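(* Let $K$ be a convex $SL$ disk of $\mathbb{R}^2$ with $m$ interior vertices. Then the space $\mathcal{E}_{\partial K}(K)$ of $SL$ homeomorphisms of $K$ keeping $\partial K$ fixed, endowed with the compact-open topology, is homeomorphic to $\mathbb{R}^{2m}$.
   Context: An $SL$ disk $K$ of $\mathbb{R}^2$ is a subset homeomorphic to the closed 2-disk together with a (finite) triangulation by affine simplices of $\mathbb{R}^2$; it is convex if it is a convex subset of $\mathbb{R}^2$. An $SL$ homeomorphism of $K$ is a homeomorphism $K\to K$ whose restriction to each simplex of the given triangulation is affine (it need not map simplices to simplices of the triangulation). Keeping $\partial K$ fixed means that the restriction to $\partial K$ is the identity. An interior vertex is a vertex of the triangulation not lying on $\partial K$. *)

(* Defs.v *)
From mathcomp Require Import all_boot all_order all_algebra finmap.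
From mathcomp Require Import all_classical all_reals topology normedtype convex.

Set Implicit Arguments.
Unset Strict Implicit.
Unset Printing Implicit Defensive.

Import Order.TTheory GRing.Theory Num.Theory.
Import numFieldNormedType.Exports.

Local Open Scope classical_set_scope.
Local Open Scope ring_scope.

Definition homeomorphism {X Y : topologicalType} (f : X -> Y) : Prop :=
  exists g : Y -> X, [/\ cancel f g, cancel g f, continuous f & continuous g].

Definition homeomorphic (X Y : topologicalType) : Prop :=
  exists f : X -> Y, homeomorphism f.

(* The topological frontier; for a disk embedded in the plane it coincides with
   the manifold boundary, by invariance of domain. *)
Definition boundary {X : topologicalType} (A : set X) : set X :=
  closure A `\` A°.

Section SLDisk.
Context {R : realType}.
Notation plane := 'rV[R]_2.

Definition closed_disk : set plane :=
  [set x | x 0 0 ^+ 2 + x 0 1 ^+ 2 <= 1].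

Definition affinely_independent (s : {fset plane}) : Prop :=
  forall c : plane -> R, \sum_(p <- s) c p = 0 -> \sum_(p <- s) c p *: p = 0 ->
  forall p, p \in s -> c p = 0.

(* The hull of the empty family is empty. *)
Definition hull (s : {fset plane}) : set plane :=
  [set x | exists c : plane -> R,
    [/\ forall p, p \in s -> 0 <= c p, \sum_(p <- s) c p = 1
      & x = \sum_(p <- s) c p *: p]].

(* A simplex is represented by its set of vertices; the common face [u] of two
   simplices may be empty. *)
Definition triangulation (T : {fset {fset plane}}) : Prop :=
  [/\ forall s, s \in T -> s != fset0 /\ affinely_independent s,
      forall s u, s \in T -> (u `<=` s)%fset -> u != fset0 -> u \in T
    & forall s t, s \in T -> t \in T ->
      exists u, [/\ (u `<=` s)%fset, (u `<=` t)%fset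
                  & hull s `&` hull t = hull u]].

Definition SL_disk (K : set plane) (T : {fset {fset plane}}) : Prop :=
  [/\ triangulation T, K = [set x | exists2 s, s \in T & hull s x]
    & homeomorphic (set_type K) (set_type closed_disk)].

Definition interior_vertices (K : set plane) (T : {fset {fset plane}}) :
    set plane :=
  [set v | [fset v]%fset \in T /\ ~ boundary K v].

Definition affine_on (K A : set plane) (f : K -> K) : Prop :=
  exists (M : 'M[R]_2) (b : plane),
    forall x : K, A (\val x) -> \val (f x) = \val x *m M + b.

Definition SL_homeo (K : set plane) (T : {fset {fset plane}}) (f : K -> K) :
    Prop :=
  homeomorphism f /\ forall s, s \in T -> affine_on (hull s) f.

Definition SL_homeo_rel_boundary (K : set plane) (T : {fset {fset plane}}) :
    set {compact-open, K -> K} :=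
  [set f | SL_homeo T f /\ forall x : K, boundary K (\val x) -> f x = x].

End SLDisk.

Arguments SL_homeo_rel_boundary {R} K T _.

(* Main.v *)
Require Import Defs.
From mathcomp Require Import all_boot all_order all_algebra finmap.
From mathcomp Require Import all_classical all_reals topology normedtype convex.
From mathcomp Require Import interval_inference.
From mathcomp Require Import ring lra.

(** A homeomorphism in question is determined by the images of the vertices, and
    the positions that occur are the admissible ones: those which extend the
    identity of the boundary and give every triangle a positive area. Indeed the
    signed crossings of a ray by the edges are antisymmetric under reversal of an
    edge, so that a generic point lies in as many triangles of an admissible
    position as of the original one, namely one.

    The ordinates [Y] of an admissible position have, at every interior vertex, a
    higher and a lower neighbour. Such [Y] are exactly the solutions of the
    Dirichlet problems with the asymmetric fluxes [(1 + p^+) s^+ - (1 + p^-) s^-],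
    one real parameter [p] per interior vertex, and [p] and [Y] determine each
    other continuously. Over a given [Y] the abscissas form an open convex
    set. It is not empty, for [Y] is harmonic for suitable positive weights and
    Tutte's theorem applies to these; the solution depends continuously on [Y],
    and radial rescaling around it identifies the fibre with a vector space.

    Tutte's theorem itself rests on a count, around each vertex, of the sign
    changes of the differences of a height function along the link: compared with
    a linear function of the original position that agrees with it on the boundary,
    no triangle can be flat. *)

Set Implicit Arguments.
Unset Strict Implicit.
Unset Printing Implicit Defensive.

Import Order.TTheory GRing.Theory Num.Theory.
Import numFieldNormedType.Exports.

Local Open Scope classical_set_scope.
Local Open Scope ring_scope.

(** * The triangulated disk as an oriented combinatorial complex *)

(** Balance at an interior vertex for the asymmetric flux reads
    [(1 + p^+) * rise = (1 + p^-) * fall], with [rise] and [fall] the total ascent and descent to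
    the neighbours. A higher and a lower neighbour make both positive; their quotient is then an
    arbitrary positive number, and [p] is a real coordinate for it. These fluxes are monotone but
    neither odd nor symmetric in the edge, so there is no energy to minimize: existence comes from
    Perron's method, uniqueness from the maximum principle, continuity from compactness and
    uniqueness together. The obstacle is that a balanced height could be constant around a vertex.
    Such plateaus, like the degenerate triangles of a Tutte drawing, are excluded by one and the
    same count. As [K] need not be strictly convex, boundary vertices may be collinear and chords
    may join them, so at the boundary sign changes are not bounded absolutely: a height is compared
    there with a linear function having the same boundary values. *)

Definition cross {R : realFieldType} (ax ay bx b_y : R) : R :=
  ax * b_y - bx * ay.

Definition area {R : realFieldType} {V : Type} (X Y : V -> R) (a b c : V) : R :=
  cross (X b - X a) (Y b - Y a) (X c - X a) (Y c - Y a).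

Lemma area_rot {R : realFieldType} {V : Type} (X Y : V -> R) a b c :
  area X Y b c a = area X Y a b c.
Proof. by rewrite /area /cross; ring. Qed.

Section Preliminaries.
Variable R : realFieldType.

Lemma exists_small (A B : R) : 0 < A ->
  exists2 e, 0 < e & forall t, 0 < t -> t <= e -> 0 < A + t * B.
Proof.
move=> A0; have nB := normr_ge0 B.
exists (A / (1 + `|B|)); first by apply: divr_gt0 => //; lra.
move=> t t0; rewrite ler_pdivlMr; last by lra.
have : - (t * `|B|) <= t * B.
  by rewrite -mulrN ler_pM2l // lerNl -normrN ler_norm.
lra.
Qed.

Lemma sum_indic_le1 (T : finType) (Q : pred T) :
  (forall x y, Q x -> Q y -> x = y) -> \sum_x ((Q x)%:R : R) <= 1.
Proof.
move=> Qu; case: (pickP Q) => [x Qx|Q0].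
  rewrite (bigD1 x) //= Qx big1 ?addr0// => y yx.
  by case: (boolP (Q y)) => // /(Qu _ _ Qx) xy; rewrite xy eqxx in yx.
by rewrite big1 ?ler01// => x _; rewrite Q0.
Qed.

Lemma sum_indic_ge1 (T : finType) (Q : pred T) x :
  Q x -> 1 <= \sum_x ((Q x)%:R : R).
Proof.
by move=> Qx; rewrite (bigD1 x) //= Qx lerDl sumr_ge0.
Qed.

(* With [e c] and [s c] the coordinates of [c] across and along [q], the
   quotient [s / e] strictly increases from [c] to its successor as long as the
   line spanned by [q] is not crossed. *)
Lemma fan_crosses (V : finType) (S : rel V) (X Y : V -> R) (A : pred V) :
    (exists c, A c) ->
    (forall c, A c -> exists2 d, S c d & A d) ->
    (forall c d, A c -> S c d -> 0 < cross (X c) (Y c) (X d) (Y d)) ->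
  forall qx qy, (qx != 0) || (qy != 0) ->
  exists c d, [/\ A c, S c d, 0 < cross (X c) (Y c) qx qy
    & cross (X d) (Y d) qx qy <= 0].
Proof.
move=> [c0 Ac0] succ pos qx qy q0.
pose n := qx ^+ 2 + qy ^+ 2.
have n0 : 0 < n.
  rewrite /n lt0r addr_ge0 ?sqr_ge0// andbT paddr_eq0 ?sqr_ge0//.
  by rewrite !sqrf_eq0 negb_and.
pose e c := cross (X c) (Y c) qx qy; pose s c := X c * qx + Y c * qy.
have es c d : A c -> S c d -> 0 < e c * s d - s c * e d.
  move=> Ac cd; have -> : e c * s d - s c * e d = cross (X c) (Y c) (X d) (Y d) * n.
    by rewrite /e /s /n /cross; ring.
  by rewrite mulr_gt0 ?pos.
have [/existsP[c /existsP[d /and4P[? ? ? ?]]]|no] := boolP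
  [exists c, exists d, [&& A c, S c d, 0 < e c & e d <= 0]].
  by exists c, d.
have {}no c d : A c -> S c d -> 0 < e c -> 0 < e d.
  move=> Ac cd ec; rewrite ltNge; apply/negP => ed; case/negP: no.
  by apply/existsP; exists c; apply/existsP; exists d; rewrite Ac cd ec ed.
case: (pickP (fun c => A c && (0 < e c))) => [c1 /= c1P|Npos].
  case: (@Order.TotalTheory.arg_maxP _ _ _ c1 (fun c => A c && (0 < e c))
    (fun c => s c / e c) c1P) => c /andP[Ac ec] cmax.
  have [d cd Ad] := succ _ Ac; have ed := no _ _ Ac cd ec.
  have : s d / e d <= s c / e c by apply: cmax; rewrite Ad ed.
  rewrite ler_pdivlMr// mulrAC.
  by rewrite ler_pdivrMr//; have := es _ _ Ac cd; lra.
have ele c : A c -> e c <= 0.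
  by move=> Ac; have := Npos c; rewrite Ac /= => /negbT; rewrite -leNgt.
have [c1 c1P] : exists c, A c && (e c < 0).
  have [ec|ec] := ltP (e c0) 0; first by exists c0; rewrite Ac0.
  have [d cd Ad] := succ _ Ac0; exists d; rewrite Ad /=.
  have e0 : e c0 = 0 by apply/eqP; rewrite eq_le ele.
  have := es _ _ Ac0 cd; rewrite e0 mul0r sub0r => H.
  by rewrite lt_neqAle ele// andbT; apply: contraTneq H => ->; rewrite mulr0 oppr0 ltxx.
case: (@Order.TotalTheory.arg_maxP _ _ _ c1 (fun c => A c && (e c < 0))
  (fun c => s c / e c) c1P) => c /andP[Ac ec] cmax.
(* All of [A] now has [e <= 0]. If [e d = 0], then [s d < 0], and positivity of the next cross
   product pushes the successor of [d] to [e > 0]. *)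
have [d cd Ad] := succ _ Ac; have := ele _ Ad; rewrite le_eqVlt => /orP[/eqP ed|ed].
  have [f df Af] := succ _ Ad.
  have := es _ _ Ac cd; have := es _ _ Ad df; rewrite ed mulr0 subr0 mul0r sub0r.
  move=> sef ecsd; have sd : s d < 0 by rewrite nmulr_rgt0 in ecsd.
  have := ele _ Af; rewrite leNgt => /negP[].
  by move: sef; rewrite -mulNr pmulr_rgt0// oppr_gt0.
have : s d / e d <= s c / e c by apply: cmax; rewrite Ad ed.
rewrite ler_ndivlMr// mulrAC.
by rewrite ler_ndivlMr//; have := es _ _ Ac cd; lra.
Qed.

End Preliminaries.

Section DiskComplex.
Variables (R : realFieldType) (V : finType) (O : V -> V -> V -> bool)
  (B : pred V) (px py : V -> R).

Definition nbr (v u : V) : bool := [exists c, O v u c].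

(* [O a b c] holds for the positively oriented triangles of a triangulated
   convex polygon with boundary vertices [B] and vertex coordinates [px, py]. *)
Record disk_complex : Prop := DiskComplex {
  cx_rot : forall a b c, O a b c -> O b c a;
  cx_pos : forall a b c, O a b c -> 0 < area px py a b c;
  cx_cone : forall v a b c d, O v a b -> O v c d -> forall qx qy,
    0 < cross (px a - px v) (py a - py v) qx qy ->
    0 < cross qx qy (px b - px v) (py b - py v) ->
    0 < cross (px c - px v) (py c - py v) qx qy ->
    0 < cross qx qy (px d - px v) (py d - py v) -> a = c /\ b = d;
  cx_opp : forall a b c, O a b c -> ~~ (B a && B b) -> exists d, O b a d;
  cx_star : forall v, exists a b, O v a b;
  cx_conn : forall A : pred V, (exists v, A v) ->
    (forall v u, A v -> nbr v u -> A u) -> forall v, A v;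
  cx_convex : forall al be v a b c d, B v -> O v a b -> O v c d ->
    let psi u := al * px u + be * py u in
    psi v < psi a -> psi b <= psi v -> psi c <= psi v -> psi v < psi d ->
    forall u, psi v <= psi u }.

Hypothesis K : disk_complex.

Let rx v u := px u - px v.
Let ry v u := py u - py v.

Lemma cx_rot2 a b c : O a b c -> O c a b.
Proof. by move=> /(cx_rot K)/(cx_rot K). Qed.

(** Turning [q] slightly towards [a] makes the weak inequalities strict and keeps the strict ones,
    after which [cx_cone] applies. If [q] points along [d], a three-term identity between cross
    products shows that [d] lies to the left of [a]. A cone thus owns its second bounding ray
    only. *)
Lemma halfopen_coneR v a b c d qx qy : O v a b -> O v c d ->
  0 < cross (rx v a) (ry v a) qx qy -> 0 <= cross qx qy (rx v b) (ry v b) ->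
  0 < cross (rx v c) (ry v c) qx qy -> 0 <= cross qx qy (rx v d) (ry v d) ->
  a = c /\ b = d.
Proof.
move=> ab cd aq qb cq qd.
have [e1 e10 H1] := exists_small (cross (rx v c) (ry v c) (rx v a) (ry v a)) cq.
have pab := cx_pos K ab; have pcd := cx_pos K cd; rewrite /area -/(rx _ _) in pab pcd.
have [e2 e20 H2] : exists2 e, 0 < e & forall t, 0 < t -> t <= e ->
    0 < cross qx qy (rx v d) (ry v d) + t * cross (rx v a) (ry v a) (rx v d) (ry v d).
  move: qd; rewrite le_eqVlt => /orP[/eqP qd|qd]; last exact: exists_small.
  exists 1 => // t t0 _; rewrite -qd add0r mulr_gt0//.
  have : 0 < cross (rx v c) (ry v c) qx qy * cross (rx v a) (ry v a) (rx v d) (ry v d).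
    have -> : cross (rx v c) (ry v c) qx qy * cross (rx v a) (ry v a) (rx v d) (ry v d)
      = cross (rx v c) (ry v c) (rx v d) (ry v d) * cross (rx v a) (ry v a) qx qy -
        cross qx qy (rx v d) (ry v d) * cross (rx v a) (ry v a) (rx v c) (ry v c).
      by rewrite /cross; ring.
    by rewrite -qd mul0r subr0 mulr_gt0.
  by rewrite pmulr_rgt0.
pose t := Num.min e1 e2; have t0 : 0 < t by rewrite lt_min e10.
apply: (cx_cone K ab cd (qx := qx + t * rx v a) (qy := qy + t * ry v a)).
- by move: aq; rewrite /cross /rx /ry; congr (0 < _); ring.
- have -> : cross (qx + t * rx v a) (qy + t * ry v a) (px b - px v) (py b - py v) =
    cross qx qy (rx v b) (ry v b) + t * cross (rx v a) (ry v a) (rx v b) (ry v b).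
    by rewrite /cross /rx /ry; ring.
  by apply: ltr_wpDl => //; apply: mulr_gt0.
- have := H1 t t0; rewrite ge_min lexx => /(_ isT).
  by congr (0 < _); rewrite /cross /rx /ry; ring.
- have := H2 t t0; rewrite ge_min lexx orbT => /(_ isT).
  by congr (0 < _); rewrite /cross /rx /ry; ring.
Qed.

(** Mirror image: here a cone owns its first ray, and [q] is turned towards [b]. *)
Lemma halfopen_coneL v a b c d qx qy : O v a b -> O v c d ->
  0 <= cross (rx v a) (ry v a) qx qy -> 0 < cross qx qy (rx v b) (ry v b) ->
  0 <= cross (rx v c) (ry v c) qx qy -> 0 < cross qx qy (rx v d) (ry v d) ->
  a = c /\ b = d.
Proof.
move=> ab cd aq qb cq qd.
have [e1 e10 H1] := exists_small (cross (rx v b) (ry v b) (rx v d) (ry v d)) qd.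
have pab := cx_pos K ab; have pcd := cx_pos K cd; rewrite /area -/(rx _ _) in pab pcd.
have [e2 e20 H2] : exists2 e, 0 < e & forall t, 0 < t -> t <= e ->
    0 < cross (rx v c) (ry v c) qx qy + t * cross (rx v c) (ry v c) (rx v b) (ry v b).
  move: cq; rewrite le_eqVlt => /orP[/eqP cq|cq]; last exact: exists_small.
  exists 1 => // t t0 _; rewrite -cq add0r mulr_gt0//.
  have : 0 < cross qx qy (rx v d) (ry v d) * cross (rx v c) (ry v c) (rx v b) (ry v b).
    have -> : cross qx qy (rx v d) (ry v d) * cross (rx v c) (ry v c) (rx v b) (ry v b)
      = cross (rx v c) (ry v c) (rx v d) (ry v d) * cross qx qy (rx v b) (ry v b) +
        cross (rx v c) (ry v c) qx qy * cross (rx v b) (ry v b) (rx v d) (ry v d).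
      by rewrite /cross; ring.
    by rewrite -cq mul0r addr0 mulr_gt0.
  by rewrite pmulr_rgt0.
pose t := Num.min e1 e2; have t0 : 0 < t by rewrite lt_min e10.
apply: (cx_cone K ab cd (qx := qx + t * rx v b) (qy := qy + t * ry v b)).
- have -> : cross (px a - px v) (py a - py v) (qx + t * rx v b) (qy + t * ry v b) =
    cross (rx v a) (ry v a) qx qy + t * cross (rx v a) (ry v a) (rx v b) (ry v b).
    by rewrite /cross /rx /ry; ring.
  by apply: ltr_wpDl => //; apply: mulr_gt0.
- by move: qb; rewrite /cross /rx /ry; congr (0 < _); ring.
- have := H2 t t0; rewrite ge_min lexx orbT => /(_ isT).
  by congr (0 < _); rewrite /cross /rx /ry; ring.
- have := H1 t t0; rewrite ge_min lexx => /(_ isT).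
  by congr (0 < _); rewrite /cross /rx /ry; ring.
Qed.

Lemma cx_uniq v a b c : O v a b -> O v a c -> b = c.
Proof.
move=> ab ac; have pab := cx_pos K ab; have pac := cx_pos K ac.
have aa : cross (rx v a) (ry v a) (rx v a) (ry v a) = 0.
  by rewrite /cross mulrC subrr.
by have [] := halfopen_coneL (qx := rx v a) (qy := ry v a) ab ac; rewrite ?aa.
Qed.

Lemma cx_uniq_pred v a b c : O v a c -> O v b c -> a = b.
Proof. by move=> /cx_rot2 ac /cx_rot2 bc; exact: cx_uniq ac bc. Qed.

Lemma cx_succ v a b : O v a b -> ~~ (B b && B v) -> exists c, O v b c.
Proof. by move=> /cx_rot2 vab /(cx_opp K vab). Qed.

Lemma cx_pred v a b : O v a b -> ~~ (B v && B a) -> exists c, O v c a.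
Proof. by move=> vab /(cx_opp K vab)[c /(cx_rot K) avc]; exists c. Qed.

(** Around an interior vertex every link vertex has a successor, as [fan_crosses] requires. The
    coordinates are arbitrary because both the reference position and admissible positions are
    used. *)
Lemma fan_cross (X Y : V -> R) v (A : pred V) : ~~ B v ->
  (forall a b, O v a b -> 0 < area X Y v a b) ->
  (exists a b, O v a b /\ A a) -> (forall a b, O v a b -> A a -> A b) ->
  forall qx qy, (qx != 0) || (qy != 0) ->
  exists a b, [/\ A a, O v a b, 0 < cross (X a - X v) (Y a - Y v) qx qy
    & cross (X b - X v) (Y b - Y v) qx qy <= 0].
Proof.
move=> Bv pos [a0 [b0 [ab0 Aa0]]] Asucc qx qy q0.
have [|||a [b [/andP[Aa _] ab ? ?]]] := @fan_crosses R V (O v)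
  (fun u => X u - X v) (fun u => Y u - Y v)
  (fun a => A a && [exists b, O v a b]) _ _ _ qx qy q0.
- by exists a0; rewrite Aa0; apply/existsP; exists b0.
- move=> a /andP[Aa /existsP[b ab]]; exists b => //.
  rewrite (Asucc _ _ ab Aa); apply/existsP.
  by apply: (cx_succ ab); rewrite (negbTE Bv) andbF.
- by move=> a b _ ab; exact: pos.
- by exists a, b.
Qed.

(** [O v a b] is read as an arrow from [a] to [b] in the link of [v]; [cut] counts the passages
    between [P] and its complement along the link. *)
Definition out_edges v (P : pred V) : R :=
  \sum_(x : V * V) (O v x.1 x.2 && (P x.1 && ~~ P x.2))%:R.
Definition in_edges v (P : pred V) : R :=
  \sum_(x : V * V) (O v x.1 x.2 && (~~ P x.1 && P x.2))%:R.
Definition cut v (P : pred V) : R :=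
  \sum_(x : V * V) (O v x.1 x.2 && (P x.1 != P x.2))%:R.

Lemma cutE v P : cut v P = out_edges v P + in_edges v P.
Proof.
rewrite /cut -big_split; apply: eq_bigr => x _ /=.
by case: (O _ _ _) (P _) (P _) => [] [] []; rewrite /= ?addr0 ?add0r.
Qed.

Lemma out_edges_ge0 v P : 0 <= out_edges v P.
Proof. exact: sumr_ge0. Qed.
Lemma in_edges_ge0 v P : 0 <= in_edges v P.
Proof. exact: sumr_ge0. Qed.

Lemma net_edges v P : out_edges v P - in_edges v P =
  \sum_u (P u)%:R * (\sum_d (O v u d)%:R - \sum_c (O v c u)%:R).
Proof.
under [RHS]eq_bigr => u _ do rewrite mulrBr !mulr_sumr.
rewrite [RHS]sumrB [X in _ = _ - X]exchange_big /= !pair_big /= -sumrB -sumrB /=.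
apply: eq_bigr => x _.
by case: (O _ _ _) (P _) (P _) => [] [] []; rewrite /= ?(mul0r, mulr0, mulr1, subrr, subr0).
Qed.

(** Uniqueness of successor and predecessor bounds both degrees by 1, and unless [u] and [v] both
    lie on the boundary, each exists when the other does. *)
Lemma degree_balance v u : ~~ (B u && B v) ->
  \sum_d ((O v u d)%:R : R) = \sum_c (O v c u)%:R.
Proof.
move=> Buv; have le1 : \sum_d ((O v u d)%:R : R) <= 1.
  by apply: sum_indic_le1 => x y; exact: cx_uniq.
have le2 : \sum_d ((O v d u)%:R : R) <= 1.
  by apply: sum_indic_le1 => x y; exact: cx_uniq_pred.
case: (pickP (O v u)) => [d vud|no].
  have [|c vcu] := cx_pred vud; first by rewrite andbC.
  apply/le_anti/andP; split.
    by apply: le_trans le1 _; exact: (sum_indic_ge1 _ vcu).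
  by apply: le_trans le2 _; exact: (sum_indic_ge1 _ vud).
rewrite !big1// => c _; last by rewrite no.
by case: (boolP (O v c u)) => // /cx_succ/(_ Buv)[d]; rewrite no.
Qed.

(** In [net_edges] only unbalanced link vertices carry weight, and these are on the boundary
    together with [v]; the net number of exits is therefore boundary data. *)
Lemma net_edges_eq v (P Q : pred V) : (forall u, B u -> B v -> P u = Q u) ->
  out_edges v P - in_edges v P = out_edges v Q - in_edges v Q.
Proof.
move=> PQ; rewrite !net_edges; apply: eq_bigr => u _.
have [/andP[Bu Bv]|/degree_balance ->] := boolP (B u && B v).
  by rewrite PQ.
by rewrite subrr !mulr0.
Qed.

Lemma net_edges0 v P : ~~ B v -> out_edges v P = in_edges v P.
Proof.
move=> Bv; have := @net_edges_eq v P xpred0; rewrite (negbTE Bv) => /(_ ltac:(by [])).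
have -> : out_edges v xpred0 = 0 by apply: big1 => x _; rewrite andbF.
have -> : in_edges v xpred0 = 0 by apply: big1 => x _; rewrite !andbF.
by rewrite subrr => /eqP; rewrite subr_eq0 => /eqP.
Qed.

(* Both a proper nonempty set of link vertices closed under successor and its
   complement would wind around [v], so that two triangles would overlap. *)
Lemma cut_ge2 v (P : pred V) : ~~ B v ->
  (exists2 u, nbr v u & P u) -> (exists2 u, nbr v u & ~~ P u) -> 2 <= cut v P.
Proof.
move=> Bv [u /existsP[c uc] Pu] [w /existsP[d wd] Pw].
rewrite cutE (net_edges0 _ Bv).
suff : 1 <= in_edges v P by lra.
case: (pickP (fun x : V * V => O v x.1 x.2 && (~~ P x.1 && P x.2))) => [x xP|no].
  exact: (@sum_indic_ge1 R _ (fun x : V * V => O v x.1 x.2 && (~~ P x.1 && P x.2)) x xP).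
have in0 : in_edges v P = 0 by rewrite /in_edges big1// => x _; rewrite no.
have out0 : out_edges v P = 0 by rewrite net_edges0.
have no' a b : O v a b -> P a -> P b.
  move=> ab Pa; apply: contra_eqT out0 => Pb; rewrite gt_eqF//.
  apply: lt_le_trans ltr01 _.
  apply: (@sum_indic_ge1 R _ (fun x : V * V => O v x.1 x.2 && (P x.1 && ~~ P x.2)) (a, b)).
  by rewrite /= ab Pa Pb.
have no2 a b : O v a b -> ~~ P a -> ~~ P b.
  by move=> ab Pa; have := no (a, b); rewrite /= ab Pa /= => ->.
have q0 : ((1 : R) != 0) || ((0 : R) != 0) by rewrite oner_eq0.
have pos a b : O v a b -> 0 < area px py v a b by exact: (cx_pos K).
have [|a1 [b1 [Pa1 ab1 e1 e2]]] := fan_cross Bv pos _ no' q0.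
  by exists u, c.
have [|a2 [b2 [Pa2 ab2 e3 e4]]] := fan_cross Bv pos _ no2 q0.
  by exists w, d.
have crossN ax ay bx b_y : cross bx b_y ax ay = - cross ax ay bx b_y :> R.
  by rewrite /cross; ring.
have [||a12 _] := halfopen_coneR ab1 ab2 e1 _ e3.
- by rewrite crossN oppr_ge0.
- by rewrite crossN oppr_ge0.
- by move: Pa2; rewrite -a12 Pa1.
Qed.

(** * Sign changes of heights around a vertex *)

Section Heights.
Implicit Types h : V -> R.

Definition up h v : pred V := fun u => h v < h u.
Definition dn h v : pred V := fun u => h u < h v.
Definition flat h a b c := (h a == h b) && (h b == h c).
(** Sign changes of [h - h v] along the link edge from [a] to [b]: 2 when [v] has the strictly
    middle height, 1 when it ties with exactly one of the others, 0 otherwise. So every triangle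
    that is not flat hands out 2 to its corners. *)
Definition mid h v a b : R :=
  (up h v a != up h v b)%:R + (dn h v a != dn h v b)%:R.

Lemma mid_sum h a b c : ~~ flat h a b c -> mid h a b c + mid h b c a + mid h c a b = 2.
Proof.
rewrite /flat /mid /up /dn.
case: (ltgtP (h a) (h b)) => ab; case: (ltgtP (h b) (h c)) => bc;
  case: (ltgtP (h a) (h c)) => ac //= _; lra.
Qed.

Lemma sum_mid h v : \sum_(x : V * V | O v x.1 x.2) mid h v x.1 x.2 =
  cut v (up h v) + cut v (dn h v).
Proof.
rewrite big_mkcond -big_split /=; apply: eq_bigr => x _.
by case: (O _ _ _); rewrite /= ?addr0.
Qed.

Lemma total_rot (F : V -> V -> V -> R) :
  \sum_v \sum_(x : V * V | O v x.1 x.2) F v x.1 x.2 =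
  \sum_v \sum_(x : V * V | O v x.1 x.2) F x.1 x.2 v.
Proof.
rewrite !pair_big_dep /=.
rewrite (reindex (fun x : V * (V * V) => (x.2.1, (x.2.2, x.1)))) /=; last first.
  by exists (fun x : V * (V * V) => (x.2.2, (x.1, x.2.1))) => -[? []].
apply: eq_bigl => -[a [b c]] /=; apply/idP/idP => [/cx_rot2|/(cx_rot K)] //.
Qed.

(** The double sum lists each triangle once per corner; adding the three rotated copies of the sum
    replaces [F] by the constant 2, hence the factor 3. *)
Lemma total_count (F : V -> V -> V -> R) :
  (forall a b c, O a b c -> F a b c + F b c a + F c a b = 2) ->
  3 * (\sum_v \sum_(x : V * V | O v x.1 x.2) F v x.1 x.2) =
  \sum_v \sum_(x : V * V | O v x.1 x.2) 2.
Proof.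
move=> F2; set S := \sum_v _.
have S1 := total_rot F; have S2 := total_rot (fun a b c => F b c a).
transitivity (S + \sum_v \sum_(x : V * V | O v x.1 x.2) F x.1 x.2 v +
    \sum_v \sum_(x : V * V | O v x.1 x.2) F x.2 v x.1).
  by rewrite -S2 -S1 -/S; ring.
rewrite /S -!big_split /=; apply: eq_bigr => v _.
by rewrite -!big_split /=; apply: eq_bigr => x /F2.
Qed.

Section Linear.
Variables al be : R.
Hypothesis albe : (al != 0) || (be != 0).
Let psi u := al * px u + be * py u.

Let psi_cross v u :
  cross (px u - px v) (py u - py v) (- be) al = psi u - psi v.
Proof. by rewrite /cross /psi; ring. Qed.

Let psi_crossN v u :
  cross (- be) al (px u - px v) (py u - py v) = psi v - psi u.
Proof. by rewrite /cross /psi; ring. Qed.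

Lemma linear_up v : ~~ B v -> exists2 u, nbr v u & psi v < psi u.
Proof.
move=> Bv; have [a [b ab]] := cx_star K v.
have pos a' b' : O v a' b' -> 0 < area px py v a' b' by exact: (cx_pos K).
have [|||c [d [_ cd]]] := @fan_cross px py v predT Bv pos _ _ (- be) al.
- by exists a, b.
- by [].
- by rewrite oppr_eq0 orbC.
rewrite psi_cross subr_gt0 => ? _; exists c => //; apply/existsP; by exists d.
Qed.

(** An arrow leaving the upper side sweeps over the ray [(- be, al)] of the level line through [v],
    and only one half-open cone contains that ray. Arrows coming back sweep over the opposite
    ray. *)
Lemma linear_out_le1 v : out_edges v (up psi v) <= 1.
Proof.
apply: sum_indic_le1 => -[a b] [c d] /=; rewrite /up.
move=> /and3P[ab va vb] /and3P[cd vc vd].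
have [||||-> -> //] := @halfopen_coneR v a b c d (- be) al ab cd.
- by rewrite psi_cross subr_gt0.
- by rewrite psi_crossN subr_ge0 leNgt.
- by rewrite psi_cross subr_gt0.
- by rewrite psi_crossN subr_ge0 leNgt.
Qed.

Lemma linear_in_le1 v : in_edges v (up psi v) <= 1.
Proof.
apply: sum_indic_le1 => -[a b] [c d] /=; rewrite /up.
move=> /and3P[ab va vb] /and3P[cd vc vd].
have crossNN ax ay : cross ax ay be (- al) = - cross ax ay (- be) al :> R.
  by rewrite /cross; ring.
have crossNN' ax ay : cross be (- al) ax ay = - cross (- be) al ax ay :> R.
  by rewrite /cross; ring.
have [||||-> -> //] := @halfopen_coneL v a b c d be (- al) ab cd.
- by rewrite crossNN psi_cross opprB subr_ge0 leNgt.
- by rewrite crossNN' psi_crossN opprB subr_gt0.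
- by rewrite crossNN psi_cross opprB subr_ge0 leNgt.
- by rewrite crossNN' psi_crossN opprB subr_gt0.
Qed.

Lemma linear_cut_le2 v : cut v (up psi v) <= 2.
Proof. by rewrite cutE; have := linear_in_le1 v; have := linear_out_le1 v; lra. Qed.

(** The difference of exits and entries is boundary data, the same for [h] and [psi]. By
    [cx_convex], away from the minima of [psi] one of the two numbers vanishes for [psi], so its cut
    is the absolute value of that difference, the least possible. *)
Lemma linear_cut_boundary v h : B v -> (exists u, psi u < psi v) ->
  (forall u, B u -> h u = psi u) -> cut v (up psi v) <= cut v (up h v).
Proof.
move=> Bv [u uv] hB.
have : out_edges v (up psi v) = 0 \/ in_edges v (up psi v) = 0.
  case: (pickP (fun x : V * V => O v x.1 x.2 && (up psi v x.1 && ~~ up psi v x.2)))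
    => [[a b] /= /and3P[ab va vb]|no].
    case: (pickP (fun x : V * V => O v x.1 x.2 && (~~ up psi v x.1 && up psi v x.2)))
      => [[c d] /= /and3P[cd vc vd]|no].
      have : psi v <= psi u.
        apply: (cx_convex K Bv ab cd (al := al) (be := be)) => //.
        - by rewrite leNgt; exact: vb.
        - by rewrite leNgt; exact: vc.
      by rewrite leNgt uv.
    by right; rewrite /in_edges big1// => x _; rewrite no.
  by left; rewrite /out_edges big1// => x _; rewrite no.
have := @net_edges_eq v (up h v) (up psi v).
have uE w : B w -> B v -> up h v w = up psi v w by move=> Bu _; rewrite /up !hB.
move=> /(_ uE) {uE}.
rewrite !cutE; have := out_edges_ge0 v (up h v); have := in_edges_ge0 v (up h v).
by move=> ? ? ? []; lra.
Qed.

(* Strong maximum principle: a vertex of the plateau of maximal height lowest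
   for [psi] has a [psi]-lower neighbour, which cannot be of that height. *)
Lemma max_principle h b v : B b -> (forall u, psi u <= psi b) ->
  (forall u, B u -> h u = psi u) ->
  (forall u, ~~ B u -> (exists2 w, nbr u w & h u < h w) \/
                       (forall w, nbr u w -> h w = h u)) ->
  ~~ B v -> h v < psi b.
Proof.
move=> Bb bmax hB hI Bv; rewrite ltNge; apply/negP => hv.
case: (@Order.TotalTheory.arg_maxP _ _ _ v predT h isT) => v0 _ v0max'.
have v0max u : h u <= h v0 by exact: v0max'.
have Bv0 : psi b <= h v0 by exact: le_trans hv (v0max v).
have [v1 v1P] : exists v1, ~~ B v1 && (h v1 == h v0).
  have [Bv0'|?] := boolP (B v0); last by exists v0; rewrite eqxx andbT.
  exists v; rewrite Bv eq_le v0max //= (le_trans _ hv)// hB//.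
case: (@Order.TotalTheory.arg_minP _ _ _ v1 (fun u => ~~ B u && (h u == h v0)) psi v1P)
  => w /andP[Bw /eqP hw] wmin.
have plateau u : nbr w u -> h u = h w.
  case: (hI _ Bw) => [[z wz hz]|]; last by exact.
  by have := v0max z; rewrite leNgt -hw hz.
have linN : exists2 u, nbr w u & psi u < psi w.
  have [a [c ac]] := cx_star K w.
  have pos a' b' : O w a' b' -> 0 < area px py w a' b' by exact: (cx_pos K).
  have [|||a1 [b1 [_ ab1]]] := @fan_cross px py w predT Bw pos _ _ be (- al).
  - by exists a, c.
  - by [].
  - by rewrite oppr_eq0 orbC.
  have -> : cross (px a1 - px w) (py a1 - py w) be (- al) = psi w - psi a1.
    by rewrite /cross /psi; ring.
  rewrite subr_gt0 => ? _; exists a1 => //; apply/existsP; by exists b1.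
have [u wu uw] := linN; have hu := plateau _ wu.
have [Bu|Bu] := boolP (B u).
  by have := bmax w; rewrite leNgt (le_lt_trans _ uw)// -(hB u Bu) hu hw.
by have : psi w <= psi u by [apply: wmin; rewrite Bu hu hw eqxx]; rewrite leNgt uw.
Qed.

End Linear.

Lemma eq_cut v (P Q : pred V) : P =1 Q -> cut v P = cut v Q.
Proof. by move=> PQ; apply: eq_bigr => x _; rewrite !PQ. Qed.

Lemma linear_dn al be v :
  dn (fun u => al * px u + be * py u) v =1
  up (fun u => (- al) * px u + (- be) * py u) v.
Proof. by move=> u; rewrite /up /dn !mulNr -!opprD ltrN2. Qed.

Lemma linear_not_flat al be a b c : (al != 0) || (be != 0) -> O a b c ->
  ~~ flat (fun u => al * px u + be * py u) a b c.
Proof.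
move=> albe abc; have D0 := cx_pos K abc; set D := area _ _ _ _ _ in D0.
apply/negP => /andP[/eqP e1 /eqP e2].
have alD : al * D = 0.
  have -> : al * D = (al * px b + be * py b - (al * px a + be * py a)) * (py c - py a)
    - (al * px c + be * py c - (al * px a + be * py a)) * (py b - py a).
    by rewrite /D /area /cross; ring.
  by rewrite -e2 -e1 subrr !mul0r subr0.
have beD : be * D = 0.
  have -> : be * D = (al * px c + be * py c - (al * px a + be * py a)) * (px b - px a)
    - (al * px b + be * py b - (al * px a + be * py a)) * (px c - px a).
    by rewrite /D /area /cross; ring.
  by rewrite -e2 -e1 subrr !mul0r subr0.
move: alD beD => /eqP; rewrite mulf_eq0 [D == 0]gt_eqF// orbF => /eqP al0.
move=> /eqP; rewrite mulf_eq0 [D == 0]gt_eqF// orbF => /eqP be0.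
by rewrite al0 be0 eqxx in albe.
Qed.

Lemma boundary_max al be : (al != 0) || (be != 0) ->
  let psi u := al * px u + be * py u in V -> exists2 b, B b & forall u, psi u <= psi b.
Proof.
move=> albe psi v.
case: (@Order.TotalTheory.arg_maxP _ _ _ v predT psi isT) => b _ bmax.
exists b => [|u]; last exact: bmax.
apply/negPn/negP => /(linear_up albe)[u _]; rewrite -/(psi b) -/(psi u).
by rewrite ltNge => /negP[]; exact: bmax.
Qed.

Definition regular h v := (exists2 u, nbr v u & h v < h u) /\
                          (exists2 u, nbr v u & h u < h v).

Section NoFlat.
Variables (al be : R) (h : V -> R).
Hypothesis albe : (al != 0) || (be != 0).
Hypothesis hB : forall u, B u -> h u = al * px u + be * py u.
Hypothesis hI : forall v, ~~ B v -> regular h v \/ forall u, nbr v u -> h u = h v.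

Let psi u := al * px u + be * py u.

(** [linear_cut_boundary] leaves out the minima of [psi]. There the maximum principle, applied to
    [- h] and to [- psi], puts every interior vertex strictly above [v], so the same vertices are
    above [v] for both. *)
Lemma boundary_cut_up v : B v -> cut v (up psi v) <= cut v (up h v).
Proof.
move=> Bv; have [/existsP[u uv]|no] := boolP [exists u, psi u < psi v].
  by apply: linear_cut_boundary => //; exists u.
have vmin u : psi v <= psi u.
  by rewrite leNgt; apply: contra no => uv; apply/existsP; exists u.
rewrite le_eqVlt (@eq_cut v (up psi v) (up h v)) ?eqxx// => u.
rewrite /up (hB Bv) -/(psi v).
have [/hB ->//|Bu] := boolP (B u).
have albeN : (- al != 0) || (- be != 0) by rewrite !oppr_eq0.
have psiN w : - al * px w + - be * py w = - psi w.
  by rewrite /psi !mulNr opprD.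
have mx (k : V -> R) : (forall w, B w -> k w = psi w) ->
    (forall w, ~~ B w -> regular k w \/ forall u, nbr w u -> k u = k w) -> psi v < k u.
  move=> kB kI; rewrite -ltrN2 -psiN.
  apply: (@max_principle _ _ albeN (fun w => - k w) v u Bv) => //.
  - by move=> w; rewrite !psiN lerN2.
  - by move=> w Bw; rewrite psiN kB.
  - move=> w Bw; have [[_ [z wz zw]]|all] := kI w Bw; [left|right].
      by exists z => //; rewrite ltrN2.
    by move=> z wz; rewrite all.
rewrite (mx h)// (mx psi)// => w Bw; left; split; first exact: (linear_up albe).
have [z wz] := linear_up albeN Bw; rewrite !psiN ltrN2 => ?; by exists z.
Qed.

End NoFlat.

(** Double counting: every triangle scores 2 for [psi], and also for [h] if flat triangles are
    scored by an auxiliary linear [phi]. Vertex by vertex [h] scores at least as much as [psi]: at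
    the boundary by [boundary_cut_up], at regular vertices because [h] has at least 4 and [psi] at
    most 4, on plateaus because [phi] does the scoring. A flat triangle makes the inequality strict
    at some vertex. *)
Lemma no_flat al be h a b c : (al != 0) || (be != 0) ->
  (forall u, B u -> h u = al * px u + be * py u) ->
  (forall v, ~~ B v -> regular h v \/ forall u, nbr v u -> h u = h v) ->
  O a b c -> ~~ flat h a b c.
Proof.
move=> albe hB hI abc; apply/negP => fabc.
pose psi u := al * px u + be * py u.
have albeN : (- al != 0) || (- be != 0) by rewrite !oppr_eq0.
have flatR x y z : flat h y z x = flat h x y z.
  rewrite /flat; case: (eqVneq (h y) (h z)) => [->|]; last by rewrite andbF.
  by rewrite andbT eq_sym.
(* Some flat triangle has a corner that is regular or on the boundary: otherwise flatness would
   spread through plateaus to every vertex, and some vertex is on the boundary. *)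
have [v [x [y [vxy fvxy vB]]]] : exists v x y, [/\ O v x y, flat h v x y &
    B v \/ regular h v].
  have [/existsP[v /existsP[x /existsP[y /and4P[vxy fl _ /orP[]]]]]|no] := boolP
    [exists v, exists x, exists y, [&& O v x y, flat h v x y, true & B v ||
      [exists u, nbr v u && (h u != h v)]]].
  - by exists v, x, y; split => //; left.
  - move=> /existsP[u /andP[vu huv]]; exists v, x, y; split => //.
    have [|Bv] := boolP (B v); [by left|right].
    by have [//|all] := hI v Bv; rewrite all ?eqxx in huv.
  pose A v := [exists x, exists y, O v x y && flat h v x y].
  have AN v : A v -> ~~ B v /\ forall u, nbr v u -> h u = h v.
    move=> /existsP[x /existsP[y /andP[vxy fl]]].
    have Nv : ~~ (B v || [exists u, nbr v u && (h u != h v)]).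
      apply: contra no => H; apply/existsP; exists v; apply/existsP; exists x.
      by apply/existsP; exists y; rewrite vxy fl H.
    move: Nv; rewrite negb_or => /andP[-> /existsPn Nv]; split => // u vu.
    by have := Nv u; rewrite vu /= negbK => /eqP.
  have Aall : forall v, A v.
    apply: (cx_conn K).
      by exists a; apply/existsP; exists b; apply/existsP; exists c; rewrite abc.
    move=> v u Av /existsP[w vuw]; have [_ all] := AN v Av.
    apply/existsP; exists w; apply/existsP; exists v; rewrite (cx_rot K vuw) flatR /flat.
    have Bv := proj1 (AN v Av).
    rewrite [h u]all ?[h w]all ?eqxx//; last by apply/existsP; exists w.
    by apply/existsP; apply: (cx_succ vuw); rewrite negb_and Bv orbT.
  have [d Bd _] := boundary_max albe a.
  by have [] := AN d (Aall d); rewrite Bd.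
have D0 := cx_pos K vxy; set D := area _ _ _ _ _ in D0.
(* The gradient of [phi] is chosen so that [v] lies strictly between [x] and [y]; the flat triangle
   then scores the full 2 at [v], on top of the cuts of [h]. *)
have [ga [de [gade phix phiy]]] : exists ga de,
    let phi u := ga * px u + de * py u in
    [/\ (ga != 0) || (de != 0), phi x - phi v = D & phi y - phi v = - D].
  exists ((py x - py v) + (py y - py v)), (- ((px x - px v) + (px y - px v))).
  split; try by rewrite /D /area /cross; ring.
  apply/negPn/negP; rewrite negb_or !negbK => /andP[/eqP e1 /eqP e2].
  suff D0' : D = 0 by rewrite D0' ltxx in D0.
  have -> : D = ((py x - py v) + (py y - py v)) * (px x - px v) +
    (- ((px x - px v) + (px y - px v))) * (py x - py v).
    by rewrite /D /area /cross; ring.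
  by rewrite e1 e2 !mul0r addr0.
pose phi u := ga * px u + de * py u; rewrite -/(phi x) -/(phi y) -/(phi v) in phix phiy.
have gadeN : (- ga != 0) || (- de != 0) by rewrite !oppr_eq0.
pose F v a b := if flat h v a b then mid phi v a b else mid h v a b.
pose fl v := \sum_(x : V * V | O v x.1 x.2) if flat h v x.1 x.2 then mid phi v x.1 x.2 else 0.
have mid_ge0 k u z w : 0 <= mid k u z w by rewrite /mid addr_ge0.
have fl_ge0 u : 0 <= fl u by apply: sumr_ge0 => z _; case: ifP.
have FE u : \sum_(x : V * V | O u x.1 x.2) F u x.1 x.2 =
    cut u (up h u) + cut u (dn h u) + fl u.
  rewrite -sum_mid -big_split /=; apply: eq_bigr => z _; rewrite /F.
  case: ifPn; rewrite ?addr0// => /andP[/eqP e1 /eqP e2].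
  by rewrite /mid /up /dn -e2 -e1 !ltxx eqxx !add0r.
have GE u : \sum_(x : V * V | O u x.1 x.2) mid psi u x.1 x.2 =
    cut u (up psi u) + cut u (dn psi u) by rewrite -sum_mid.
have tot : \sum_v \sum_(x : V * V | O v x.1 x.2) F v x.1 x.2 =
           \sum_v \sum_(x : V * V | O v x.1 x.2) mid psi v x.1 x.2.
  apply: (@mulfI _ 3); first by rewrite pnatr_eq0.
  rewrite !total_count// => p q r pqr.
    by rewrite mid_sum// linear_not_flat.
  rewrite /F (flatR p q r) -(flatR r p q); case: ifPn => fpqr; rewrite mid_sum//.
  exact: linear_not_flat.
have strict u : B u \/ regular h u -> cut u (up psi u) + cut u (dn psi u) <=
    cut u (up h u) + cut u (dn h u).
  move=> uB; have [Bu|Bu] := boolP (B u).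
    apply: lerD; first exact: boundary_cut_up.
    rewrite (eq_cut _ (linear_dn al be u)).
    have -> : cut u (dn h u) = cut u (up (fun w => - h w) u).
      by apply: eq_cut => w; rewrite /up /dn ltrN2.
    apply: boundary_cut_up => //.
    - by move=> w /hB ->; rewrite !mulNr opprD.
    - move=> w Bw; have [[[z1 ? ?] [z2 ? ?]]|all] := hI w Bw; [left|right].
        by split; [exists z2|exists z1]; rewrite ?ltrN2.
      by move=> z /all ->.
  case: uB => [|[[z1 uz1 hz1] [z2 uz2 hz2]]]; first by rewrite (negbTE Bu).
  have : 2 <= cut u (up h u).
    by apply: cut_ge2 => //; [exists z1|exists z2]; rewrite // /up -leNgt ltW.
  have : 2 <= cut u (dn h u).
    by apply: cut_ge2 => //; [exists z2|exists z1]; rewrite // /dn -leNgt ltW.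
  have := linear_cut_le2 al be u; have := linear_cut_le2 (- al) (- be) u.
  rewrite -(eq_cut _ (linear_dn al be u)) -/psi; lra.
have weak u : \sum_(x : V * V | O u x.1 x.2) mid psi u x.1 x.2 <=
    \sum_(x : V * V | O u x.1 x.2) F u x.1 x.2.
  rewrite FE GE; have [Bu|Bu] := boolP (B u).
    by have := strict u (or_introl Bu); have := fl_ge0 u; lra.
  have [reg|all] := hI u Bu.
    by have := strict u (or_intror reg); have := fl_ge0 u; lra.
  (* At a plateau vertex all triangles are flat, so the score consists of the sign changes of [phi],
     at least 4. *)
  have flE : fl u = cut u (up phi u) + cut u (dn phi u).
    rewrite -sum_mid; apply: eq_bigr => -[z w] /= uzw; rewrite /flat.
    rewrite [h z]all ?[h w]all ?eqxx//; last by apply/existsP; exists w.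
    by apply/existsP; apply: (cx_succ uzw); rewrite negb_and Bu orbT.
  have [z1 uz1 hz1] := linear_up gade Bu; have [z2 uz2] := linear_up gadeN Bu.
  rewrite !mulNr -!opprD ltrN2 => hz2'; have {hz2'}hz2 : phi z2 < phi u by [].
  have : 2 <= cut u (up phi u).
    by apply: cut_ge2 => //; [exists z1|exists z2]; rewrite // /up -leNgt ltW.
  have : 2 <= cut u (dn phi u).
    by apply: cut_ge2 => //; [exists z2|exists z1]; rewrite // /dn -leNgt ltW.
  have := linear_cut_le2 al be u; have := linear_cut_le2 (- al) (- be) u.
  rewrite -(eq_cut _ (linear_dn al be u)) -/psi flE.
  have : 0 <= cut u (up h u) by rewrite cutE addr_ge0 ?out_edges_ge0 ?in_edges_ge0.
  have : 0 <= cut u (dn h u) by rewrite cutE addr_ge0 ?out_edges_ge0 ?in_edges_ge0.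
  lra.
have fl2 : 2 <= fl v.
  rewrite /fl (bigD1 (x, y)) //= fvxy.
  have -> : mid phi v x y = 2.
    rewrite /mid /up /dn.
    have -> : phi v < phi x by rewrite -subr_gt0 phix.
    have -> : phi v < phi y = false by rewrite ltNge -subr_ge0 -opprB phiy opprK ltW.
    have -> : phi x < phi v = false by rewrite ltNge -subr_ge0 phix ltW.
    have -> : phi y < phi v by rewrite -subr_gt0 -opprB phiy opprK.
    by rewrite /=; lra.
  by rewrite lerDl sumr_ge0// => z _; case: ifP.
move: tot; rewrite (bigD1 v) //= [RHS](bigD1 v) //= FE GE.
have := strict v vB.
have : \sum_(i | i != v) \sum_(x : V * V | O i x.1 x.2) mid psi i x.1 x.2 <=
   \sum_(i | i != v) \sum_(x : V * V | O i x.1 x.2) F i x.1 x.2.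
  by apply: ler_sum => u _; exact: weak.
lra.
Qed.

End Heights.

End DiskComplex.

(** * Continuity *)

Section Continuity.
Context {R : realType} {T : topologicalType}.
Implicit Types f g : T -> R.

Lemma cont_cst {U : topologicalType} (a : U) : continuous (fun _ : T => a).
Proof. by move=> x; exact: cvg_cst. Qed.
Lemma contD f g : continuous f -> continuous g -> continuous (fun x => f x + g x).
Proof. by move=> cf cg x; apply: cvgD; [exact: cf|exact: cg]. Qed.
Lemma contN f : continuous f -> continuous (fun x => - f x).
Proof. by move=> cf x; apply: cvgN; exact: cf. Qed.
Lemma contB f g : continuous f -> continuous g -> continuous (fun x => f x - g x).
Proof. by move=> cf cg; apply: contD => //; exact: contN. Qed.
Lemma contM f g : continuous f -> continuous g -> continuous (fun x => f x * g x).
Proof. by move=> cf cg x; apply: cvgM; [exact: cf|exact: cg]. Qed.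
Lemma contV f : (forall x, f x != 0) -> continuous f -> continuous (fun x => (f x)^-1).
Proof. by move=> f0 cf x; apply: cvgV; [exact: f0|exact: cf]. Qed.
Lemma contX f n : continuous f -> continuous (fun x => f x ^+ n).
Proof.
move=> cf; elim: n => [|n IH].
  by rewrite (_ : (fun x => _) = fun=> 1); [exact: cont_cst|apply/funext].
rewrite (_ : (fun x => _) = fun x => f x * f x ^+ n); first exact: contM.
by apply/funext => x; rewrite exprS.
Qed.
Lemma cont_max f g : continuous f -> continuous g ->
  continuous (fun x => Num.max (f x) (g x)).
Proof. by move=> cf cg x; apply: continuous_max; [exact: cf|exact: cg]. Qed.
Lemma cont_sum (I : Type) (r : seq I) (P : pred I) (F : I -> T -> R) :
  (forall i, continuous (F i)) -> continuous (fun x => \sum_(i <- r | P i) F i x).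
Proof.
move=> cF; elim: r => [|i r IH].
  by rewrite (_ : (fun x => _) = fun=> 0); [exact: cont_cst|apply/funext => x; rewrite big_nil].
rewrite (_ : (fun x => _) = fun x =>
  (if P i then F i x else 0) + \sum_(j <- r | P j) F j x).
  by apply: contD => //; case: (P i) => //; exact: cont_cst.
by apply/funext => x; rewrite big_cons; case: (P i); rewrite ?add0r.
Qed.
Lemma cont_bigmax (I : Type) (r : seq I) (P : pred I) (F : I -> T -> R) :
  (forall i, continuous (F i)) ->
  continuous (fun x => \big[Num.max/0]_(i <- r | P i) F i x).
Proof.
move=> cF; elim: r => [|i r IH].
  by rewrite (_ : (fun x => _) = fun=> 0); [exact: cont_cst|apply/funext => x; rewrite big_nil].
case: (boolP (P i)) => Pi.
  rewrite (_ : (fun x => _) = fun x => Num.max (F i x) (\big[Num.max/0]_(j <- r | P j) F j x)).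
    exact: cont_max.
  by apply/funext => x; rewrite big_cons Pi.
rewrite (_ : (fun x => _) = fun x => \big[Num.max/0]_(j <- r | P j) F j x) //.
by apply/funext => x; rewrite big_cons (negbTE Pi).
Qed.

Lemma cont_pair (U W : topologicalType) (h : T -> U) (k : T -> W) :
  continuous h -> continuous k -> continuous (fun x => (h x, k x)).
Proof.
move=> ch ck x A [[P Q] /= [Ph Qk] PQ].
have : nbhs x (h @^-1` P `&` k @^-1` Q) by apply: filterI; [exact: ch|exact: ck].
by apply: filterS => y [? ?]; exact: PQ.
Qed.

Lemma cont_comp (U W : topologicalType) (h : T -> U) (k : U -> W) :
  continuous h -> continuous k -> continuous (fun x => k (h x)).
Proof. by move=> ch ck x; apply: (continuous_comp (ch x) (ck (h x))). Qed.

Lemma cont_mx m n (M : T -> 'M[R]_(m, n)) :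
  (forall i j, continuous (fun x => M x i j)) -> continuous M.
Proof.
move=> cM x A [P xP sPA].
have : \forall y \near x, forall i j, P i j (M y i j).
  by apply: filter_forall => i; apply: filter_forall => j; apply: cM; exact: xP.
by apply: filterS => y Py; exact: sPA.
Qed.

Lemma cont_open f (a : R) : continuous f -> open [set x | a < f x].
Proof.
move=> cf; apply: (@open_comp _ _ f [set y | a < y]); last exact: open_gt.
by move=> x _; exact: cf.
Qed.

(* By compactness and uniqueness every cluster point of [s] at [x] is [s x]. *)
Lemma cont_unique_zero (Y : topologicalType) (I : Type) (E : I -> T * Y -> R)
    (s : T -> Y) (C : set Y) : hausdorff_space Y -> compact C ->
  (forall x, nbhs (s x) C) ->
  (forall x, C (s x)) -> (forall i, continuous (E i)) ->
  (forall x i, E i (x, s x) = 0) ->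
  (forall x y, (forall i, E i (x, y) = 0) -> y = s x) -> continuous s.
Proof.
move=> hY cC nC Cs cE Es uE x.
apply: (@compact_cluster_set1 Y (s x) (s @ nbhs x) C) => //.
  by apply: nearW => y; exact: Cs.
have uc y : cluster (s @ x) y -> y = s x.
  move=> yc; apply: uE => i; apply: contrapT => Ez.
  have : nbhs (E i (x, y)) [set t | t != 0].
    by apply: open_nbhs_nbhs; split; [exact: open_neq|exact/eqP].
  move=> /(cE i (x, y)).
  move=> [[P Q] /= [Px Qz] PQ].
  have [w [[t Pt <-] Qw]] := yc (s @` P) Q (filterS (@preimage_image _ _ _ _) Px) Qz.
  by have := PQ (t, s t) (conj Pt Qw); rewrite /= Es eqxx.
rewrite predeqE => y; split=> [/uc //|->].
have [z [_ zc]] : C `&` cluster (s @ x) !=set0.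
  by apply: cC; apply: nearW => z; exact: Cs.
by rewrite -(uc z zc).
Qed.

End Continuity.

(** * The Dirichlet problem for monotone fluxes *)

Section Dirichlet.
Variables (R : realType) (V : finType) (N : rel V) (B : pred V).
Hypothesis conn : forall A : pred V, (exists v, A v) ->
  (forall v u, A v -> N v u -> A u) -> forall v, A v.
Hypothesis B0 : exists b, B b.

(** Neither oddness in [s] nor symmetry between [v] and [u] is imposed: the weights used later
    depend on the base vertex, and the slopes on the sign of [s]. *)
Definition flux (rho : V -> V -> R -> R) : Prop :=
  forall v u, [/\ {homo rho v u : s t / s < t}, rho v u 0 = 0 & continuous (rho v u)].

Definition balanced (rho : V -> V -> R -> R) (y : V -> R) v : Prop :=
  \sum_(u | N v u) rho v u (y u - y v) = 0.

(** Differences of one weak sign have fluxes of that sign, which cancel only if all of them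
    vanish. *)
Lemma balanced_regular rho y v : flux rho -> balanced rho y v ->
  (exists2 u, N v u & y v < y u) /\ (exists2 u, N v u & y u < y v) \/
  (forall u, N v u -> y u = y v).
Proof.
move=> hr bal.
have [/existsP[u /andP[vu yu]]|noup] := boolP [exists u, N v u && (y v < y u)].
  left; split; first by exists u.
  apply: contrapT => nodn; suff : 0 < \sum_(w | N v w) rho v w (y w - y v).
    by rewrite bal ltxx.
  have yw w : N v w -> 0 <= rho v w (y w - y v).
    move=> vw; have [rw r0 _] := hr v w; rewrite -r0.
    have : y v <= y w by rewrite leNgt; apply/negP => ?; apply: nodn; exists w.
    by rewrite -subr_ge0 le_eqVlt => /orP[/eqP <-//|/rw/ltW].
  rewrite (bigD1 u) //= ltr_pwDl ?sumr_ge0// => [|w /andP[vw _]]; last exact: yw.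
  by have [rw r0 _] := hr v u; rewrite -r0 rw// subr_gt0.
have [/existsP[u /andP[vu yu]]|nodn] := boolP [exists u, N v u && (y u < y v)].
  suff : \sum_(w | N v w) rho v w (y w - y v) < 0 by rewrite bal ltxx.
  have yw w : N v w -> rho v w (y w - y v) <= 0.
    move=> vw; have [rw r0 _] := hr v w; rewrite -r0.
    have : y w <= y v.
      by rewrite leNgt; apply: contra noup => ?; apply/existsP; exists w; rewrite vw.
    by rewrite -subr_le0 le_eqVlt => /orP[/eqP ->//|/rw/ltW].
  rewrite (bigD1 u) //= ltr_nwDl ?sumr_le0// => [|w /andP[vw _]]; last exact: yw.
  by have [rw r0 _] := hr v u; rewrite -r0 rw// subr_lt0.
right=> u vu; apply/eqP; rewrite eq_le !leNgt.
by apply/andP; split; [apply: contra noup|apply: contra nodn] => yu;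
  apply/existsP; exists u; rewrite vu.
Qed.

(** Where [y - z] attains a positive maximum, balance and strict monotonicity force all neighbours
    to attain it too; by connectivity it would reach [B], where the difference is 0. *)
Lemma balanced_le rho y z : flux rho -> (forall b, B b -> y b = z b) ->
  (forall v, ~~ B v -> balanced rho y v) ->
  (forall v, ~~ B v -> balanced rho z v) -> forall v, y v <= z v.
Proof.
move=> hr yz by_ bz v0.
case: (@Order.TotalTheory.arg_maxP _ _ _ v0 predT (fun v => y v - z v) isT) => v1 _ vmax'.
have vmax v : y v - z v <= y v1 - z v1 by exact: vmax'.
rewrite -subr_le0 (le_trans (vmax v0))// leNgt; apply/negP => M0.
pose A v := y v - z v == y v1 - z v1.
have AB v : A v -> ~~ B v.
  by move=> /eqP Av; apply: contraL M0 => Bv; rewrite -Av (yz _ Bv) subrr ltxx.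
have [b Bb] := B0; suff /AB : A b by rewrite Bb.
apply: conn; first by exists v1; exact: eqxx.
move=> v u Av vu; have := by_ v (AB v Av); have := bz v (AB v Av); rewrite /balanced => E1 E2.
have le w : N v w -> rho v w (y w - y v) <= rho v w (z w - z v).
  move=> _; have [rw _ _] := hr v w.
  have : y w - y v <= z w - z v by have := vmax w; rewrite -(eqP Av); lra.
  by rewrite le_eqVlt => /orP[/eqP ->//|/rw/ltW].
apply: contraT => Au.
suff : \sum_(w | N v w) rho v w (y w - y v) < \sum_(w | N v w) rho v w (z w - z v).
  by rewrite E1 E2 ltxx.
rewrite (bigD1 u) //= [ltRHS](bigD1 u) //= ltr_leD//.
  have [rw _ _] := hr v u; apply: rw.
  have := vmax u; rewrite le_eqVlt => /orP[|]; first by move=> H; rewrite /A H in Au.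
  by rewrite -(eqP Av); lra.
by apply: ler_sum => w /andP[vw _]; exact: le.
Qed.

Lemma balanced_uniq rho y z : flux rho -> (forall b, B b -> y b = z b) ->
  (forall v, ~~ B v -> balanced rho y v) ->
  (forall v, ~~ B v -> balanced rho z v) -> y = z.
Proof.
move=> hr yz hy hz; apply/funext => v; apply/eqP; rewrite eq_le.
by rewrite (balanced_le hr yz hy hz) (balanced_le hr _ hz hy)// => b /yz.
Qed.

(* Perron's method: the supremum of the subsolutions is a solution. *)
Lemma balanced_exists rho (g : V -> R) lo hi : flux rho ->
  (forall v, lo <= g v <= hi) ->
  exists y : V -> R, [/\ forall b, B b -> y b = g b, forall v, lo <= y v <= hi
    & forall v, ~~ B v -> balanced rho y v].
Proof.
move=> hr gb.
have rho_le v u s t : s <= t -> rho v u s <= rho v u t.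
  have [rw _ _] := hr v u.
  by rewrite le_eqVlt => /orP[/eqP ->//|/rw/ltW].
pose E y v := \sum_(u | N v u) rho v u (y u - y v).
pose S := [set y : V -> R | [/\ forall b, B b -> y b = g b,
  forall v, lo <= y v <= hi & forall v, ~~ B v -> 0 <= E y v]].
have [y0 Sy0] : S !=set0.
  exists (fun v => if B v then g v else lo); split => [b ->//|v|v Bv].
    by case: ifP => // _; rewrite lexx; have /andP[/le_trans h /h] := gb v.
  apply: sumr_ge0 => u _; have [_ r0 _] := hr v u; rewrite -r0 (negbTE Bv) rho_le//.
  by case: ifP => _; rewrite ?subrr// subr_ge0; have /andP[] := gb u.
pose Sv v := [set y v | y in S].
have supS v : has_sup (Sv v).
  split; first by exists (y0 v), y0.
  by exists hi => _ [y [_ yb _] <-]; have /andP[] := yb v.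
pose ys v := sup (Sv v).
have ys_ge y v : S y -> y v <= ys v.
  by move=> Sy; apply: sup_upper_bound => //; exists y.
have ysB b : B b -> ys b = g b.
  move=> Bb; have -> : g b = sup [set g b] by rewrite sup1.
  congr sup; apply/seteqP; split=> [_ [y [yB _ _] <-]|_ ->]; first exact: yB.
  by exists y0 => //; have [yB _ _] := Sy0; exact: yB.
have ysb v : lo <= ys v <= hi.
  apply/andP; split.
    by apply: le_trans (ys_ge _ v Sy0); have [_ /(_ v) /andP[]] := Sy0.
  by apply: ge_sup; [exists (y0 v), y0|move=> _ [y [_ yb _] <-]; have /andP[] := yb v].
have contE v : continuous (fun t => \sum_(u | N v u) rho v u (ys u - t)).
  apply: cont_sum => u t.
  apply: (@continuous_comp _ _ _ (fun t => ys u - t) (rho v u)).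
    by apply: contB; [exact: cont_cst|by move=> ?; exact: cvg_id].
  by have [_ _] := hr v u; exact.
have E_ge0 v : ~~ B v -> 0 <= E ys v.
  move=> Bv; rewrite leNgt; apply/negP => Elt.
  (* A subsolution with value close to the supremum at [v] has there at most the flux obtained from
     the neighbouring values of [ys], which would be negative. *)
  have : \forall t \near ys v, \sum_(u | N v u) rho v u (ys u - t) < 0.
    by have /cvgr_lt := contE v (ys v); apply.
  move=> /nbhs_ballP[e /= e0 He].
  have [_ [y Sy <-] ylt] := sup_adherent e0 (supS v).
  have [_ _ /(_ v Bv)] := Sy; rewrite leNgt => /negP[].
  apply: le_lt_trans (He (y v) _).
    by apply: ler_sum => u _; apply: rho_le; rewrite lerD2r ys_ge.
  rewrite /ball /= ger0_norm ?subr_ge0 ?ys_ge//.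
  by move: ylt; rewrite -/(ys v); lra.
exists ys; split => // v Bv; apply/eqP; rewrite eq_le E_ge0// andbT leNgt.
apply/negP => Egt.
(* Room for a bump: at the ceiling [hi] all differences are nonpositive, and the flux could not be
   positive. *)
have yslt : ys v < hi.
  rewrite ltNge; apply/negP => ge.
  suff : E ys v <= 0 by rewrite leNgt Egt.
  apply: sumr_le0 => u _; have [_ r0 _] := hr v u; rewrite -r0 rho_le// subr_le0.
  by apply: le_trans ge; have /andP[] := ysb u.
have : \forall t \near ys v, 0 < \sum_(u | N v u) rho v u (ys u - t).
  by have /cvgr_gt := contE v (ys v); apply.
move=> /nbhs_ballP[e /= e0 He].
(* Raising [v] alone by [d] keeps the flux at [v] positive and can only increase it elsewhere, so
   the result is a subsolution exceeding the supremum. *)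
pose d := Num.min (e / 2) (hi - ys v).
have d0 : 0 < d by rewrite lt_min divr_gt0//= subr_gt0.
pose y' u := if u == v then ys v + d else ys u.
have y'ge u : ys u <= y' u.
  by rewrite /y'; case: eqP => // ->; rewrite lerDl ltW.
suff Sy' : S y' by have := ys_ge _ v Sy'; rewrite /y' eqxx; lra.
split => [b Bb|u|w Bw].
- rewrite /y'; case: eqP => [bv|_]; last exact: ysB.
  by rewrite bv (negbTE Bv) in Bb.
- rewrite (le_trans _ (y'ge u)) /=; last by have /andP[] := ysb u.
  rewrite /y'; case: eqP => _; last by have /andP[] := ysb u.
  by have : d <= hi - ys v by [rewrite /d ge_min lexx orbT]; lra.
- rewrite /E; have [->|wv] := eqVneq w v.
    have : 0 < \sum_(u | N v u) rho v u (ys u - (ys v + d)).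
      apply: He; rewrite /ball /= opprD addrA subrr sub0r normrN gtr0_norm//.
      by have : d <= e / 2 by [rewrite /d ge_min lexx]; lra.
    move=> H; apply/ltW/(lt_le_trans H); apply: ler_sum => u _; apply: rho_le.
    by rewrite [y' v]/y' eqxx lerD2r.
  apply: le_trans (E_ge0 w Bw) _; apply: ler_sum => u _; apply: rho_le.
  by rewrite [y' w]/y' (negbTE wv) lerD2r.
Qed.

(** All solutions obey one bound independent of [p], hence lie in a compact cube, and each is the
    unique zero of equations jointly continuous in parameter and solution; [cont_unique_zero]
    applies. *)
Lemma dirichlet (P : topologicalType) (rho : P -> V -> V -> R -> R) (g : V -> R) :
  (forall p, flux (rho p)) ->
  (forall v u, continuous (fun q : P * R => rho q.1 v u q.2)) ->
  exists s : P -> V -> R,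
    [/\ forall p b, B b -> s p b = g b,
        forall p v, ~~ B v -> balanced (rho p) (s p) v
      & forall v, continuous (s ^~ v)].
Proof.
move=> hr hc.
pose M := \sum_v `|g v|.
have gM v : - M <= g v <= M.
  by rewrite -ler_norml /M (bigD1 v) //= lerDl sumr_ge0.
have [s sP] := choice (fun p => balanced_exists (hr p) gM).
exists s; split=> [p|p v|v]; [by have [] := sP p|by have [_ _] := sP p; exact|].
pose n := #|V|.
pose row (y : V -> R) : 'rV[R]_n := \row_i y (enum_val i).
pose fn (r : 'rV[R]_n) : V -> R := fun v => r ord0 (enum_rank v).
have rowK y : fn (row y) = y by apply/funext => u; rewrite /fn mxE enum_rankK.
have fnK r : row (fn r) = r by apply/rowP => i; rewrite !mxE /fn enum_valK.
have cfn u : continuous (fn ^~ u) by exact: coord_continuous.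
suff : continuous (fun p => row (s p)).
  move=> cr; rewrite (_ : s ^~ v = fun p => fn (row (s p)) v).
    by move=> p; apply: (@continuous_comp _ _ _ (fun p => row (s p)) (fn ^~ v)); [exact: cr|exact: cfn].
  by apply/funext => p; rewrite rowK.
(* The margin 1 makes the cube a neighbourhood of each solution, not merely a set containing it. *)
pose C := [set r : 'rV[R]_n | forall i, `[- M - 1, M + 1]%classic (r ord0 i)].
pose E v (q : P * 'rV[R]_n) : R := if B v then fn q.2 v - g v else
   \sum_(u | N v u) rho q.1 v u (fn q.2 u - fn q.2 v).
have inC (y : V -> R) : (forall v, - M <= y v <= M) -> nbhs (row y) C.
  move=> yM; exists (fun _ i => `]- M - 1, M + 1[%classic) => [i j|r /= Hr i].
    have /andP[y1 y2] := yM (enum_val j); apply: open_nbhs_nbhs; split.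
      exact: interval_open.
    by rewrite /= mxE in_itv /=; apply/andP; split; lra.
  by have := Hr ord0 i; rewrite /= !in_itv /= => /andP[/ltW -> /ltW ->].
apply: (@cont_unique_zero R P _ V E (fun p => row (s p)) C).
- exact: norm_hausdorff.
- by apply: (@rV_compact R n (fun=> _)) => _; exact: segment_compact.
- by move=> p; apply: inC; have [] := sP p.
- by move=> p; apply: nbhs_singleton; apply: inC; have [] := sP p.
- move=> w; rewrite /E; have cfn2 u : continuous (fun q : P * 'rV[R]_n => fn q.2 u).
    by move=> q; apply: (@continuous_comp _ _ _ snd (fn ^~ u)); [exact: cvg_snd|exact: cfn].
  case: (B w); first by apply: contB => //; exact: cont_cst.
  apply: cont_sum => u.
  apply: (cont_comp (h := fun q : P * 'rV[R]_n => (q.1, fn q.2 u - fn q.2 w)) _ (hc w u)).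
  by apply: cont_pair; [move=> q; exact: cvg_fst|exact: contB].
- move=> p w; rewrite /E /= rowK; have [sB _ sI] := sP p.
  by case: ifPn => [/sB ->|/sI//]; rewrite subrr.
- move=> p r Er; rewrite -[r]fnK; congr row.
  have [sB _ sI] := sP p; apply: (balanced_uniq (hr p)) => // [b Bb|w Bw].
    by have := Er b; rewrite /E Bb /= => /eqP; rewrite subr_eq0 sB// => /eqP.
  by have := Er w; rewrite /E (negbTE Bw).
Qed.

End Dirichlet.

(** * The embedding theorem of Tutte *)

Section Tutte.
Variables (R : realType) (V : finType) (O : V -> V -> V -> bool)
  (B : pred V) (px py : V -> R).
Hypothesis K : disk_complex O B px py.
Hypothesis V0 : V.

Let N := nbr O.

Let B0 : exists b, B b.
Proof.
have [|b Bb _] := @boundary_max _ _ _ _ _ _ K 1 0 _ V0; first by rewrite oner_eq0.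
by exists b.
Qed.

Lemma linear_flux (w : V -> V -> R) : (forall v u, 0 < w v u) ->
  flux (fun v u s => w v u * s).
Proof.
move=> w0 v u; split=> [s t st||]; [by rewrite ltr_pM2l|by rewrite mulr0|].
by apply: contM; [exact: cont_cst|move=> ?; exact: cvg_id].
Qed.

(** The direction opposite to a neighbour [u] of [v] lies in some triangle cone at [v], which gives
    a nonnegative relation between the edges at [v] with positive coefficient on [u]. Adding these
    relations over all neighbours makes every weight positive. *)
Lemma reference_weights : exists w : V -> V -> R, (forall v u, 0 < w v u) /\
  forall v, ~~ B v -> balanced N (fun v u s => w v u * s) px v /\
                      balanced N (fun v u s => w v u * s) py v.
Proof.
suff Hv v : exists w : V -> R, (forall u, 0 < w u) /\ (~~ B v ->
    \sum_(u | N v u) w u * (px u - px v) = 0 /\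
    \sum_(u | N v u) w u * (py u - py v) = 0).
  have [w wP] := choice Hv; exists w; split=> [v u|v Bv]; first by case: (wP v).
  by case: (wP v) => _ /(_ Bv).
have [Bv|Bv] := boolP (B v); first by exists (fun=> 1); split => // u; exact: ltr01.
have pos a b : O v a b -> 0 < area px py v a b by exact: (cx_pos K).
have Hu u : exists k : V -> R, [/\ forall z, 0 <= k z, N v u -> 0 < k u &
    \sum_(z | N v z) k z * (px z - px v) = 0 /\
    \sum_(z | N v z) k z * (py z - py v) = 0].
  case: (boolP (N v u)) => [vu|]; last first.
    by exists (fun=> 0); split => //; rewrite !big1// => *; rewrite mul0r.
  have [c uc] := existsP vu; have Dc := pos _ _ uc.
  have q0 : (- (px u - px v) != 0) || (- (py u - py v) != 0).
    apply: contraTT Dc; rewrite negb_or !negbK !oppr_eq0 => /andP[/eqP e1 /eqP e2].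
    by rewrite /area /cross e1 e2 mul0r mulr0 subrr ltxx.
  have [|//|a [b [_ ab e1 e2]]] := @fan_cross _ _ _ _ _ _ K px py v predT Bv pos _ _ _ _ q0.
    by exists u, c.
  have Dab := pos _ _ ab.
  have va : N v a by apply/existsP; exists b.
  have vb : N v b.
    by apply/existsP; apply: (cx_succ K ab); rewrite negb_and Bv orbT.
  set ca := cross _ _ _ _ in e1; set cb := cross _ _ _ _ in e2.
  (* Cramer's rule: in the basis [a - v], [b - v] the vector [- (u - v)] has coordinates [- cb] and
     [ca], up to the factor [area px py v a b]. *)
  exists (fun z => area px py v a b * (z == u)%:R + (- cb) * (z == a)%:R + ca * (z == b)%:R).
  have sumE (p q r : R) (f : V -> R) : \sum_(z | N v z)
      (p * (z == u)%:R + q * (z == a)%:R + r * (z == b)%:R) * f z =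
      p * f u + q * f a + r * f b.
    have one (p' : R) d : N v d -> \sum_(z | N v z) p' * (z == d)%:R * f z = p' * f d.
      move=> vd; rewrite (bigD1 d) //= eqxx mulr1 big1 ?addr0// => z /andP[_ /negbTE ->].
      by rewrite mulr0 mul0r.
    under eq_bigr => z _ do rewrite !mulrDl.
    by rewrite !big_split /= !one.
  split.
  - move=> z; rewrite !addr_ge0// mulr_ge0 ?oppr_ge0 ?ler0n//; exact: ltW.
  - move=> _; rewrite eqxx mulr1 -addrA ltr_pwDl//.
    by rewrite addr_ge0// mulr_ge0 ?oppr_ge0 ?ler0n//; exact: ltW.
  - by split; rewrite sumE /area /cb /ca /cross; ring.
have [k kP] := choice Hu.
exists (fun z => if N v z then \sum_u k u z else 1); split.
  move=> z; case: ifPn => [vz|_]; last exact: ltr01.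
  rewrite (bigD1 z) //= ltr_pwDl ?sumr_ge0// => [|u _]; first by case: (kP z) => _ /(_ vz).
  by case: (kP u).
move=> _; split.
  transitivity (\sum_(z | N v z) \sum_u k u z * (px z - px v)).
    by apply: eq_bigr => z ->; rewrite mulr_suml.
  by rewrite exchange_big /= big1 => [//|u _]; case: (kP u) => _ _ [].
transitivity (\sum_(z | N v z) \sum_u k u z * (py z - py v)).
  by apply: eq_bigr => z ->; rewrite mulr_suml.
by rewrite exchange_big /= big1 => [//|u _]; case: (kP u) => _ _ [].
Qed.

(* By [no_flat] no triangle can degenerate while the weights are deformed to
   weights for which the reference position is harmonic. *)
Lemma tutte (w : V -> V -> R) (X Y : V -> R) : (forall v u, 0 < w v u) ->
  (forall b, B b -> X b = px b) -> (forall b, B b -> Y b = py b) ->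
  (forall v, ~~ B v -> balanced N (fun v u s => w v u * s) X v) ->
  (forall v, ~~ B v -> balanced N (fun v u s => w v u * s) Y v) ->
  forall a b c, O a b c -> 0 < area X Y a b c.
Proof.
move=> w0 XB YB XI YI a b c abc.
have [w1 [w10 w1I]] := reference_weights.
(* The squares keep the weights positive for every real [t], so that [R] itself is the parameter
   space; [t = 0] gives [w1] and [t = 1] gives [w]. *)
pose wt t v u := (1 - t) ^+ 2 * w1 v u + t ^+ 2 * w v u.
have wt0 t v u : 0 < wt t v u.
  have [->|t0] := eqVneq t 0; first by rewrite /wt subr0 expr0n /= expr1n mul1r mul0r addr0.
  apply: ltr_wpDl; first by rewrite mulr_ge0 ?sqr_ge0// ltW.
  by rewrite mulr_gt0// lt0r sqr_ge0 andbT sqrf_eq0.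
pose rho t := fun v u s => wt t v u * s.
have hr t : flux (rho t) by exact: linear_flux (wt0 t).
have hc v u : continuous (fun q : R * R => rho q.1 v u q.2).
  have c1 : continuous (fst : R * R -> R) by move=> q; exact: cvg_fst.
  have c2 : continuous (snd : R * R -> R) by move=> q; exact: cvg_snd.
  apply: contM => //; apply: contD; apply: contM; try exact: cont_cst.
    by apply: contX; apply: contB => //; exact: cont_cst.
  exact: contX.
have [sx [sxB sxI sxc]] := dirichlet (cx_conn K) B0 px hr hc.
have [sy [syB syI syc]] := dirichlet (cx_conn K) B0 py hr hc.
have D_ne0 t : area (sx t) (sy t) a b c != 0.
  apply/eqP => D0.
  (* If the area vanishes, a normal of a nonzero edge gives a combination of [sx] and [sy] constant
     on the triangle. It is balanced for the same linear flux and linear on the boundary, so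
     [no_flat] applies. *)
  have [al [be [albe fl]]] : exists al be, ((al != 0) || (be != 0)) /\
      flat (fun v => al * sx t v + be * sy t v) a b c.
    have [/orP H|] := boolP ((- (sy t b - sy t a) != 0) || (sx t b - sx t a != 0)).
      exists (- (sy t b - sy t a)), (sx t b - sx t a); split; first exact/orP.
      move: D0; rewrite /area /cross => D0.
      by apply/andP; split; apply/eqP; move: D0; nra.
    rewrite negb_or !negbK oppr_eq0 => /andP[/eqP e1 /eqP e2].
    have [/orP H|] := boolP ((- (sy t c - sy t a) != 0) || (sx t c - sx t a != 0)).
      exists (- (sy t c - sy t a)), (sx t c - sx t a); split; first exact/orP.
      move: D0; rewrite /area /cross => D0.
      by apply/andP; split; apply/eqP; move: D0; nra.
    rewrite negb_or !negbK oppr_eq0 => /andP[/eqP e3 /eqP e4].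
    exists 1, 0; split; first by rewrite oner_eq0.
    by apply/andP; split; apply/eqP; lra.
  apply/negP: fl; apply: (no_flat K albe) => // [v Bv|v Bv].
    by rewrite sxB// syB.
  apply: (balanced_regular (hr t)).
  have := sxI t v Bv; have := syI t v Bv; rewrite /balanced /rho => Ey Ex.
  transitivity (al * (\sum_(u | N v u) wt t v u * (sx t u - sx t v)) +
                be * (\sum_(u | N v u) wt t v u * (sy t u - sy t v))).
    by rewrite !mulr_sumr -big_split; apply: eq_bigr => u _ /=; ring.
  by rewrite Ex Ey !mulr0 addr0.
have s0 : sx 0 = px /\ sy 0 = py.
  have rho0 : rho 0 = fun v u s => w1 v u * s.
    by rewrite /rho /wt; apply/funext => v; apply/funext => u; apply/funext => s; ring.
  split; apply: (balanced_uniq (cx_conn K) B0 (hr 0)).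
  - exact: sxB.
  - exact: sxI.
  - by move=> v /w1I[]; rewrite rho0.
  - exact: syB.
  - exact: syI.
  - by move=> v /w1I[]; rewrite rho0.
have s1 : sx 1 = X /\ sy 1 = Y.
  have rho1 : rho 1 = fun v u s => w v u * s.
    by rewrite /rho /wt; apply/funext => v; apply/funext => u; apply/funext => s; ring.
  split; apply: (balanced_uniq (cx_conn K) B0 (hr 1)).
  - by move=> b' Bb; rewrite sxB// XB.
  - exact: sxI.
  - by rewrite rho1.
  - by move=> b' Bb; rewrite syB// YB.
  - exact: syI.
  - by rewrite rho1.
have [[e1 e2] [e3 e4]] := (s0, s1).
pose f t := area (sx t) (sy t) a b c.
have cf : continuous f.
  by rewrite /f /area /cross; apply: contB; apply: contM; apply: contB.
have f0 : 0 < f 0 by rewrite /f e1 e2 (cx_pos K).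
suff : 0 < f 1 by rewrite /f e3 e4.
rewrite ltNge; apply/negP => f1.
have [||t _ ft] := @IVT R f 0 1 0 ler01.
- exact: continuous_subspaceT.
- by rewrite ge_min f1 orbT /= le_max (ltW f0).
- by have := D_ne0 t; rewrite -/(f t) ft eqxx.
Qed.

End Tutte.

(** * Coordinates on the space of admissible configurations *)

Section PosNegParts.
Variable R : realType.
Implicit Types s t : R.

Definition pospart s : R := Num.max s 0.
Definition negpart s : R := pospart (- s).

Lemma pospart_ge0 s : 0 <= pospart s. Proof. by rewrite le_max lexx orbT. Qed.
Lemma negpart_ge0 s : 0 <= negpart s. Proof. exact: pospart_ge0. Qed.
Lemma pospart_id s : 0 <= s -> pospart s = s. Proof. by rewrite /pospart; case: ltgtP. Qed.
Lemma pospart_eq0 s : s <= 0 -> pospart s = 0.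
Proof. by move=> s0; apply/max_idPr. Qed.
Lemma negpart_eq0 s : 0 <= s -> negpart s = 0.
Proof. by rewrite -oppr_le0; exact: pospart_eq0. Qed.
Lemma negpart_id s : s <= 0 -> negpart s = - s.
Proof. by rewrite -oppr_ge0; exact: pospart_id. Qed.

Lemma posB s : pospart s - negpart s = s.
Proof.
by have [s0|s0] := lerP 0 s; [rewrite pospart_id ?negpart_eq0//|
  rewrite pospart_eq0 ?negpart_id 1?ltW//]; lra.
Qed.
Lemma mul_pospart s : pospart s * s = pospart s ^+ 2.
Proof.
by have [s0|s0] := lerP 0 s; [rewrite pospart_id//|rewrite pospart_eq0 1?ltW//]; ring.
Qed.
Lemma mul_negpart s : negpart s * s = - negpart s ^+ 2.
Proof. by rewrite -mul_pospart mulrN opprK. Qed.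

Context {T : topologicalType}.
Lemma cont_pospart (f : T -> R) : continuous f -> continuous (fun x => pospart (f x)).
Proof. by move=> cf; apply: cont_max => //; exact: cont_cst. Qed.
Lemma cont_negpart (f : T -> R) : continuous f -> continuous (fun x => negpart (f x)).
Proof. by move=> cf; apply: cont_pospart; exact: contN. Qed.

(* [p |-> (1 + p^+) / (1 + p^-)] is a bijection from the line onto the
   positive half-line, with this inverse. *)
Lemma ratio_coord p (a b : R) : 0 < a -> 0 < b ->
  (1 + pospart p) * a = (1 + negpart p) * b <->
  p = pospart (b - a) / a - negpart (b - a) / b.
Proof.
move=> a0 b0; split=> [|->].
  have [p0|p0] := lerP 0 p.
    rewrite (pospart_id p0) (negpart_eq0 p0) addr0 mul1r => <-.
    have -> : (1 + p) * a - a = p * a by ring.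
    have pa : 0 <= p * a by rewrite mulr_ge0 // ltW.
    by rewrite (pospart_id pa) (negpart_eq0 pa) mul0r subr0 mulfK// gt_eqF.
  rewrite (pospart_eq0 (ltW p0)) (negpart_id (ltW p0)) addr0 mul1r => ->.
  have -> : b - (1 - p) * b = p * b by ring.
  have pb : p * b <= 0 by rewrite nmulr_rle0 ?ltW.
  by rewrite (pospart_eq0 pb) (negpart_id pb) mul0r sub0r -mulNr opprK mulfK// gt_eqF.
have [ab|/ltW ab] := lerP 0 (b - a).
  rewrite (negpart_eq0 ab) mul0r subr0 (pospart_id ab).
  have q0 : 0 <= (b - a) / a by rewrite divr_ge0// ltW.
  by rewrite (pospart_id q0) (negpart_eq0 q0); field; rewrite gt_eqF.
rewrite (pospart_eq0 ab) mul0r sub0r (negpart_id ab).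
have q0 : - (- (b - a) / b) <= 0.
  by rewrite oppr_le0 divr_ge0 ?oppr_ge0 // ltW.
by rewrite (pospart_eq0 q0) (negpart_id q0); field; rewrite gt_eqF.
Qed.

End PosNegParts.

Section ConfigurationChart.
Variables (R : realType) (V : finType) (O : V -> V -> V -> bool)
  (B : pred V) (px py : V -> R).
Hypothesis K : disk_complex O B px py.
Hypothesis V0 : V.

Let N := nbr O.

Let B0 : exists b, B b.
Proof.
have [|b Bb _] := @boundary_max _ _ _ _ _ _ K 1 0 _ V0; first by rewrite oner_eq0.
by exists b.
Qed.

Definition admissible (X Y : V -> R) : Prop :=
  (forall b, B b -> X b = px b /\ Y b = py b) /\
  (forall a b c, O a b c -> 0 < area X Y a b c).

Definition rise (Y : V -> R) v : R := \sum_(u | N v u) pospart (Y u - Y v).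
Definition fall (Y : V -> R) v : R := \sum_(u | N v u) negpart (Y u - Y v).
(** The solution [p] of [(1 + p^+) * rise = (1 + p^-) * fall]: it is [fall / rise - 1] when
    [fall >= rise] and [1 - rise / fall] otherwise. *)
Definition height_coord Y v : R :=
  pospart (fall Y v - rise Y v) / rise Y v - negpart (fall Y v - rise Y v) / fall Y v.

Lemma rise_fall_cont (Z : topologicalType) (Y : Z -> V -> R) v :
  (forall u, continuous (Y ^~ u)) ->
  continuous (fun z => rise (Y z) v) /\ continuous (fun z => fall (Y z) v).
Proof.
move=> cY; split; apply: cont_sum => u.
  by apply: cont_pospart; exact: contB.
by apply: cont_negpart; exact: contB.
Qed.

Lemma rise_gt0 Y v : regular O Y v -> 0 < rise Y v.
Proof.
move=> [[u vu yu] _]; rewrite /rise (bigD1 u) //= ltr_pwDl//.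
  by rewrite pospart_id ?subr_gt0// subr_ge0 ltW.
by apply: sumr_ge0 => *; exact: pospart_ge0.
Qed.

Lemma fall_gt0 Y v : regular O Y v -> 0 < fall Y v.
Proof.
move=> [_ [u vu yu]]; rewrite /fall (bigD1 u) //= ltr_pwDl//.
  by rewrite negpart_id ?oppr_gt0 ?subr_lt0// subr_le0 ltW.
by apply: sumr_ge0 => *; exact: negpart_ge0.
Qed.

Definition asym (p : V -> R) v (u : V) s : R :=
  (1 + pospart (p v)) * pospart s - (1 + negpart (p v)) * negpart s.

Lemma asym_flux p : flux (asym p).
Proof.
move=> v u; split=> [s t st||].
- have p1 : 0 < 1 + pospart (p v) by rewrite ltr_pwDl ?ltr01 ?pospart_ge0.
  have p2 : 0 < 1 + negpart (p v) by rewrite ltr_pwDl ?ltr01 ?negpart_ge0.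
  rewrite /asym; have [s0|s0] := lerP 0 s.
    have t0 := le_trans s0 (ltW st).
    by rewrite (pospart_id s0) (pospart_id t0) (negpart_eq0 s0) (negpart_eq0 t0)
      !mulr0 !subr0 ltr_pM2l.
  rewrite (pospart_eq0 (ltW s0)) (negpart_id (ltW s0)) mulr0 sub0r.
  have [t0|/ltW t0] := lerP 0 t.
    rewrite (pospart_id t0) (negpart_eq0 t0) mulr0 subr0.
    apply: (@lt_le_trans _ _ 0); last by rewrite mulr_ge0// ltW.
    by rewrite mulrN opprK pmulr_rlt0.
  by rewrite (pospart_eq0 t0) (negpart_id t0) mulr0 sub0r !mulrN !opprK ltr_pM2l.
- by rewrite /asym (pospart_id (lexx 0)) (negpart_eq0 (lexx 0)) !mulr0 subrr.
- by apply: contB; apply: contM; try exact: cont_cst;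
    [apply: cont_pospart|apply: cont_negpart] => ?; exact: cvg_id.
Qed.

Lemma asym_balanced p Y v : regular O Y v ->
  balanced N (asym p) Y v <-> p v = height_coord Y v.
Proof.
move=> reg; rewrite -ratio_coord; [|exact: rise_gt0|exact: fall_gt0].
rewrite /balanced /asym sumrB -!mulr_sumr -/(rise Y v) -/(fall Y v).
by split=> [/eqP|->]; rewrite ?subrr// subr_eq0 => /eqP.
Qed.

(** The positively oriented fan crosses both horizontal directions at [v]; one crossing starts at a
    neighbour above, the other at one below. *)
Lemma admissible_regular X Y v : admissible X Y -> ~~ B v -> regular O Y v.
Proof.
move=> [_ pos] Bv; have [a [b ab]] := cx_star K v.
have pv c d : O v c d -> 0 < area X Y v c d by exact: pos.
split.
  have [|//||c [d [_ cd e _]]] := @fan_cross _ _ _ _ _ _ K X Y v predT Bv pv _ _ (- 1) 0.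
  - by exists a, b.
  - by rewrite oppr_eq0 oner_eq0.
  exists c; first by apply/existsP; exists d.
  by move: e; rewrite /cross; lra.
have [|//||c [d [_ cd e _]]] := @fan_cross _ _ _ _ _ _ K X Y v predT Bv pv _ _ 1 0.
- by exists a, b.
- by rewrite oner_eq0.
exists c; first by apply/existsP; exists d.
by move: e; rewrite /cross; lra.
Qed.

(** The alternative left by [balanced_regular] is a plateau at [v], whose triangles would be flat,
    against [no_flat] for the linear function [py]. *)
Lemma balanced_height_regular p Y v : (forall b, B b -> Y b = py b) ->
  (forall v, ~~ B v -> balanced N (asym p) Y v) -> ~~ B v -> regular O Y v.
Proof.
move=> YB YI Bv.
have cases w : ~~ B w -> regular O Y w \/ forall u, N w u -> Y u = Y w.
  by move=> /YI; apply: balanced_regular; exact: asym_flux.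
case: (cases v Bv) => // all.
have [a [b ab]] := cx_star K v.
have alb : ((0 : R) != 0) || ((1 : R) != 0) by rewrite oner_eq0 orbT.
have Ya : Y a = Y v by apply: all; apply/existsP; exists b.
have Yb : Y b = Y v.
  by apply: all; apply/existsP; apply: (cx_succ K ab); rewrite negb_and Bv orbT.
have := no_flat K alb (h := Y) _ cases ab; rewrite /flat Ya Yb !eqxx => H.
by suff : false by []; apply: H => u /YB ->; ring.
Qed.

(* Positive weights, continuous in [Y], for which [Y] is harmonic at [v]. *)
Definition height_weight (Y : V -> R) v u : R :=
  1 + pospart (fall Y v - rise Y v) / (\sum_(z | N v z) pospart (Y z - Y v) ^+ 2) *
        pospart (Y u - Y v)
    + negpart (fall Y v - rise Y v) / (\sum_(z | N v z) negpart (Y z - Y v) ^+ 2) *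
        negpart (Y u - Y v).

Lemma height_weight_gt0 Y v u : 0 < height_weight Y v u.
Proof.
rewrite /height_weight -addrA ltr_pwDl// addr_ge0// !mulr_ge0 ?pospart_ge0 ?negpart_ge0//.
  by rewrite invr_ge0 sumr_ge0// => *; exact: sqr_ge0.
by rewrite invr_ge0 sumr_ge0// => *; exact: sqr_ge0.
Qed.

Lemma sum_pospart2_gt0 (Y : V -> R) v : regular O Y v ->
  0 < \sum_(z | N v z) pospart (Y z - Y v) ^+ 2.
Proof.
move=> [[u vu yu] _]; rewrite (bigD1 u) //= ltr_pwDl//.
  by rewrite pospart_id ?exprn_gt0 ?subr_gt0// subr_ge0 ltW.
by apply: sumr_ge0 => *; exact: sqr_ge0.
Qed.

Lemma sum_negpart2_gt0 (Y : V -> R) v : regular O Y v ->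
  0 < \sum_(z | N v z) negpart (Y z - Y v) ^+ 2.
Proof.
move=> [_ [u vu yu]]; rewrite (bigD1 u) //= ltr_pwDl//.
  by rewrite negpart_id ?exprn_gt0 ?oppr_gt0 ?subr_lt0// subr_le0 ltW.
by apply: sumr_ge0 => *; exact: sqr_ge0.
Qed.

(** Weight 1 alone leaves the defect [rise - fall]. The two further terms are normalized to
    contribute the positive part of [fall - rise] and minus its negative part, which cancels the
    defect. *)
Lemma height_weight_balanced Y v : regular O Y v ->
  balanced N (fun v u s => height_weight Y v u * s) Y v.
Proof.
move=> reg; rewrite /balanced /height_weight.
set c1 := pospart _ / _; set c2 := negpart _ / _.
transitivity (\sum_(u | N v u) (Y u - Y v) + c1 * \sum_(u | N v u) pospart (Y u - Y v) ^+ 2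
    - c2 * \sum_(u | N v u) negpart (Y u - Y v) ^+ 2).
  rewrite !mulr_sumr -big_split -sumrB; apply: eq_bigr => u _ /=.
  by rewrite !mulrDl mul1r -(mulrA c1) -(mulrA c2) mul_pospart mul_negpart mulrN.
rewrite divfK ?gt_eqF ?sum_pospart2_gt0// divfK ?gt_eqF ?sum_negpart2_gt0//.
rewrite -addrA posB.
have -> : \sum_(u | N v u) (Y u - Y v) = rise Y v - fall Y v.
  by rewrite /rise /fall -sumrB; apply: eq_bigr => u _; rewrite posB.
by rewrite addrC addrA subrK subrr.
Qed.

(** * Decoding parameters into admissible positions and back *)

Section Chart.
Variables (Q : topologicalType) (par dir : V -> Q -> R) (mk : (V -> R) -> (V -> R) -> Q).
Hypothesis par_cont : forall v, continuous (par v).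
Hypothesis dir_cont : forall v, continuous (dir v).
Hypothesis dirB : forall v q, B v -> dir v q = 0.
Hypothesis mk_par : forall p d v, ~~ B v -> par v (mk p d) = p v.
Hypothesis mk_dir : forall p d v, ~~ B v -> dir v (mk p d) = d v.
Hypothesis mkK : forall q, mk (par ^~ q) (dir ^~ q) = q.
Hypothesis mk_ext : forall p d p' d', (forall v, ~~ B v -> p v = p' v) ->
  (forall v, ~~ B v -> d v = d' v) -> mk p d = mk p' d'.
Hypothesis mk_cont : forall (Z : topologicalType) (p d : Z -> V -> R),
  (forall v, ~~ B v -> continuous (p ^~ v)) ->
  (forall v, ~~ B v -> continuous (d ^~ v)) -> continuous (fun z => mk (p z) (d z)).

Lemma configuration_chart : exists (X Y : Q -> V -> R) (enc : (V -> R) -> (V -> R) -> Q),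
  [/\ forall v, continuous (X ^~ v) /\ continuous (Y ^~ v),
      forall q, admissible (X q) (Y q),
      forall q, enc (X q) (Y q) = q,
      forall x y, admissible x y -> X (enc x y) = x /\ Y (enc x y) = y
    & forall (Z : topologicalType) (x y : Z -> V -> R),
        (forall z, admissible (x z) (y z)) ->
        (forall v, continuous (x ^~ v)) -> (forall v, continuous (y ^~ v)) ->
        continuous (fun z => enc (x z) (y z))].
Proof.
have proj1c : continuous (fst : Q * R -> Q) by move=> w; exact: cvg_fst.
have proj2c : continuous (snd : Q * R -> R) by move=> w; exact: cvg_snd.
have hc v u : continuous (fun q : Q * R => asym (par ^~ q.1) v u q.2).
  have cp : continuous (fun q : Q * R => par v q.1) by apply: cont_comp.
  apply: contB; apply: contM; try (exact: cont_pospart || exact: cont_negpart).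
    by apply: contD; [exact: cont_cst|exact: cont_pospart].
  by apply: contD; [exact: cont_cst|exact: cont_negpart].
have [Y [YB YI Yc]] := dirichlet (cx_conn K) B0 py (fun q : Q => asym_flux (par ^~ q)) hc.
have Yreg q v : ~~ B v -> regular O (Y q) v.
  by apply: balanced_height_regular; [exact: YB|exact: YI].
have Yuniq q y : (forall b, B b -> y b = py b) -> (forall v, ~~ B v -> regular O y v) ->
    (forall v, ~~ B v -> par v q = height_coord y v) -> Y q = y.
  move=> yB yreg pe; apply: (balanced_uniq (cx_conn K) B0 (asym_flux (par ^~ q))).
  - by move=> b Bb; rewrite YB// yB.
  - exact: YI.
  - by move=> v Bv; apply/asym_balanced; [exact: yreg|exact: pe].
have Ycoord q v : ~~ B v -> height_coord (Y q) v = par v q.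
  by move=> Bv; symmetry; apply/(asym_balanced (par ^~ q)); [exact: Yreg|exact: YI].
have cdiff v u : continuous (fun q => Y q u - Y q v) by apply: contB; exact: Yc.
have cfr v : continuous (fun q => fall (Y q) v - rise (Y q) v).
  by have [cr cf] := rise_fall_cont v Yc; exact: contB.
have cwt v u : ~~ B v -> continuous (fun q => height_weight (Y q) v u).
  move=> Bv; apply: contD; first (apply: contD; first exact: cont_cst).
    apply: contM; last exact: cont_pospart.
    apply: contM; first exact: cont_pospart.
    apply: contV => [q|]; first by rewrite gt_eqF ?sum_pospart2_gt0//; exact: Yreg.
    by apply: cont_sum => z; apply: contX; exact: cont_pospart.
  apply: contM; last exact: cont_negpart.
  apply: contM; first exact: cont_negpart.
  apply: contV => [q|]; first by rewrite gt_eqF ?sum_negpart2_gt0//; exact: Yreg.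
  by apply: cont_sum => z; apply: contX; exact: cont_negpart.
pose w q v u := if B v then 1 else height_weight (Y q) v u.
have w0 q v u : 0 < w q v u by rewrite /w; case: ifP => _; rewrite ?ltr01 ?height_weight_gt0.
have wc v u : continuous (fun q : Q * R => w q.1 v u * q.2).
  apply: contM => //; apply: (cont_comp (k := fun q => w q v u)) => //.
  by rewrite /w; case: (boolP (B v)) => Bv; [exact: cont_cst|exact: cwt].
have hw q : flux (fun v u s => w q v u * s) by exact: linear_flux (w0 q).
have [S [SB SI Sc]] := dirichlet (cx_conn K) B0 px hw wc.
have Spos q a b c : O a b c -> 0 < area (S q) (Y q) a b c.
  apply: (tutte K V0 (w0 q)); [exact: SB|exact: YB|exact: SI|move=> v Bv].
  by rewrite /balanced /w (negbTE Bv); exact/height_weight_balanced/Yreg.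
have areaD (x e y : V -> R) a b c : area (fun v => x v + e v) y a b c =
    area x y a b c + area e y a b c by rewrite /area /cross; ring.
have areaZ (k : R) (e y : V -> R) a b c : area (fun v => e v * k) y a b c =
    k * area e y a b c by rewrite /area /cross; ring.
(* For fixed [Y] areas are affine in the abscissas, so [g q e < 1] says that [S q + e] keeps all
   areas positive. The 0 in the maximum covers directions in which no area decreases. *)
pose g q (e : V -> R) : R := \big[Num.max/0]_(t : V * (V * V) | O t.1 t.2.1 t.2.2)
  (- area e (Y q) t.1 t.2.1 t.2.2 / area (S q) (Y q) t.1 t.2.1 t.2.2).
have g_ge0 q e : 0 <= g q e.
  by rewrite /g; elim/big_rec: _ => // t x _ x0; rewrite le_max x0 orbT.
have gZ q e k : 0 <= k -> g q (fun v => e v * k) = k * g q e.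
  move=> k0; rewrite /g; apply: (big_ind2 (fun x y => x = k * y)).
  - by rewrite mulr0.
  - by move=> x1 x2 y1 y2 -> ->; rewrite maxr_pMr.
  - by move=> t _; rewrite areaZ -mulrN mulrA.
have g_lt1 q e : g q e < 1 <-> forall a b c, O a b c ->
    0 < area (fun v => S q v + e v) (Y q) a b c.
  have key a b c : O a b c -> (- area e (Y q) a b c / area (S q) (Y q) a b c < 1) =
      (0 < area (fun v => S q v + e v) (Y q) a b c).
    by move=> abc; rewrite ltr_pdivrMr ?Spos// mul1r areaD; apply/idP/idP; lra.
  split=> [lt1 a b c abc|pos].
    rewrite -key//; apply: le_lt_trans lt1; rewrite /g.
    by rewrite (bigD1 (a, (b, c))) //= le_max lexx.
  rewrite /g; elim/big_rec: _ => [|t x Ot x1]; first exact: ltr01.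
  by rewrite gt_max x1 key// pos.
(* Heights and centre depend on [q] through [par] alone; [dir] only selects a point of the fibre. *)
have par_only q q' : (forall v, ~~ B v -> par v q = par v q') -> Y q = Y q' /\ S q = S q'.
  move=> qq'; have YE : Y q = Y q'.
    by apply: Yuniq; [exact: YB|exact: Yreg|move=> v Bv; rewrite Ycoord// qq'].
  split=> //; apply: (balanced_uniq (cx_conn K) B0 (hw q)).
  - by move=> b Bb; rewrite !SB.
  - exact: SI.
  - by move=> v Bv; have := SI q' v Bv; rewrite /balanced /w YE.
(* Encoding uses the centre and gauge over [y] before the direction is known; they are read off at
   direction 0. *)
pose q0 y := mk (height_coord y) (fun=> 0).
pose den y x := 1 - g (q0 y) (fun v => x v - S (q0 y) v).
pose enc (x y : V -> R) : Q := mk (height_coord y)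
  (fun v => (x v - S (q0 y) v) / den y x).
pose X q v := S q v + dir v q / (1 + g q (dir ^~ q)).
have g1_gt0 q e : 0 < 1 + g q e by rewrite ltr_pwDl ?ltr01.
have q0Y q : Y (q0 (Y q)) = Y q /\ S (q0 (Y q)) = S q.
  by apply: par_only => v Bv; rewrite mk_par// Ycoord.
have gE q : g (q0 (Y q)) = g q.
  by apply/funext => e; rewrite /g; case: (q0Y q) => -> ->.
have XB q b : B b -> X q b = px b by move=> Bb; rewrite /X dirB// mul0r addr0 SB.
have Xadm q : admissible (X q) (Y q).
  split=> [b Bb|]; first by rewrite XB// YB.
  apply/(g_lt1 q (fun v => dir v q / (1 + g q (dir ^~ q)))).
  by rewrite gZ ?invr_ge0 1?ltW// mulrC ltr_pdivrMr// mul1r ltrDr ltr01.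
have cg (Z : topologicalType) (h : Z -> Q) (e : Z -> V -> R) : continuous h ->
    (forall v, continuous (e ^~ v)) -> continuous (fun z => g (h z) (e z)).
  move=> ch ce; rewrite /g.
  have cY v : continuous (fun z => Y (h z) v) by apply: (cont_comp (k := Y ^~ v)).
  have cS v : continuous (fun z => S (h z) v) by apply: (cont_comp (k := S ^~ v)).
  have cA (t1 t2 t3 : V) (a : Z -> V -> R) : (forall v, continuous (a ^~ v)) ->
      continuous (fun z => area (a z) (Y (h z)) t1 t2 t3).
    by move=> ca; rewrite /area /cross; apply: contB; apply: contM; apply: contB.
  (* Triples that are not triangles may have zero area; the value 0 keeps their terms continuous. *)
  pose F (t : V * (V * V)) z := if O t.1 t.2.1 t.2.2 then
    - area (e z) (Y (h z)) t.1 t.2.1 t.2.2 / area (S (h z)) (Y (h z)) t.1 t.2.1 t.2.2 else 0.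
  rewrite (_ : (fun z => _) = fun z =>
    \big[Num.max/0]_(t : V * (V * V) | O t.1 t.2.1 t.2.2) F t z).
    apply: cont_bigmax => t; rewrite /F; case: (boolP (O _ _ _)) => Ot; last exact: cont_cst.
    apply: contM; first by apply: contN; exact: cA.
    by apply: contV => [z|]; [rewrite gt_eqF// Spos|exact: cA].
  by apply/funext => z; apply: eq_bigr => t Ot; rewrite /F Ot.
have adm_q0 x y : admissible x y -> Y (q0 y) = y.
  move=> adm; apply: Yuniq => [b /(proj1 adm)[]//|v|v Bv]; first exact: admissible_regular adm.
  by rewrite mk_par.
have den_gt0 x y : admissible x y -> 0 < den y x.
  move=> adm; rewrite subr_gt0; apply/g_lt1 => a b c abc; rewrite (adm_q0 x y adm).
  rewrite (_ : (fun v => _) = x); first exact: (proj2 adm).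
  by apply/funext => v; rewrite addrC subrK.
exists X, Y, enc; split.
- move=> v; split=> //; apply: contD => //; apply: contM => //.
  apply: contV => [q|]; first by rewrite gt_eqF.
  apply: contD; first exact: cont_cst.
  by apply: (cg Q id (fun q => dir ^~ q)) => // q; exact: cvg_id.
- exact: Xadm.
- move=> q; rewrite /enc -[RHS]mkK; apply: mk_ext => v Bv; first exact: Ycoord.
  rewrite /den; have [_ ->] := q0Y q; rewrite gE.
  have XS : (fun v => X q v - S q v) = (fun v => dir v q * (1 + g q (dir ^~ q))^-1).
    by apply/funext => u; rewrite /X addrC addKr.
  rewrite XS gZ ?invr_ge0 1?ltW// /X [S q v + _]addrC addrK.
  have := g1_gt0 q (dir ^~ q); set G := g q _ => G0.
  by field; rewrite gt_eqF//=; apply/negP => /eqP; lra.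
- move=> x y adm; have qE := adm_q0 x y adm.
  have [YE SE] : Y (enc x y) = Y (q0 y) /\ S (enc x y) = S (q0 y).
    by apply: par_only => v Bv; rewrite !mk_par.
  split; last by rewrite YE qE.
  have d0 := den_gt0 x y adm.
  have dE : (dir ^~ (enc x y)) = fun v => (x v - S (q0 y) v) * (den y x)^-1.
    apply/funext => v; have [Bv|Bv] := boolP (B v); last by rewrite mk_dir.
    by rewrite dirB// SB// (proj1 (proj1 adm v Bv)) subrr mul0r.
  have gEE : g (enc x y) = g (q0 y).
    by apply/funext => e; rewrite /g YE SE.
  apply/funext => v; rewrite /X gEE dE gZ ?invr_ge0 1?ltW// SE.
  have -> : dir v (enc x y) = (x v - S (q0 y) v) * (den y x)^-1.
    by rewrite -[LHS]/((dir ^~ (enc x y)) v) dE.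
  have gden : g (q0 y) (fun v => x v - S (q0 y) v) = 1 - den y x by rewrite /den; ring.
  rewrite gden; move: d0; set D := den y x => D0.
  by field; rewrite gt_eqF//=; apply/negP => /eqP; lra.
- move=> Z x y adm cx cy.
  have reg z v : ~~ B v -> regular O (y z) v by exact: admissible_regular (adm z).
  have cc v : ~~ B v -> continuous (fun z => height_coord (y z) v).
    move=> Bv; have [cr cf] := rise_fall_cont v cy.
    apply: contB; apply: contM.
    - by apply: cont_pospart; exact: contB.
    - by apply: contV => // z; rewrite gt_eqF// rise_gt0//; exact: reg.
    - by apply: cont_negpart; exact: contB.
    - by apply: contV => // z; rewrite gt_eqF// fall_gt0//; exact: reg.
  have cq : continuous (fun z => q0 (y z)).
    by apply: mk_cont => // v _; exact: cont_cst.
  have cS v : continuous (fun z => x z v - S (q0 (y z)) v).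
    by apply: contB => //; apply: (cont_comp (k := S ^~ v)).
  apply: mk_cont => // v Bv; apply: contM => //.
  apply: contV => [z|]; first by rewrite gt_eqF// den_gt0.
  apply: contB; first exact: cont_cst.
  by apply: (cg Z (fun z => q0 (y z)) (fun z v => x z v - S (q0 (y z)) v)).
Qed.

End Chart.
End ConfigurationChart.

(** * Counting preimages along a ray *)

Section RayCrossing.
Variable R : realFieldType.
Implicit Types s t e : R.

(* Signed crossing of the vertical ray above [q] by an edge with endpoints at
   horizontal offsets [s] and [t] from [q], where [e] tells the side of the edge
   on which [q] lies. *)
Definition ray_cross s t e : R :=
  ((t < 0 < s) && (0 < e))%:R - ((s < 0 < t) && (e < 0))%:R.

(** Local degree of a triangle at [q], where [e1], [e2], [e3] are the unnormalized barycentric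
    coordinates of [q]. *)
Definition signed_inside e1 e2 e3 : R :=
  [&& 0 < e1, 0 < e2 & 0 < e3]%:R - [&& e1 < 0, e2 < 0 & e3 < 0]%:R.

Lemma ray_crossC s t e : ray_cross t s (- e) = - ray_cross s t e.
Proof. by rewrite /ray_cross oppr_gt0 oppr_lt0 opprB. Qed.

(** The ray from [q] meets the boundary of the triangle with total sign the winding number. The
    linear relation enters through signs only: the products [s * e] are neither all positive nor all
    negative, and the remaining sign patterns are checked one by one. *)
Lemma ray_cross_sum s1 s2 s3 e1 e2 e3 :
  s1 != 0 -> s2 != 0 -> s3 != 0 -> e1 != 0 -> e2 != 0 -> e3 != 0 ->
  s1 * e1 + s2 * e2 + s3 * e3 = 0 ->
  ray_cross s1 s2 e3 + ray_cross s2 s3 e1 + ray_cross s3 s1 e2 =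
  signed_inside e1 e2 e3.
Proof.
move=> s10 s20 s30 e10 e20 e30 H; rewrite /ray_cross /signed_inside.
have neg s : s != 0 -> (s < 0) = ~~ (0 < s) by move=> s0; case: ltgtP s0.
have prod s e : s != 0 -> e != 0 -> (0 < s * e) = ((0 < s) == (0 < e)).
  rewrite !neq_lt => /orP[s0|s0] /orP[e0|e0].
  - by rewrite nmulr_rgt0// e0 (lt_gtF s0) (lt_gtF e0).
  - by rewrite nmulr_rgt0// e0 (lt_gtF s0) (lt_gtF e0).
  - by rewrite pmulr_rgt0// s0 (lt_gtF e0).
  - by rewrite pmulr_rgt0// s0 e0.
have : ~~ [&& 0 < s1 * e1, 0 < s2 * e2 & 0 < s3 * e3].
  by apply/negP => /and3P[]; lra.
have : [|| 0 < s1 * e1, 0 < s2 * e2 | 0 < s3 * e3].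
  have := mulf_neq0 s10 e10; rewrite -[_ || _]negbK !negb_or => p1.
  apply/negP => /and3P[]; rewrite -!leNgt => q1 q2 q3; move/eqP: p1; apply.
  by apply/le_anti; rewrite q1 /=; lra.
rewrite !prod// !neg//.
by case: (0 < s1); case: (0 < s2); case: (0 < s3); case: (0 < e1); case: (0 < e2);
  case: (0 < e3) => //= _ _; rewrite ?subrr ?subr0 ?sub0r ?addr0 ?add0r ?addNr ?subrr.
Qed.

End RayCrossing.

Section Stokes.
Variables (R : realFieldType) (V : finType) (O : V -> V -> V -> bool)
  (B : pred V) (px py : V -> R).
Hypothesis K : disk_complex O B px py.
Variables (qx qy : R).

Definition side (X Y : V -> R) a b : R :=
  cross (X b - X a) (Y b - Y a) (qx - X a) (qy - Y a).

Definition generic (X Y : V -> R) : Prop :=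
  (forall v, X v != qx) /\ (forall a b c, O a b c -> side X Y a b != 0).

Definition inside (X Y : V -> R) a b c : R :=
  signed_inside (side X Y b c) (side X Y c a) (side X Y a b).

Let chi (X Y : V -> R) a b : R := ray_cross (X a - qx) (X b - qx) (side X Y a b).

Lemma sideC X Y a b : side X Y b a = - side X Y a b.
Proof. by rewrite /side /cross; ring. Qed.

Lemma chi_inside X Y a b c : generic X Y -> O a b c ->
  chi X Y a b + chi X Y b c + chi X Y c a = inside X Y a b c.
Proof.
move=> [gX gS] abc; have bca := cx_rot K abc; have cab := cx_rot K bca.
apply: ray_cross_sum.
- by rewrite subr_eq0.
- by rewrite subr_eq0.
- by rewrite subr_eq0.
- exact: gS bca.
- exact: gS cab.
- exact: gS abc.
- by rewrite /side /cross; ring.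
Qed.

Lemma sum_inside X Y : generic X Y ->
  \sum_a \sum_(x : V * V | O a x.1 x.2) inside X Y a x.1 x.2 =
  3 * \sum_a \sum_(x : V * V | O a x.1 x.2) chi X Y a x.1.
Proof.
move=> gen; pose F a b (c : V) := chi X Y a b.
have S1 := total_rot K F; have S2 := total_rot K (fun a b c => F b c a).
transitivity (\sum_a \sum_(x : V * V | O a x.1 x.2) F a x.1 x.2 +
    \sum_a \sum_(x : V * V | O a x.1 x.2) F x.1 x.2 a +
    \sum_a \sum_(x : V * V | O a x.1 x.2) F x.2 a x.1).
  rewrite -!big_split /=; apply: eq_bigr => a _.
  rewrite -!big_split /=; apply: eq_bigr => x ax.
  by rewrite /F -chi_inside.
by rewrite -S2 -S1; ring.
Qed.

(** [D] is the change in the crossing number of an edge. It vanishes when both ends are boundary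
    vertices, for sides of [K] and chords alike; every other edge is traversed equally often both
    ways. Being antisymmetric, [D] then sums to its own negative. *)
Lemma stokes X Y : generic px py -> generic X Y ->
  (forall b, B b -> X b = px b /\ Y b = py b) ->
  \sum_a \sum_(x : V * V | O a x.1 x.2) inside X Y a x.1 x.2 =
  \sum_a \sum_(x : V * V | O a x.1 x.2) inside px py a x.1 x.2.
Proof.
move=> gp gX XB; rewrite !sum_inside//; congr (3 * _).
pose L a b : R := \sum_c (O a b c)%:R.
have LE (f : V -> V -> R) : \sum_a \sum_(x : V * V | O a x.1 x.2) f a x.1 =
    \sum_a \sum_b L a b * f a b.
  apply: eq_bigr => a _; rewrite big_mkcond /=.
  rewrite -(pair_bigA _ (fun b c => if O a b c then f a b else 0)) /=.
  apply: eq_bigr => b _; rewrite mulr_suml; apply: eq_bigr => c _.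
  by case: (O a b c); rewrite ?mul1r ?mul0r.
have Lsym a b : ~~ (B b && B a) -> L a b = L b a.
  rewrite /L => /(degree_balance K) ->; apply: eq_bigr => c _; congr (_%:R).
  by congr nat_of_bool; apply/idP/idP => [/(cx_rot2 K)|/(cx_rot K)].
rewrite !LE; apply/eqP; rewrite -subr_eq0.
pose D a b := chi X Y a b - chi px py a b.
have chiC Z W a b : chi Z W b a = - chi Z W a b.
  by rewrite /chi (sideC Z W a b) (ray_crossC (Z a - qx) (Z b - qx)).
have DC a b : D b a = - D a b.
  rewrite /D (chiC X Y a b) (chiC px py a b).
  by move: (chi X Y a b) (chi px py a b) => x y; rewrite opprB opprK addrC.
have DB a b : B a -> B b -> D a b = 0.
  by move=> /XB[e1 e2] /XB[e3 e4]; rewrite /D /chi /side e1 e2 e3 e4 subrr.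
have LD a b : L b a * D a b = L a b * D a b.
  have [/andP[Bb Ba]|/Lsym -> //] := boolP (B b && B a).
  by rewrite (DB a b) // !mulr0.
pose S := \sum_a \sum_b L a b * D a b.
have -> : \sum_a \sum_b L a b * chi X Y a b - \sum_a \sum_b L a b * chi px py a b = S.
  rewrite -sumrB; apply: eq_bigr => a _; rewrite -sumrB; apply: eq_bigr => b _.
  by rewrite -mulrBr.
have : S = - S.
  rewrite {1}/S exchange_big -sumrN; apply: eq_bigr => a _.
  rewrite -sumrN; apply: eq_bigr => b _.
  by rewrite DC mulrN LD.
by move=> SN; apply/eqP; lra.
Qed.

End Stokes.

(** * The plane *)

Section Plane.
Context {R : realType}.
Notation plane := 'rV[R]_2.
Implicit Types (p q r a b c x y : plane).

Definition xc p : R := p 0 0.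
Definition yc p : R := p 0 1.

Lemma planeP p q : xc p = xc q -> yc p = yc q -> p = q.
Proof.
move=> e1 e2; apply/rowP => -[[|[|//]] i].
  by rewrite (_ : Ordinal _ = 0)//; exact/val_inj.
by rewrite (_ : Ordinal _ = 1)//; exact/val_inj.
Qed.

Definition pt (s t : R) : plane := \row_i if i == 0 then s else t.

Lemma xc_pt s t : xc (pt s t) = s. Proof. by rewrite /xc mxE. Qed.
Lemma yc_pt s t : yc (pt s t) = t. Proof. by rewrite /yc mxE. Qed.
Lemma xcD p q : xc (p + q) = xc p + xc q. Proof. by rewrite /xc mxE. Qed.
Lemma ycD p q : yc (p + q) = yc p + yc q. Proof. by rewrite /yc mxE. Qed.
Lemma xcZ t p : xc (t *: p) = t * xc p. Proof. by rewrite /xc mxE. Qed.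
Lemma ycZ t p : yc (t *: p) = t * yc p. Proof. by rewrite /yc mxE. Qed.
Lemma xcN p : xc (- p) = - xc p. Proof. by rewrite /xc mxE. Qed.
Lemma ycN p : yc (- p) = - yc p. Proof. by rewrite /yc mxE. Qed.
Definition coordE := (xcD, ycD, xcZ, ycZ, xcN, ycN, xc_pt, yc_pt).

Lemma xc_cont : continuous xc. Proof. exact: coord_continuous. Qed.
Lemma yc_cont : continuous yc. Proof. exact: coord_continuous. Qed.

Lemma cont_plane (T : topologicalType) (f : T -> plane) :
  continuous (fun t => xc (f t)) -> continuous (fun t => yc (f t)) -> continuous f.
Proof.
move=> cx cy; apply: cont_mx => i j; rewrite ord1.
case: j => -[|[|//]] j.
  by rewrite (_ : Ordinal _ = 0)//; exact/val_inj.
by rewrite (_ : Ordinal _ = 1)//; exact/val_inj.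
Qed.

Definition orient p q r : R := area xc yc p q r.

Lemma orient_cont p q : continuous (orient p q).
Proof.
rewrite /orient /area /cross; apply: contB; apply: contM;
  try exact: cont_cst; apply: contB; (exact: xc_cont || exact: yc_cont || exact: cont_cst).
Qed.

(** Half planes instead of a hull give closedness and sign tests at once; this is the triangle for
    positively oriented corners. *)
Definition tri a b c : set plane :=
  [set x | [/\ 0 <= orient b c x, 0 <= orient c a x & 0 <= orient a b x]].
Definition otri a b c : set plane :=
  [set x | [/\ 0 < orient b c x, 0 < orient c a x & 0 < orient a b x]].

Lemma orientE a b c x : orient a b c = orient b c x + orient c a x + orient a b x.
Proof. by rewrite /orient /area /cross; ring. Qed.

Lemma bary_xc a b c x : orient a b c * xc x =
  orient b c x * xc a + orient c a x * xc b + orient a b x * xc c.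
Proof. by rewrite /orient /area /cross; ring. Qed.

Lemma bary_yc a b c x : orient a b c * yc x =
  orient b c x * yc a + orient c a x * yc b + orient a b x * yc c.
Proof. by rewrite /orient /area /cross; ring. Qed.

Lemma baryE a b c x : orient a b c != 0 ->
  x = (orient b c x / orient a b c) *: a + (orient c a x / orient a b c) *: b +
      (orient a b x / orient a b c) *: c.
Proof.
move=> D0; apply: planeP; rewrite !coordE; apply: (mulfI D0).
  rewrite bary_xc; set D := orient a b c in D0 *; set e := orient b c x.
  by set f := orient c a x; set g := orient a b x; field.
rewrite bary_yc; set D := orient a b c in D0 *; set e := orient b c x.
by set f := orient c a x; set g := orient a b x; field.
Qed.

Lemma tri_closed a b c : closed (tri a b c).
Proof.
rewrite (_ : tri a b c = (orient b c @^-1` [set t | 0 <= t]) `&`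
  (orient c a @^-1` [set t | 0 <= t]) `&` (orient a b @^-1` [set t | 0 <= t])).
  have cl p q : closed (orient p q @^-1` [set t | 0 <= t]).
    by have /continuous_closedP := @orient_cont p q; apply; exact: closed_ge.
  by apply: closedI => //; apply: closedI.
by apply/seteqP; split=> [x [? ? ?]|x [[? ?] ?]].
Qed.

Lemma otri_open a b c : open (otri a b c).
Proof.
rewrite (_ : otri a b c = [set x | 0 < orient b c x] `&`
  [set x | 0 < orient c a x] `&` [set x | 0 < orient a b x]).
  have op p q : open [set x | 0 < orient p q x] by apply: cont_open; exact: orient_cont.
  by apply: openI => //; apply: openI.
by apply/seteqP; split=> [x [? ? ?]|x [[? ?] ?]].
Qed.

Lemma otri_tri a b c x : otri a b c x -> tri a b c x.
Proof. by move=> [? ? ?]; split; exact: ltW. Qed.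

Lemma centroid_otri a b c : 0 < orient a b c -> otri a b c (3^-1 *: (a + b + c)).
Proof.
move=> D0; have D3 : 0 < 3^-1 * orient a b c by rewrite mulr_gt0// invr_gt0.
by split; move: D3; congr (0 < _); rewrite /orient /area /cross !coordE; field.
Qed.

Lemma orient_uniq a b c : orient a b c != 0 -> uniq [:: a; b; c].
Proof.
move=> D0; rewrite /= !inE negb_or !andbT.
by apply/andP; split; [apply/andP; split|]; apply: contraNneq D0 => ->;
  rewrite /orient /area /cross; apply/eqP; ring.
Qed.

Lemma sum_fset3 (M : nmodType) (F : plane -> M) a b c : uniq [:: a; b; c] ->
  \sum_(p <- [fset a; b; c]%fset) F p = F a + F b + F c.
Proof.
move=> u; rewrite (perm_big [:: a; b; c]) /=.
  by rewrite !big_cons big_nil addr0 addrA.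
by apply: uniq_perm (fset_uniq _) u _ => p; rewrite !inE orbA.
Qed.

Definition coef3 a b c (s t u : R) : plane -> R :=
  fun p => if p == a then s else if p == b then t else u.

Lemma coef3E a b c s t u : uniq [:: a; b; c] ->
  [/\ coef3 a b c s t u a = s, coef3 a b c s t u b = t & coef3 a b c s t u c = u].
Proof.
rewrite /= !inE negb_or andbT => /andP[/andP[ab ac] bc].
rewrite /coef3 !eqxx [b == a]eq_sym (negbTE ab) [c == a]eq_sym (negbTE ac).
by rewrite [c == b]eq_sym (negbTE bc).
Qed.

Lemma hull_tri a b c : 0 < orient a b c -> hull [fset a; b; c]%fset = tri a b c.
Proof.
move=> D0; have Dn0 : orient a b c != 0 by rewrite gt_eqF.
have u := orient_uniq Dn0.
apply/seteqP; split=> x /=.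
  move=> [k [k0 k1 xE]]; rewrite sum_fset3// in k1; rewrite sum_fset3// in xE.
  have [ka kb kc] : [/\ 0 <= k a, 0 <= k b & 0 <= k c].
    by split; apply: k0; rewrite !inE eqxx ?orbT.
  have E p q : orient p q x = k a * orient p q a + k b * orient p q b + k c * orient p q c.
    by rewrite xE /orient /area /cross !coordE; move: k1; nra.
  have r1 : orient b c a = orient a b c by rewrite /orient area_rot.
  have r2 : orient c a b = orient a b c by rewrite /orient -area_rot.
  have z p q : orient p q p = 0 /\ orient p q q = 0.
    by split; rewrite /orient /area /cross; ring.
  by split; rewrite E ?r1 ?r2 !(proj1 (z _ _)) !(proj2 (z _ _)) !mulr0 ?addr0 ?add0r
    mulr_ge0// ltW.
move=> [e f g].
exists (coef3 a b c (orient b c x / orient a b c) (orient c a x / orient a b c)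
  (orient a b x / orient a b c)).
have [Ea Eb Ec] := coef3E (orient b c x / orient a b c) (orient c a x / orient a b c)
  (orient a b x / orient a b c) u.
split.
- by move=> p _; rewrite /coef3; case: ifP => _; [|case: ifP => _]; rewrite divr_ge0// ltW.
- by rewrite sum_fset3// Ea Eb Ec -!mulrDl -orientE divff.
- by rewrite sum_fset3// Ea Eb Ec -baryE.
Qed.

Lemma open_ray (U : set plane) x d : open U -> U x ->
  exists2 e : R, 0 < e & forall t, `|t| < e -> U (x + t *: d).
Proof.
move=> oU Ux.
have cf : continuous (fun t : R => x + t *: d).
  apply: cont_plane.
    rewrite (_ : (fun t => _) = fun t => xc x + t * xc d).
      apply: contD; first exact: cont_cst.
      by apply: contM; [move=> ?; exact: cvg_id|exact: cont_cst].
    by apply/funext => t; rewrite !coordE.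
  rewrite (_ : (fun t => _) = fun t => yc x + t * yc d).
    apply: contD; first exact: cont_cst.
    by apply: contM; [move=> ?; exact: cvg_id|exact: cont_cst].
  by apply/funext => t; rewrite !coordE.
have : nbhs (x + (0 : R) *: d) U.
  by apply: open_nbhs_nbhs; split => //; rewrite scale0r addr0.
move=> /(cf 0) /nbhs_ballP[e /= e0 He]; exists e => // t te.
by apply: He; rewrite /ball /= sub0r normrN.
Qed.

Definition on_line (l : R * R * R) x : R := l.1.1 * xc x + l.1.2 * yc x + l.2.

(** A point found on [l] is moved off it by a small step along the normal. The part of [U] off [l]
    is again open and nonempty, so the lines are avoided one at a time. *)
Lemma avoid_lines (ls : seq (R * R * R)) (U : set plane) :
  (forall l, l \in ls -> (l.1.1 != 0) || (l.1.2 != 0)) -> open U -> U !=set0 ->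
  exists2 x, U x & forall l, l \in ls -> on_line l x != 0.
Proof.
elim: ls U => [|l ls IH] U nz oU [x0 Ux0]; first by exists x0.
have cl : continuous (on_line l).
  by rewrite /on_line; apply: contD; [apply: contD; apply: contM;
    (exact: cont_cst || exact: xc_cont || exact: yc_cont)|exact: cont_cst].
have oU' : open (U `&` on_line l @^-1` [set t | t != 0]).
  by apply: openI => //; apply: open_comp; [move=> ? _; exact: cl|exact: open_neq].
have [||x [Ux lx] xls] := IH _ _ oU'.
- by move=> k kls; apply: nz; rewrite inE kls orbT.
- have [lx0|lx0] := eqVneq (on_line l x0) 0; last by exists x0.
  have [e e0 He] := open_ray (pt l.1.1 l.1.2) oU Ux0.
  exists (x0 + (e / 2) *: pt l.1.1 l.1.2); split.
    by apply: He; rewrite gtr0_norm ?divr_gt0//; lra.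
  rewrite /=; have -> : on_line l (x0 + (e / 2) *: pt l.1.1 l.1.2) =
    (e / 2) * (l.1.1 ^+ 2 + l.1.2 ^+ 2).
    move: lx0; rewrite /on_line !coordE => lx0.
    by apply/eqP; rewrite -subr_eq0 -lx0; apply/eqP; ring.
  rewrite mulf_neq0 ?gt_eqF ?divr_gt0// lt0r addr_ge0 ?sqr_ge0// andbT.
  rewrite paddr_eq0 ?sqr_ge0// !sqrf_eq0 negb_and.
  by apply: nz; rewrite inE eqxx.
- by exists x => // k; rewrite inE => /orP[/eqP ->|/xls].
Qed.

End Plane.

Section SubtypeTopology.
Context {X : topologicalType} {A : set X}.

Lemma cont_val : continuous (\val : set_type A -> X).
Proof. exact: initial_continuous. Qed.

Lemma cont_set_type (T : topologicalType) (f : T -> set_type A) :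
  continuous (fun t => \val (f t)) -> continuous f.
Proof. by move=> cf; apply: continuous_comp_initial. Qed.

Lemma set_typeP (x : set_type A) : A (\val x).
Proof. by case: x => x /= /set_mem. Qed.

Definition to_set_type (x : X) (Ax : A x) : set_type A := exist _ x (mem_set Ax).

End SubtypeTopology.

(** * No continuous injection of the disk into a line *)

Section DiskNotInLine.
Context {R : realType}.
Notation plane := 'rV[R]_2.
Notation disk := (set_type (@closed_disk R)).

Lemma closed_disk_convex (p q : plane) t : closed_disk p -> closed_disk q ->
  0 <= t <= 1 -> closed_disk (p + t *: (q - p)).
Proof.
rewrite /closed_disk /= -/(xc _) -/(yc _) -/(xc _) -/(yc _) -/(xc _) -/(yc _) !coordE.
move=> hp hq /andP[t0 t1].
have : 0 <= t * (1 - t) * ((xc q - xc p) ^+ 2 + (yc q - yc p) ^+ 2).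
  apply: mulr_ge0; last by rewrite addr_ge0 ?sqr_ge0.
  by rewrite mulr_ge0 // subr_ge0.
nra.
Qed.

(* The segment joining the points where [f] takes the extreme values would
   contain a point with the middle value. *)
Lemma disk_no_middle (f : disk -> R) (p q r : disk) : continuous f -> injective f ->
  orient (\val p) (\val r) (\val q) != 0 -> ~ (f p < f q < f r).
Proof.
move=> cf fi nc /andP[pq qr].
(* Clamping lets the segment from [p] to [r] be a path in the disk defined on all of [R]. *)
pose cl (t : R) := Num.max 0 (Num.min t 1).
have clb t : 0 <= cl t <= 1 by rewrite /cl le_max lexx ge_max ler01 ge_min lexx orbT.
pose h t : disk := to_set_type (closed_disk_convex (set_typeP p) (set_typeP r) (clb t)).
have ccl : continuous cl.
  apply: cont_max; first exact: cont_cst.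
  by move=> x; apply: continuous_min; [exact: cvg_id|exact: cvg_cst].
have ch : continuous h.
  apply: cont_set_type; apply: cont_plane => /=.
    rewrite (_ : (fun t => _) = fun t => xc (\val p) + cl t * (xc (\val r) - xc (\val p))).
      by apply: contD; [exact: cont_cst|apply: contM => //; exact: cont_cst].
    by apply/funext => t; rewrite !coordE.
  rewrite (_ : (fun t => _) = fun t => yc (\val p) + cl t * (yc (\val r) - yc (\val p))).
    by apply: contD; [exact: cont_cst|apply: contM => //; exact: cont_cst].
  by apply/funext => t; rewrite !coordE.
have h0 : h 0 = p.
  by apply/val_inj; rewrite /= /cl min_l ?ler01// maxxx scale0r addr0.
have h1 : h 1 = r.
  by apply/val_inj; rewrite /= /cl minxx max_r ?ler01// scale1r addrC subrK.
have [||t _ ft] := @IVT R (f \o h) 0 1 (f q) ler01.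
- apply: continuous_subspaceT => t; exact: (continuous_comp (ch t) (cf (h t))).
- by rewrite /= h0 h1 ge_min (ltW pq) le_max (ltW qr) orbT.
have ht := fi _ _ ft.
by move/eqP: nc; apply; rewrite -ht /= /orient /area /cross !coordE; ring.
Qed.

(** Of three noncollinear points one takes the middle value, and it lies off the segment joining the
    other two. *)
Lemma disk_not_in_line (f : disk -> R) : continuous f -> ~ injective f.
Proof.
move=> cf fi.
have d0 : closed_disk (pt 0 0 : plane).
  by rewrite /closed_disk /= -/(xc _) -/(yc _) !coordE; lra.
have d1 : closed_disk (pt 1 0 : plane).
  by rewrite /closed_disk /= -/(xc _) -/(yc _) !coordE; lra.
have d2 : closed_disk (pt 0 1 : plane).
  by rewrite /closed_disk /= -/(xc _) -/(yc _) !coordE; lra.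
pose p := to_set_type d0; pose q := to_set_type d1; pose r := to_set_type d2.
have D : orient (\val p) (\val q) (\val r) = 1.
  by rewrite /= /orient /area /cross !coordE; ring.
have nz (a b c : disk) : orient (\val p) (\val q) (\val r) = orient (\val a) (\val b) (\val c) \/
    orient (\val p) (\val q) (\val r) = - orient (\val a) (\val b) (\val c) ->
    orient (\val a) (\val b) (\val c) != 0.
  by rewrite D => -[]; apply: contra_eqN => /eqP ->; rewrite ?oppr0 oner_eq0.
have neq (a b : disk) : \val a != \val b -> f a != f b.
  by apply: contraNneq => /fi ->.
have pq : f p != f q.
  apply: neq; apply/eqP => /(congr1 xc)/eqP; rewrite /= !coordE.
  by rewrite eq_sym oner_eq0.
have qr : f q != f r.
  by apply: neq; apply/eqP => /(congr1 xc)/eqP; rewrite /= !coordE oner_eq0.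
have pr : f p != f r.
  apply: neq; apply/eqP => /(congr1 yc)/eqP; rewrite /= !coordE.
  by rewrite eq_sym oner_eq0.
have M a b c := @disk_no_middle f a b c cf fi.
move: pq qr pr; case: (ltgtP (f p) (f q)) => // pq _; case: (ltgtP (f q) (f r)) => // qr _;
  case: (ltgtP (f p) (f r)) => // pr _; try lra.
- by apply: (M p q r); [apply: nz; right; rewrite /orient /area /cross; ring|rewrite pq].
- by apply: (M p r q); [apply: nz; left|rewrite pr].
- by apply: (M r p q); [apply: nz; right; rewrite /orient /area /cross; ring|rewrite pr].
- by apply: (M q p r); [apply: nz; left; rewrite /orient /area /cross; ring|rewrite pq].
- by apply: (M q r p); [apply: nz; right; rewrite /orient /area /cross; ring|rewrite qr].
- by apply: (M r q p); [apply: nz; left; rewrite /orient /area /cross; ring|rewrite qr].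
Qed.

End DiskNotInLine.

(** * Convex combinations and interior points *)

Section Disk.
Context {R : realType}.
Notation plane := 'rV[R]_2.
Variables (K : set plane) (T : {fset {fset plane}}).
Hypothesis K_disk : SL_disk K T.
Hypothesis K_convex : convex_set K.
Implicit Types (a b c x y o : plane) (s t u : {fset plane}).

Lemma conv2 x y (t : R) : K x -> K y -> 0 <= t -> t <= 1 -> K (t *: x + (1 - t) *: y).
Proof.
move=> Kx Ky t0 t1.
by have /set_mem := K_convex (Itv01 t0 t1) (mem_set Kx) (mem_set Ky).
Qed.

Lemma conv3 x y z (r s t : R) : K x -> K y -> K z -> 0 <= r -> 0 <= s -> 0 <= t ->
  r + s + t = 1 -> K (r *: x + s *: y + t *: z).
Proof.
move=> Kx Ky Kz r0 s0 t0 e.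
have [t1|t1] := eqVneq t 1.
  have [-> ->] : r = 0 /\ s = 0 by split; lra.
  by rewrite t1 !scale0r !add0r scale1r.
have rs : 0 < r + s by have /orP[] : (t < 1) || (1 < t) by [rewrite -neq_lt]; lra.
have -> : r *: x + s *: y + t *: z =
    (r + s) *: ((r / (r + s)) *: x + (1 - r / (r + s)) *: y) + (1 - (r + s)) *: z.
  apply: planeP; rewrite !coordE (_ : 1 - (r + s) = t); try lra;
  by field; rewrite gt_eqF.
apply: conv2 => //; try lra; apply: conv2 => //; first by rewrite divr_ge0// ltW.
by rewrite ler_pdivrMr//; lra.
Qed.

Lemma tri_sub a b c : K a -> K b -> K c -> 0 < orient a b c -> tri a b c `<=` K.
Proof.
move=> Ka Kb Kc D0 x [e f g]; rewrite (@baryE _ a b c x) ?gt_eqF//.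
apply: conv3 => //; try by rewrite divr_ge0 // ltW.
by rewrite -!mulrDl -orientE divff ?gt_eqF.
Qed.

(** The homothety with centre [x] and ratio [t] carries a neighbourhood of [o] in [K] to one of the
    new point. *)
Lemma segment_interior o x (t : R) : K° o -> K x -> 0 < t -> t <= 1 ->
  K° (t *: o + (1 - t) *: x).
Proof.
move=> Ko Kx t0 t1.
have cf : continuous (fun y : plane => t^-1 *: (y - (1 - t) *: x)).
  apply: cont_plane.
    rewrite (_ : (fun y => _) = fun y => t^-1 * (xc y - (1 - t) * xc x)).
      by apply: contM; [exact: cont_cst|apply: contB; [exact: xc_cont|exact: cont_cst]].
    by apply/funext => y; rewrite !coordE.
  rewrite (_ : (fun y => _) = fun y => t^-1 * (yc y - (1 - t) * yc x)).
    by apply: contM; [exact: cont_cst|apply: contB; [exact: yc_cont|exact: cont_cst]].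
  by apply/funext => y; rewrite !coordE.
have : nbhs (t^-1 *: (t *: o + (1 - t) *: x - (1 - t) *: x)) K.
  by rewrite addrK scalerA mulVf ?gt_eqF// scale1r.
move=> /(cf (t *: o + (1 - t) *: x)) H.
suff : nbhs (t *: o + (1 - t) *: x) K by [].
have {}H : nbhs (t *: o + (1 - t) *: x) [set y | K (t^-1 *: (y - (1 - t) *: x))] by exact: H.
apply: filterS H => y /= Ky.
have -> : y = t *: (t^-1 *: (y - (1 - t) *: x)) + (1 - t) *: x.
  by rewrite scalerA mulfV ?gt_eqF// scale1r subrK.
by apply: conv2 => //; exact: ltW.
Qed.

(** Here the homeomorphism with the round disk enters: on a collinear [K] the scalar product with
    [b - a] would be injective, giving a continuous injection of the disk into the line. *)
Lemma noncollinear : exists a b c, [/\ K a, K b, K c & 0 < orient a b c].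
Proof.
have [_ _ [f [g [fK gK cf cg]]]] := K_disk.
apply: contrapT => no.
have col a b c : K a -> K b -> K c -> orient a b c = 0.
  move=> Ka Kb Kc; apply/eqP; rewrite eq_le !leNgt; apply/andP; split; apply/negP => D.
    by apply: no; exists a, b, c.
  apply: no; exists a, c, b; split => //.
  by move: D; rewrite -oppr_gt0; congr (0 < _); rewrite /orient /area /cross; ring.
have d0 : closed_disk (pt 0 0 : plane).
  by rewrite /closed_disk /= -/(xc _) -/(yc _) !coordE; lra.
have d1 : closed_disk (pt 1 0 : plane).
  by rewrite /closed_disk /= -/(xc _) -/(yc _) !coordE; lra.
pose p := to_set_type d0; pose q := to_set_type d1.
pose a := \val (g p); pose b := \val (g q).
have ab : a <> b.
  move=> /val_inj/(can_inj gK)/(congr1 \val)/(congr1 xc); rewrite /= !coordE.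
  by move/esym/eqP; rewrite oner_eq0.
pose h (z : set_type closed_disk) : R :=
  (xc b - xc a) * xc (\val (g z)) + (yc b - yc a) * yc (\val (g z)).
apply: (@disk_not_in_line R h).
  have cv : continuous (fun z => \val (g z)) by apply: cont_comp => //; exact: cont_val.
  by apply: contD; apply: contM; try exact: cont_cst;
    [apply: (cont_comp cv xc_cont)|apply: (cont_comp cv yc_cont)].
move=> z w zw; apply: (can_inj gK); apply: val_inj.
have := col _ _ _ (set_typeP (g p)) (set_typeP (g q)) (set_typeP (g z)).
have := col _ _ _ (set_typeP (g p)) (set_typeP (g q)) (set_typeP (g w)).
rewrite -/a -/b /orient /area /cross => e1 e2.
pose n := (xc b - xc a) ^+ 2 + (yc b - yc a) ^+ 2.
have n0 : n != 0.
  apply: contra_notN ab; rewrite /n paddr_eq0 ?sqr_ge0// !sqrf_eq0 !subr_eq0.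
  by move=> /andP[/eqP e3 /eqP e4]; apply: planeP.
have {}zw : h z - h w = 0 by rewrite zw subrr.
have e21 := f_equal2 (fun k l : R => k - l) e2 e1; rewrite /= subrr in e21.
apply: planeP; apply: (mulfI n0); apply/eqP; rewrite -subr_eq0; apply/eqP.
  transitivity ((xc b - xc a) * (h z - h w) - (yc b - yc a) * 0); last by rewrite zw !mulr0 subrr.
  by rewrite -e21 /h /n; ring.
transitivity ((yc b - yc a) * (h z - h w) + (xc b - xc a) * 0); last by rewrite zw !mulr0 addr0.
by rewrite -e21 /h /n; ring.
Qed.

End Disk.

(** * The triangles of an SL disk *)

Section Triangulation.
Context {R : realType}.
Notation plane := 'rV[R]_2.
Variables (K : set plane) (T : {fset {fset plane}}).
Hypothesis K_disk : SL_disk K T.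
Hypothesis K_convex : convex_set K.
Implicit Types (a b c x y o : plane) (s t u : {fset plane}).

Lemma sum_fsubset (M : nmodType) u s (F : plane -> M) : (u `<=` s)%fset ->
  \sum_(p <- u) F p = \sum_(p <- s) (if p \in u then F p else 0).
Proof.
move=> us; rewrite -(big_fset_incl _ us) => [|p ps pu]; last by rewrite (negbTE pu).
by rewrite !big_seq; apply: eq_bigr => p ->.
Qed.

Lemma affinely_independent_inj s (k l : plane -> R) : affinely_independent s ->
  \sum_(p <- s) k p = \sum_(p <- s) l p ->
  \sum_(p <- s) k p *: p = \sum_(p <- s) l p *: p -> forall p, p \in s -> k p = l p.
Proof.
move=> ind e1 e2 p ps; apply/eqP; rewrite -subr_eq0; apply/eqP.
apply: (ind (fun p => k p - l p)) => //; first by rewrite sumrB e1 subrr.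
under eq_bigr => q _ do rewrite scalerBl.
by rewrite sumrB e2 subrr.
Qed.

Lemma carrier s t (k : plane -> R) x : s \in T -> t \in T ->
  (forall p, p \in s -> 0 <= k p) -> \sum_(p <- s) k p = 1 ->
  x = \sum_(p <- s) k p *: p -> hull t x -> forall p, p \in s -> k p != 0 -> p \in t.
Proof.
move=> sT tT k0 k1 xk tx p ps kp.
have [[ind _ inter] _ _] := K_disk.
have [u [us ut E]] := inter s t sT tT.
have [l [l0 l1 xl]] : hull u x by rewrite -E; split => //; exists k.
have := @affinely_independent_inj s k (fun q => if q \in u then l q else 0) (proj2 (ind s sT)).
rewrite k1 -xk -(sum_fsubset _ us) l1 => /(_ erefl).
have -> : \sum_(q <- s) (if q \in u then l q else 0) *: q = x.
  rewrite xl (sum_fsubset _ us); apply: eq_bigr => q _.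
  by case: ifP; rewrite ?scale0r.
move=> /(_ erefl p ps) kE; move: kp; rewrite kE; case: ifP => [/(fsubsetP ut)//|_].
by rewrite eqxx.
Qed.

Definition is_tri a b c : bool := ([fset a; b; c]%fset \in T) && (0 < orient a b c).

Lemma is_tri_rot a b c : is_tri a b c -> is_tri b c a.
Proof.
rewrite /is_tri /orient (area_rot _ _ a b c) => /andP[abc ->]; rewrite andbT.
by rewrite (_ : [fset b; c; a]%fset = [fset a; b; c]%fset)//; apply/fsetP => p;
  rewrite !inE; case: (p == a); case: (p == b); case: (p == c).
Qed.

Lemma is_tri_sub a b c : is_tri a b c -> tri a b c `<=` K.
Proof.
move=> /andP[abcT D0] x; rewrite -hull_tri// => xs.
by have [_ -> _] := K_disk; exists [fset a; b; c]%fset.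
Qed.

Lemma orient_swap a b c : orient a c b = - orient a b c.
Proof. by rewrite /orient /area /cross; ring. Qed.

Lemma independent_orient a b c s : affinely_independent s -> uniq [:: a; b; c] ->
  ([fset a; b; c] `<=` s)%fset -> orient a b c != 0.
Proof.
move=> ind u sub; apply/eqP => D0.
have ka (k : plane -> R) : k a + k b + k c = 0 -> k a *: a + k b *: b + k c *: c = 0 ->
    k b = 0 /\ k c = 0.
  move=> e1 e2; pose k' p := if p \in [fset a; b; c]%fset then k p else 0.
  have H : forall p, p \in s -> k' p = 0.
    apply: ind; first by rewrite -(sum_fsubset _ sub) sum_fset3.
    rewrite -[RHS]e2 -(sum_fset3 (fun p => k p *: p))// (sum_fsubset _ sub).
    by apply: eq_bigr => p _; rewrite /k'; case: ifP; rewrite ?scale0r.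
  have bs : b \in [fset a; b; c]%fset by rewrite !inE eqxx orbT.
  have cs : c \in [fset a; b; c]%fset by rewrite !inE eqxx orbT.
  by have := H b (fsubsetP sub _ bs); have := H c (fsubsetP sub _ cs); rewrite /k' bs cs.
have dep l m : l * (xc b - xc a) + m * (xc c - xc a) = 0 ->
    l * (yc b - yc a) + m * (yc c - yc a) = 0 -> l = 0 /\ m = 0.
  move=> e1 e2; have [Ea Eb Ec] := coef3E (- l - m) l m u.
  have := ka (coef3 a b c (- l - m) l m); rewrite Ea Eb Ec; apply; first by ring.
  by apply: planeP; rewrite !coordE [RHS]mxE; lra.
have [c1 c2] : xc c - xc a = 0 /\ - (xc b - xc a) = 0.
  by apply: dep; [ring|move: D0; rewrite /orient /area /cross; lra].
have [c3 c4] : yc c - yc a = 0 /\ - (yc b - yc a) = 0.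
  by apply: dep; [move: D0; rewrite /orient /area /cross; lra|ring].
have ac : a = c by apply: planeP; lra.
by move: u; rewrite ac /= !inE eqxx orbT.
Qed.

Lemma uniq_tri a b c s : s \in T -> uniq [:: a; b; c] -> ([fset a; b; c] `<=` s)%fset ->
  (is_tri a b c \/ is_tri a c b).
Proof.
move=> sT u sub; have [[ind face _] _ _] := K_disk.
have abcT : [fset a; b; c]%fset \in T.
  by apply: (face s) => //; apply/fset0Pn; exists a; rewrite !inE eqxx.
have := independent_orient (proj2 (ind s sT)) u sub; rewrite neq_lt => /orP[D|D].
  right; rewrite /is_tri orient_swap oppr_gt0 D andbT.
  rewrite (_ : [fset a; c; b]%fset = [fset a; b; c]%fset)//; apply/fsetP => p.
  by rewrite !inE; case: (p == a); case: (p == b); case: (p == c).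
by left; rewrite /is_tri abcT.
Qed.

Lemma simplex_cases s : s \in T ->
  (exists l : R * R * R, ((l.1.1 != 0) || (l.1.2 != 0)) /\
     forall x, hull s x -> on_line l x = 0) \/
  exists a b c, s = [fset a; b; c]%fset /\ is_tri a b c.
Proof.
move=> sT; have [[ind face _] _ _] := K_disk; have [s0 sind] := ind s sT.
have := fset_uniq s; have : forall p, (p \in s) = (p \in (s : seq _)) by [].
have : forall (k : plane -> R), \sum_(p <- s) k p = \sum_(p <- (s : seq _)) k p by [].
case E : (enum_fset s) => [|a [|b [|c r]]] _ mems u.
- by case/fset0Pn: s0 => p; rewrite mems.
- left; exists (1, 0, - xc a); split; first by rewrite /= oner_eq0.
  move=> x [k [_]]; rewrite E !big_cons !big_nil !addr0 => ka ->.
  by rewrite ka /on_line /= !coordE; ring.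
- left; exists (- (yc b - yc a), xc b - xc a, (yc b - yc a) * xc a - (xc b - xc a) * yc a).
  split.
    apply: contraLR u => /=; rewrite negb_or !negbK oppr_eq0 !subr_eq0.
    by move=> /andP[/eqP e1 /eqP e2]; rewrite (@planeP _ a b) // inE eqxx.
  move=> x [k [_]]; rewrite E !big_cons !big_nil !addr0 => kab ->.
  have -> : k a = 1 - k b by lra.
  by rewrite /on_line /= !coordE; ring.
- right.
  have u3 : uniq [:: a; b; c].
    by move: u; rewrite /= !inE !negb_or => /and4P[/and3P[-> -> _] /andP[-> _] _ _].
  have sub : ([fset a; b; c] `<=` s)%fset.
    by apply/fsubsetP => p; rewrite mems !inE => /orP[/orP[]|] ->; rewrite ?orbT.
  suff -> : s = [fset a; b; c]%fset.
    have [abc|acb] := uniq_tri sT u3 sub; [exists a, b, c|exists a, c, b]; split => //.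
    by apply/fsetP => p; rewrite !inE; case: (p == a); case: (p == b); case: (p == c).
  apply/eqP; rewrite eqEfsubset sub andbT; apply/fsubsetP => d ds.
  apply: contraT => dabc; have D0 := independent_orient sind u3 sub.
  pose k p := coef3 a b c (orient b c d / orient a b c) (orient c a d / orient a b c)
    (orient a b d / orient a b c) p.
  have [ka kb kc] := coef3E (orient b c d / orient a b c) (orient c a d / orient a b c)
    (orient a b d / orient a b c) u3.
  have subd : (d |` [fset a; b; c] `<=` s)%fset by rewrite fsubUset fsub1set ds.
  (* A fourth vertex [d] is an affine combination of [a], [b], [c]; its barycentric coordinates,
     with [-1] at [d], form a relation contradicting independence. *)
  pose k' p := if p \in (d |` [fset a; b; c])%fset then
    (if p == d then -1 else k p) else 0.
  have nd p : p \in [fset a; b; c]%fset -> (p == d) = false.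
    by move=> pabc; apply: contraNF dabc => /eqP <-.
  have /eqP : k' d = 0.
    apply: sind => //.
      rewrite -(sum_fsubset (fun p => if p == d then -1 else k p) subd).
      rewrite big_fsetU1//= eqxx (eq_big_seq k) => [|p /nd ->//].
      by rewrite sum_fset3// /k ka kb kc -!mulrDl -orientE divff// addNr.
    transitivity (\sum_(p <- (d |` [fset a; b; c])%fset) (if p == d then -1 else k p) *: p).
      rewrite (sum_fsubset _ subd); apply: eq_bigr => p _; rewrite /k'.
      by case: ifP; rewrite ?scale0r.
    rewrite big_fsetU1//= eqxx (eq_big_seq (fun p => k p *: p)) => [|p /nd ->//].
    by rewrite sum_fset3// /k ka kb kc -baryE// scaleN1r addNr.
  by rewrite /k' !inE eqxx /= oppr_eq0 oner_eq0.
Qed.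

Definition vset : {fset plane} := (\bigcup_(s <- T) s)%fset.
Let V : finType := vset.

Lemma vsetP p s : s \in T -> p \in s -> p \in vset.
Proof. by move=> sT ps; apply/bigfcupP; exists s; rewrite ?sT. Qed.

Lemma vset1 p : (p \in vset) = ([fset p]%fset \in T).
Proof.
apply/idP/idP => [/bigfcupP[s /andP[sT _] ps]|pT]; last first.
  by apply: (vsetP pT); rewrite inE.
have [[_ face _] _ _] := K_disk; apply: (face s) => //; first by rewrite fsub1set.
by apply/fset0Pn; exists p; rewrite inE.
Qed.

Definition tris (a b c : V) : bool := is_tri (\val a) (\val b) (\val c).

Lemma is_tri_lift a b c : is_tri a b c -> exists a' b' c' : V,
  [/\ \val a' = a, \val b' = b & \val c' = c].
Proof.
move=> /andP[abc _].
have [ha hb hc] : [/\ a \in vset, b \in vset & c \in vset].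
  by split; apply: vsetP abc _; rewrite !inE eqxx ?orbT.
by exists [` ha]%fset, [` hb]%fset, [` hc]%fset.
Qed.

(** The triangles missing [x] are closed and finite in number, so a neighbourhood of [x] avoids them
    all. *)
Lemma near_tri x : \forall y \near x, forall a b c, is_tri a b c -> tri a b c y -> tri a b c x.
Proof.
pose Q (t : V * V * V) y := tris t.1.1 t.1.2 t.2 ->
  tri (\val t.1.1) (\val t.1.2) (\val t.2) y -> tri (\val t.1.1) (\val t.1.2) (\val t.2) x.
have : \forall y \near x, forall r : V * V * V, Q r y.
  apply: (@filter_forall _ _ Q _ (nbhs_filter x)) => -[[a b] c]; rewrite /Q /=.
  have [xt|xt] := pselect (tri (\val a) (\val b) (\val c) x); first by apply: nearW.
  have : nbhs x (~` tri (\val a) (\val b) (\val c)).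
    by apply: open_nbhs_nbhs; split => //; apply: closed_openC; exact: tri_closed.
  by apply: filterS => y /= yt _ /yt.
apply: filterS => y H a b c abc; have [a' [b' [c' [ea eb ec]]]] := is_tri_lift abc.
by rewrite -ea -eb -ec; apply: (H (a', b', c')); rewrite /tris /= ea eb ec.
Qed.

Lemma interior_point : exists o, K° o.
Proof.
have [a [b [c [Ka Kb Kc D0]]]] := noncollinear K_disk.
pose o := 3^-1 *: (a + b + c).
have oabc : otri a b c o by exact: centroid_otri.
exists o; suff : nbhs o K by [].
have : nbhs o (otri a b c) by apply: open_nbhs_nbhs; split => //; exact: otri_open.
by apply: filterS => y /otri_tri; exact: tri_sub.
Qed.

Lemma near_interior x (U : set plane) : K x -> nbhs x U -> exists2 y, K° y & U y.
Proof.
move=> Kx; rewrite nbhsE => -[W [oW Wx] WU].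
have [o Ko] := interior_point.
have [e e0 He] := open_ray (o - x) oW Wx.
pose t := Num.min 1 (e / 2).
have t0 : 0 < t by rewrite lt_min ltr01 divr_gt0.
exists (t *: o + (1 - t) *: x).
  by apply: segment_interior => //; rewrite ge_min lexx.
apply: WU; have -> : t *: o + (1 - t) *: x = x + t *: (o - x).
  by apply: planeP; rewrite !coordE; ring.
apply: He; rewrite gtr0_norm// (@le_lt_trans _ _ (e / 2)) ?ge_min ?lexx ?orbT//.
by lra.
Qed.

(* A point outside all triangles would have, in [K], a neighbourhood covered by
   the finitely many lines carrying the vertices and edges. *)
Lemma triangles_cover x : K x -> exists a b c, is_tri a b c /\ tri a b c x.
Proof.
move=> Kx; apply: contrapT => no.
have N := near_tri x.
have [y0 Ky0 y0N] := near_interior Kx (nbhs_interior N).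
have /choice[line lineP] (s : {fset plane}) : exists l : R * R * R,
    ((l.1.1 != 0) || (l.1.2 != 0)) /\ (s \in T -> (forall x, hull s x -> on_line l x = 0) \/
    exists a b c, s = [fset a; b; c]%fset /\ is_tri a b c).
  have [sT|sT] := boolP (s \in T); last by exists (1, 0, 0); rewrite oner_eq0.
  have [[l [l0 lP]]|tri] := simplex_cases sT; first by exists l; split => // _; left.
  by exists (1, 0, 0); rewrite oner_eq0; split => // _; right.
pose U := [set y | forall a b c, is_tri a b c -> tri a b c y -> tri a b c x]° `&` K°.
have [|||y [/interior_subset/= Uy /interior_subset Ky] off] :=
  @avoid_lines R [seq line s | s <- enum_fset T] U _ _ _.
- by move=> l /mapP[s _ ->]; case: (lineP s).
- by apply: openI; exact: open_interior.
- by exists y0.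
have [_ KE _] := K_disk; move: (Ky); rewrite KE => -[s sT sy].
have [_ /(_ sT)[onl|[a [b [c [sE abc]]]]]] := lineP s.
  by have := off _ (map_f line sT); rewrite onl// eqxx.
apply: no; exists a, b, c; split => //; apply: Uy => //.
by rewrite -hull_tri -?sE//; case/andP: abc.
Qed.

Lemma K_closed : closed K.
Proof.
rewrite -openC openE => x /= Kx; have := near_tri x; apply: filterS => y H /= Ky.
have [a [b [c [abc yt]]]] := triangles_cover Ky.
by apply: Kx; apply: (is_tri_sub abc); exact: H.
Qed.

Lemma boundaryE x : boundary K x <-> K x /\ ~ K° x.
Proof. by rewrite /boundary -(proj1 (closure_id K))//; exact: K_closed. Qed.

Lemma tri_carrier a b c t x : is_tri a b c -> t \in T -> tri a b c x -> hull t x ->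
  [/\ orient b c x != 0 -> a \in t, orient c a x != 0 -> b \in t
    & orient a b x != 0 -> c \in t].
Proof.
move=> /andP[abcT D0] tT [e f g] tx.
have Dn0 : orient a b c != 0 by rewrite gt_eqF.
have u := orient_uniq Dn0.
pose k := coef3 a b c (orient b c x / orient a b c) (orient c a x / orient a b c)
  (orient a b x / orient a b c).
have [ka kb kc] := coef3E (orient b c x / orient a b c) (orient c a x / orient a b c)
  (orient a b x / orient a b c) u.
rewrite -/k in ka kb kc; have H := @carrier _ t k x abcT tT.
have {}H p : p \in [fset a; b; c]%fset -> k p != 0 -> p \in t.
  apply: H => //.
  - by move=> q _; rewrite /k /coef3; case: ifP => _; [|case: ifP => _]; rewrite divr_ge0// ltW.
  - by rewrite sum_fset3// ka kb kc -!mulrDl -orientE divff.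
  - by rewrite sum_fset3// ka kb kc -baryE.
have d (z : R) : z != 0 -> z / orient a b c != 0 by move=> ?; rewrite mulf_neq0// invr_eq0.
by split=> z0; apply: H; rewrite ?ka ?kb ?kc ?d// !inE eqxx ?orbT.
Qed.

(** Three distinct vertices among three form a permutation, and positive orientation leaves only the
    rotations. *)
Lemma is_tri_eq a b c a' b' c' : is_tri a b c -> is_tri a' b' c' ->
  a \in [fset a'; b'; c']%fset -> b \in [fset a'; b'; c']%fset ->
  c \in [fset a'; b'; c']%fset ->
  [\/ [/\ a = a', b = b' & c = c'], [/\ a = b', b = c' & c = a'] |
      [/\ a = c', b = a' & c = b']].
Proof.
move=> /andP[_ D] /andP[_ D'].
have /= := orient_uniq (lt0r_neq0 D).
rewrite !inE negb_or andbT => /andP[/andP[/eqP ab /eqP ac] /eqP bc].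
move=> /orP[/orP[]|] /eqP ea /orP[/orP[]|] /eqP eb /orP[/orP[]|] /eqP ec;
  subst; try congruence; try (by constructor).
all: by move: D D'; rewrite /orient /area /cross; lra.
Qed.

(** All barycentric coordinates of a point of the open triangle are nonzero, so by [carrier] every
    corner belongs to the other triangle. *)
Lemma otri_inj a b c a' b' c' x : is_tri a b c -> is_tri a' b' c' ->
  otri a b c x -> tri a' b' c' x ->
  [\/ [/\ a = a', b = b' & c = c'], [/\ a = b', b = c' & c = a'] |
      [/\ a = c', b = a' & c = b']].
Proof.
move=> abc abc' ox tx; have [e f g] := ox.
have /andP[tT D'] := abc'.
have [|ha hb hc] := tri_carrier abc tT (otri_tri ox) _; first by rewrite hull_tri.
by apply: is_tri_eq => //; [apply: ha|apply: hb|apply: hc]; rewrite gt_eqF.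
Qed.

End Triangulation.

(** * The complex of an SL disk *)

Section DiskComplexOfTriangulation.
Context {R : realType}.
Notation plane := 'rV[R]_2.
Variables (K : set plane) (T : {fset {fset plane}}).
Hypothesis K_disk : SL_disk K T.
Hypothesis K_convex : convex_set K.
Implicit Types (a b c x y o p q : plane).

Let V : finType := vset T.
Let O : V -> V -> V -> bool := @tris R T.

(** As [K] is closed and contains its vertices, failing to be interior is lying on the frontier. *)
Definition bdry_vertex (v : vset T) : bool := `[< ~ K° (\val v) >].
Definition vx (v : vset T) : R := xc (\val v).
Definition vy (v : vset T) : R := yc (\val v).

Lemma vertex_in (v : V) : K (\val v).
Proof.
have [_ -> _] := K_disk; exists [fset \val v]%fset.
  by rewrite -(vset1 K_disk); exact: (valP v).
exists (fun=> 1); split => [//||]; first by rewrite big_seq_fset1.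
by rewrite big_seq_fset1 scale1r.
Qed.

Lemma vertex_carrier (v : V) t : t \in T -> hull t (\val v) -> \val v \in t.
Proof.
move=> tT vt; apply: (carrier K_disk (s := [fset \val v]%fset) (k := fun=> 1)
  (x := \val v)) => //; rewrite ?oner_neq0//.
- by rewrite -(vset1 K_disk); exact: (valP v).
- by rewrite big_seq_fset1.
- by rewrite big_seq_fset1 scale1r.
- by rewrite inE.
Qed.

(** A point just across the edge from [m] is still in [K], and the triangle covering it contains [m]
    by [near_tri]. As [m] is inside the edge, [a] and [b] are corners of that triangle, and the side
    on which the new point lies decides their order. *)
Lemma tris_opposite (a b c : V) (t : R) : O a b c -> 0 < t -> t < 1 ->
  K° (t *: \val a + (1 - t) *: \val b) -> exists d, O b a d.
Proof.
move=> abc t0 t1; set m := _ + _ => Km.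
have abc' : is_tri T (\val a) (\val b) (\val c) by exact: abc.
have /andP[abcT D0] := abc'.
have N : nbhs m (K `&` [set y | forall a b c, is_tri T a b c -> tri a b c y -> tri a b c m]).
  by apply: filterI; [exact: Km|exact: near_tri].
have [e e0 He] := open_ray (\val a - \val c) (@open_interior _ _) (N : (_)° m).
pose y := m + (e / 2) *: (\val a - \val c).
have [Ky Hy] : (K `&` [set y | forall a b c, is_tri T a b c -> tri a b c y -> tri a b c m]) y.
  by apply: interior_subset; apply: He; rewrite gtr0_norm ?divr_gt0//; lra.
have [a' [b' [c' [abc1 ty]]]] := triangles_cover K_disk K_convex Ky.
have tm := Hy _ _ _ abc1 ty.
have /andP[tT D'] := abc1.
have ymab : orient (\val a) (\val b) y < 0.
  rewrite (_ : orient _ _ _ = - (e / 2) * orient (\val a) (\val b) (\val c)).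
    by rewrite nmulr_rlt0// oppr_lt0 divr_gt0.
  by rewrite /y /m /orient /area /cross !coordE; ring.
have E1 : orient (\val b) (\val c) m = t * orient (\val a) (\val b) (\val c).
  by rewrite /m /orient /area /cross !coordE; ring.
have E2 : orient (\val c) (\val a) m = (1 - t) * orient (\val a) (\val b) (\val c).
  by rewrite /m /orient /area /cross !coordE; ring.
have E3 : orient (\val a) (\val b) m = 0.
  by rewrite /m /orient /area /cross !coordE; ring.
have tabc : tri (\val a) (\val b) (\val c) m.
  split; rewrite ?E1 ?E2 ?E3//; first by rewrite mulr_ge0// ltW.
  by apply: mulr_ge0; [rewrite subr_ge0 ltW|exact: ltW].
have [|ha hb _] := tri_carrier K_disk abc' tT tabc _; first by rewrite hull_tri.
have {}ha : \val a \in [fset a'; b'; c']%fset.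
  by apply: ha; rewrite E1 mulf_neq0// gt_eqF.
have {}hb : \val b \in [fset a'; b'; c']%fset.
  by apply: hb; rewrite E2 mulf_neq0// gt_eqF// subr_gt0.
have ab : \val a <> \val b.
  by move=> ab; move: D0; rewrite ab /orient /area /cross !subrr !mul0r mulr0 subrr ltxx.
have lift a2 b2 c2 : is_tri T a2 b2 c2 -> \val b = a2 -> \val a = b2 -> exists d, O b a d.
  move=> abc2 ea eb; have [a3 [b3 [c3 [e1 e2 e3]]]] := is_tri_lift abc2.
  exists c3; have -> : b = a3 by apply: val_inj; rewrite ea e1.
  have -> : a = b3 by apply: val_inj; rewrite eb e2.
  by rewrite /O /tris e1 e2 e3.
have [ty1 ty2 ty3] := ty; have bca := is_tri_rot abc1; have cab := is_tri_rot bca.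
move: ha hb; rewrite !inE => /orP[/orP[]|] /eqP ea /orP[/orP[]|] /eqP eb.
- by case: ab; rewrite ea eb.
- by move: ymab; rewrite ea eb ltNge ty3.
- exact: lift cab eb ea.
- exact: lift abc1 eb ea.
- by case: ab; rewrite ea eb.
- by move: ymab; rewrite ea eb ltNge ty1.
- by move: ymab; rewrite ea eb ltNge ty2.
- exact: lift bca eb ea.
- by case: ab; rewrite ea eb.
Qed.

(** The triangles with corners in [A] and those with corners outside would form two disjoint closed
    sets covering [K], and would disconnect the segment from [v0] to [w], which convexity places in
    [K]. *)
Lemma tris_conn (A : pred V) : (exists v, A v) ->
  (forall v u, A v -> nbr O v u -> A u) -> forall v, A v.
Proof.
move=> [v0 Av0] cl w; apply: contraT => Aw.
pose S (P : pred V) := [set x | exists a b c : V,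
  [/\ O a b c, P a & tri (\val a) (\val b) (\val c) x]].
have Sclosed P : closed (S P).
  rewrite -openC openE => x /= Sx; have := near_tri T x.
  apply: filterS => y Hy /= [a [b [c [abc Pa ty]]]].
  by apply: Sx; exists a, b, c; split => //; exact: Hy.
have star (P : pred V) v : P v -> S P (\val v).
  move=> Pv; have [a [b [c [abc tv]]]] := triangles_cover K_disk K_convex (vertex_in v).
  have [a' [b' [c' [ea eb ec]]]] := is_tri_lift abc; subst a b c.
  have [zT D0] := andP abc.
  have := vertex_carrier zT; rewrite hull_tri// => /(_ v tv).
  have [t1 t2 t3] := tv.
  rewrite !inE => /orP[/orP[]|] /eqP/val_inj ev; subst v.
  - by exists a', b', c'.
  - by exists b', c', a'; split => //; rewrite /O /tris; exact: is_tri_rot.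
  - by exists c', a', b'; split => //; rewrite /O /tris; exact/is_tri_rot/is_tri_rot.
have disj x : S A x -> S (predC A) x -> False.
  move=> [a [b [c [abc Aa tx]]]] [a' [b' [c' [abc' Aa' tx']]]].
  have [zT D'] := andP (abc' : is_tri T (\val a') (\val b') (\val c')).
  have [_ D] := andP (abc : is_tri T (\val a) (\val b) (\val c)).
  have Ab : A b by apply: cl Aa _; apply/existsP; exists c.
  have bca : O b c a := is_tri_rot abc.
  have Ac : A c by apply: cl Ab _; apply/existsP; exists a.
  have noA v : \val v \in [fset \val a'; \val b'; \val c']%fset -> ~~ A v.
    have bca' : O b' c' a' := is_tri_rot abc'.
    have cab' : O c' a' b' := is_tri_rot bca'.
    have Ab' : ~~ A b'.
      apply: contra Aa' => Ab'; apply: (cl c'); last by apply/existsP; exists b'.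
      by apply: (cl b') => //; apply/existsP; exists a'.
    have Ac' : ~~ A c'.
      by apply: contra Aa' => Ac'; apply: (cl c') => //; apply/existsP; exists b'.
    by rewrite !inE => /orP[/orP[]|] /eqP/val_inj ->.
  have [|ha hb hc] := tri_carrier K_disk abc zT tx _; first by rewrite hull_tri.
  have := orientE (\val a) (\val b) (\val c) x.
  have [/eqP e1|/ha/noA] := boolP (orient (\val b) (\val c) x == 0); last by rewrite Aa.
  have [/eqP e2|/hb/noA] := boolP (orient (\val c) (\val a) x == 0); last by rewrite Ab.
  have [/eqP e3|/hc/noA] := boolP (orient (\val a) (\val b) x == 0); last by rewrite Ac.
  by rewrite e1 e2 e3 !addr0 => D1; rewrite D1 ltxx in D.
have cover x : K x -> S A x \/ S (predC A) x.
  move=> Kx; have [a [b [c [abc tx]]]] := triangles_cover K_disk K_convex Kx.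
  have [a' [b' [c' [ea eb ec]]]] := is_tri_lift abc; subst a b c.
  by case: (boolP (A a')) => Aa; [left|right]; exists a', b', c'.
pose f (t : R) : plane := t *: \val v0 + (1 - t) *: \val w.
have cf : continuous f.
  apply: cont_plane.
    rewrite (_ : (fun t => _) = fun t => t * xc (\val v0) + (1 - t) * xc (\val w)).
      by apply: contD; apply: contM; try exact: cont_cst; try (by move=> ?; exact: cvg_id);
        apply: contB; [exact: cont_cst|move=> ?; exact: cvg_id].
    by apply/funext => t; rewrite !coordE.
  rewrite (_ : (fun t => _) = fun t => t * yc (\val v0) + (1 - t) * yc (\val w)).
    by apply: contD; apply: contM; try exact: cont_cst; try (by move=> ?; exact: cvg_id);
      apply: contB; [exact: cont_cst|move=> ?; exact: cvg_id].
  by apply/funext => t; rewrite !coordE.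
have Kf t : t \in `[0, 1] -> K (f t).
  by rewrite in_itv /= => /andP[t0 t1]; apply: conv2 => //; exact: vertex_in.
have /continuous_closedP cfc := cf.
have E : `[(0:R), 1]%classic `&` f @^-1` S A = `[0, 1]%classic.
  apply: (@segment_connected R 0 1).
  - exists 1; split; first by rewrite /= in_itv /= ler01 lexx.
    by rewrite /= /f scale1r subrr scale0r addr0; exact: star.
  - exists (~` (f @^-1` S (predC A))); first by apply: closed_openC; exact: cfc.
    apply/seteqP; split=> t /= [t01 H]; split => //; first by move=> /(disj _ H).
    by have [|/H] := cover _ (Kf _ t01).
  - by exists (f @^-1` S A) => //; exact: cfc.
have : (`[(0:R), 1]%classic `&` f @^-1` S A) 0 by rewrite E /= in_itv /= lexx ler01.
move=> [_]; rewrite /= /f scale0r subr0 scale1r add0r => Sw.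
by have := disj _ Sw (star (predC A) w Aw).
Qed.

(** For small [t > 0] the point at [v + t q] is inside both triangles, which then agree by
    [otri_inj]. *)
Lemma tris_cone (v a b c d : V) : O v a b -> O v c d -> forall qx qy,
  0 < cross (vx a - vx v) (vy a - vy v) qx qy ->
  0 < cross qx qy (vx b - vx v) (vy b - vy v) ->
  0 < cross (vx c - vx v) (vy c - vy v) qx qy ->
  0 < cross qx qy (vx d - vx v) (vy d - vy v) -> a = c /\ b = d.
Proof.
move=> vab vcd qx qy aq qb cq qd.
have /andP[_ D1] : is_tri T (\val v) (\val a) (\val b) by exact: vab.
have /andP[_ D2] : is_tri T (\val v) (\val c) (\val d) by exact: vcd.
have [e1 e10 H1] := exists_small (cross (vx b - vx a) (vy b - vy a) qx qy) D1.
have [e2 e20 H2] := exists_small (cross (vx d - vx c) (vy d - vy c) qx qy) D2.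
pose t := Num.min e1 e2; have t0 : 0 < t by rewrite lt_min e10.
have {}H1 := H1 t t0; have {}H2 := H2 t t0.
rewrite ge_min lexx /= in H1; rewrite ge_min lexx orbT in H2.
pose y := \val v + t *: pt qx qy.
have o1 : otri (\val v) (\val a) (\val b) y.
  split.
  - by have := H1 isT; congr (0 < _); rewrite /y /orient /area /cross !coordE /vx /vy; ring.
  - have -> : orient (\val b) (\val v) y = t * cross qx qy (vx b - vx v) (vy b - vy v).
      by rewrite /y /orient /area /cross !coordE /vx /vy; ring.
    by rewrite mulr_gt0.
  - have -> : orient (\val v) (\val a) y = t * cross (vx a - vx v) (vy a - vy v) qx qy.
      by rewrite /y /orient /area /cross !coordE /vx /vy; ring.
    by rewrite mulr_gt0.
have o2 : otri (\val v) (\val c) (\val d) y.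
  split.
  - by have := H2 isT; congr (0 < _); rewrite /y /orient /area /cross !coordE /vx /vy; ring.
  - have -> : orient (\val d) (\val v) y = t * cross qx qy (vx d - vx v) (vy d - vy v).
      by rewrite /y /orient /area /cross !coordE /vx /vy; ring.
    by rewrite mulr_gt0.
  - have -> : orient (\val v) (\val c) y = t * cross (vx c - vx v) (vy c - vy v) qx qy.
      by rewrite /y /orient /area /cross !coordE /vx /vy; ring.
    by rewrite mulr_gt0.
have [[_ /val_inj -> /val_inj -> //]|[vc _ _]|[vd _ _]] :=
  otri_inj K_disk vab vcd o1 (otri_tri o2).
- by move: D2; rewrite vc /orient /area /cross !subrr !mul0r mulr0 subrr ltxx.
- by move: D2; rewrite vd /orient /area /cross !subrr !mul0r mulr0 subrr ltxx.
Qed.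

(* If [K] meets both sides of the line and both of its rays at [v], then the ray
   from an interior point through [v] can be prolonged in [K]. *)
Lemma tris_convex (al be : R) (v a b c d : V) : bdry_vertex v -> O v a b -> O v c d ->
  let psi u := al * vx u + be * vy u in
  psi v < psi a -> psi b <= psi v -> psi c <= psi v -> psi v < psi d ->
  forall u, psi v <= psi u.
Proof.
move=> /asboolP Bv vab vcd psi va vb vc vd u; rewrite leNgt; apply/negP => uv; apply: Bv.
have /andP[_ D1] : is_tri T (\val v) (\val a) (\val b) by exact: vab.
have /andP[_ D2] : is_tri T (\val v) (\val c) (\val d) by exact: vcd.
pose nn := al ^+ 2 + be ^+ 2.
have nn0 : 0 < nn.
  rewrite lt0r addr_ge0 ?sqr_ge0// andbT; apply/eqP => /eqP.
  rewrite paddr_eq0 ?sqr_ge0// !sqrf_eq0 => /andP[/eqP e1 /eqP e2].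
  by move: va; rewrite /psi e1 e2 !mul0r ltxx.
(* [n] directs the level line of [psi] through [v]. An edge going from above that line to it or
   below meets it at [v] plus a multiple of [n], whose sign is that of the area spanned with [v]. *)
pose n := pt (- be) al.
have ray (w z : V) : psi v < psi w -> psi z <= psi v ->
    K (\val v + (area vx vy v w z / (psi w - psi z)) *: n).
  move=> vw zv; set W := psi w - psi z.
  have W0 : 0 < W by rewrite subr_gt0 (le_lt_trans zv).
  set l := _ / W; set t := (psi w - psi v) / W.
  have lW : W * l = area vx vy v w z by rewrite mulrC divfK// gt_eqF.
  have tW : W * t = psi w - psi v by rewrite mulrC divfK// gt_eqF.
  have -> : \val v + l *: n = t *: \val z + (1 - t) *: \val w.
    apply: planeP; rewrite !coordE; apply: (mulfI (lt0r_neq0 W0)).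
      transitivity (W * vx v - be * (W * l)); first by rewrite /vx; ring.
      transitivity ((W * t) * vx z + (W - W * t) * vx w); last by rewrite /vx; ring.
      by rewrite lW tW /W /psi /area /cross; ring.
    transitivity (W * vy v + al * (W * l)); first by rewrite /vy; ring.
    transitivity ((W * t) * vy z + (W - W * t) * vy w); last by rewrite /vy; ring.
    by rewrite lW tW /W /psi /area /cross; ring.
  apply: conv2 => //; [exact: vertex_in|exact: vertex_in| |].
    by apply: divr_ge0; [rewrite subr_ge0 ltW|exact: ltW].
  by rewrite /t ler_pdivrMr// mul1r lerB.
have [l1 l10 K1] : exists2 l, 0 < l & K (\val v + l *: n).
  exists (area vx vy v a b / (psi a - psi b)); last exact: ray.
  by rewrite divr_gt0// subr_gt0 (le_lt_trans vb).
have [l2 l20 K2] : exists2 l, 0 < l & K (\val v - l *: n).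
  exists (area vx vy v c d / (psi d - psi c)).
    by rewrite divr_gt0// subr_gt0 (le_lt_trans vc).
  have := ray d c vd vc; have -> : area vx vy v d c = - area vx vy v c d.
    by rewrite /area /cross; ring.
  by rewrite mulNr scaleNr.
have [o Ko] := interior_point K_disk K_convex.
pose e := \val v - o.
suff [s s0 Ks] : exists2 s, 0 < s & K (\val v + s *: e).
  have -> : \val v = (s / (1 + s)) *: o + (1 - s / (1 + s)) *: (\val v + s *: e).
    by apply: planeP; rewrite !coordE; field; rewrite gt_eqF// addr_gt0.
  have s1 : 0 < 1 + s by rewrite addr_gt0.
  apply: segment_interior => //; first by rewrite divr_gt0.
  by rewrite ler_pdivrMr// mul1r lerDr.
pose psi' (p : plane) := al * xc p + be * yc p.
(* [e] is split into a nonnegative multiple of a vector from [v] to a point [k] of [K], chosen by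
   the sign of [psi' e], and a multiple of [n], which the points of [K] on the level line absorb. *)
have [k [bt [Kk bt0 kE]]] : exists k bt, [/\ K k, 0 <= bt & psi' e = bt * (psi' (k - \val v))].
  have psiD (w : V) : psi' (\val w - \val v) = psi w - psi v.
    by rewrite /psi' /psi !coordE /vx /vy; ring.
  have [e0|e0] := lerP 0 (psi' e).
    exists (\val a), (psi' e / (psi a - psi v)); split; first exact: vertex_in.
      by rewrite divr_ge0// subr_ge0 ltW.
    by rewrite psiD divfK// gt_eqF// subr_gt0.
  exists (\val u), (psi' e / (psi u - psi v)); split; first exact: vertex_in.
    by apply: mulr_le0; [exact: ltW|rewrite invr_le0 subr_le0 ltW].
  by rewrite psiD divfK// lt_eqF// subr_lt0.
pose f := e - bt *: (k - \val v).
have par (w : plane) : psi' w = 0 -> w = ((al * yc w - be * xc w) / nn) *: n.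
  move=> w0; apply: planeP; apply: (mulfI (lt0r_neq0 nn0)); rewrite !coordE mulrA.
    rewrite [nn * (_ / _)]mulrC divfK ?gt_eqF//.
    transitivity (- be * (al * yc w - be * xc w) + al * psi' w); first by rewrite /nn /psi'; ring.
    by rewrite w0 mulr0 addr0 mulrC.
  rewrite [nn * (_ / _)]mulrC divfK ?gt_eqF//.
  transitivity (al * (al * yc w - be * xc w) + be * psi' w); first by rewrite /nn /psi'; ring.
  by rewrite w0 mulr0 addr0 mulrC.
have f0 : psi' f = 0 by move: kE; rewrite /f /psi' !coordE; lra.
have fE := par f f0; move: fE; set ga := _ / nn => fE.
have eE : e = ga *: n + bt *: (k - \val v) by rewrite -fE /f subrK.
have [r [l [Kr l0 rE]]] : exists (r : plane) (l : R), [/\ K r, 0 <= l & ga *: n = l *: (r - \val v)].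
  have [g0|g0] := lerP 0 ga.
    exists (\val v + l1 *: n), (ga / l1); split => //; first by rewrite divr_ge0// ltW.
    by rewrite [\val v + _]addrC addrK scalerA divfK// gt_eqF.
  exists (\val v - l2 *: n), (- ga / l2); split => //.
    by rewrite divr_ge0 ?oppr_ge0// ltW.
  by rewrite [\val v - _]addrC addrK scalerN scalerA divfK ?gt_eqF// scaleNr opprK.
(* With this scale the prolonged point is a convex combination of [v], [r] and [k]. *)
exists (1 + l + bt)^-1; first by rewrite invr_gt0 -addrA ltr_pwDl// addr_ge0.
have S0 : 0 < 1 + l + bt by rewrite -addrA ltr_pwDl// addr_ge0.
rewrite eE rE.
have -> : \val v + (1 + l + bt)^-1 *: (l *: (r - \val v) + bt *: (k - \val v)) =
    (1 / (1 + l + bt)) *: \val v + (l / (1 + l + bt)) *: r + (bt / (1 + l + bt)) *: k.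
  by apply: planeP; rewrite !coordE; field; rewrite gt_eqF.
apply: conv3 => //; first exact: vertex_in.
- by rewrite divr_ge0// ltW.
- by rewrite divr_ge0// ltW.
- by rewrite divr_ge0// ltW.
- by rewrite -!mulrDl divff// gt_eqF.
Qed.

Lemma tris_disk_complex : disk_complex O bdry_vertex vx vy.
Proof.
split.
- by move=> a b c; exact: is_tri_rot.
- by move=> a b c /andP[].
- exact: tris_cone.
- move=> a b c abc; rewrite negb_and => ab.
  have half0 : (0 : R) < 2^-1 by rewrite invr_gt0.
  have half1 : (2^-1 : R) < 1 by rewrite invf_lt1// ltr1n.
  apply: (tris_opposite abc half0 half1).
  move: ab => /orP[] /asboolPn/contrapT Kab.
    by apply: segment_interior => //; (exact: vertex_in || exact: ltW).
  rewrite addrC; have {2}-> : 2^-1 = 1 - (1 - 2^-1) :> R by ring.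
  by apply: segment_interior => //; rewrite ?subr_gt0//; (exact: vertex_in || lra).
- move=> v; have [a [b [c [abc tv]]]] := triangles_cover K_disk K_convex (vertex_in v).
  have [a' [b' [c' [ea eb ec]]]] := is_tri_lift abc; subst a b c.
  have [zT D0] := andP abc.
  have := vertex_carrier zT; rewrite hull_tri// => /(_ v tv).
  rewrite !inE => /orP[/orP[]|] /eqP/val_inj ev; subst v.
  - by exists b', c'.
  - by exists c', a'; exact: is_tri_rot.
  - by exists a', b'; exact/is_tri_rot/is_tri_rot.
- exact: tris_conn.
- exact: tris_convex.
Qed.

End DiskComplexOfTriangulation.

(** * Piecewise affine maps *)

Section AffineTransport.
Context {R : realType} {V : finType}.
Notation plane := 'rV[R]_2.
Implicit Types (X Y : V -> R) (q : plane) (a b c : V).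

Definition sd X Y a b q : R := side (xc q) (yc q) X Y a b.

(* The affine map taking the triangle [a b c] placed by [X, Y] to its position
   under [X', Y']. *)
Definition transport X Y X' Y' a b c q : plane :=
  let D := area X Y a b c in
  pt ((sd X Y b c q * X' a + sd X Y c a q * X' b + sd X Y a b q * X' c) / D)
     ((sd X Y b c q * Y' a + sd X Y c a q * Y' b + sd X Y a b q * Y' c) / D).

Lemma sd_sum X Y a b c q : sd X Y b c q + sd X Y c a q + sd X Y a b q = area X Y a b c.
Proof. by rewrite /sd /side /area /cross; ring. Qed.

Lemma sdC X Y a b q : sd X Y b a q = - sd X Y a b q.
Proof. by rewrite /sd /side /cross; ring. Qed.

Lemma transport_rot X Y X' Y' a b c q :
  transport X Y X' Y' b c a q = transport X Y X' Y' a b c q.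
Proof. by rewrite /transport area_rot; congr pt; congr (_ / _); ring. Qed.

(** An affine map multiplies signed areas by its determinant, here the quotient of the two areas. *)
Lemma sd_transport X Y X' Y' a b c q : area X Y a b c != 0 ->
  sd X' Y' a b (transport X Y X' Y' a b c q) * area X Y a b c =
  sd X Y a b q * area X' Y' a b c.
Proof.
move=> D0.
have aux (e f g D : R) : e + f + g = D -> D != 0 ->
    cross (X' b - X' a) (Y' b - Y' a) ((e * X' a + f * X' b + g * X' c) / D - X' a)
      ((e * Y' a + f * Y' b + g * Y' c) / D - Y' a) * D = g * area X' Y' a b c.
  by move=> <- S0; rewrite /area /cross; field.
rewrite {1}/sd /side /transport xc_pt yc_pt; apply: aux => //; exact: sd_sum.
Qed.

Lemma sd_transport_rot X Y X' Y' a b c q : area X Y a b c != 0 ->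
  [/\ sd X' Y' b c (transport X Y X' Y' a b c q) * area X Y a b c =
        sd X Y b c q * area X' Y' a b c,
      sd X' Y' c a (transport X Y X' Y' a b c q) * area X Y a b c =
        sd X Y c a q * area X' Y' a b c
    & sd X' Y' a b (transport X Y X' Y' a b c q) * area X Y a b c =
        sd X Y a b q * area X' Y' a b c].
Proof.
move=> D0.
have e1 : area X Y b c a = area X Y a b c by rewrite area_rot.
have e2 : area X' Y' b c a = area X' Y' a b c by rewrite area_rot.
have e3 : area X Y c a b = area X Y a b c by rewrite -area_rot.
have e4 : area X' Y' c a b = area X' Y' a b c by rewrite -area_rot.
split; last exact: sd_transport.
  by rewrite -e1 -e2 -transport_rot sd_transport// e1.
by rewrite -e3 -e4 transport_rot sd_transport// e3.
Qed.

Lemma transportK X Y X' Y' a b c q : area X Y a b c != 0 -> area X' Y' a b c != 0 ->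
  transport X' Y' X Y a b c (transport X Y X' Y' a b c q) = q.
Proof.
move=> D0 D0'; have [e1 e2 e3] := sd_transport_rot X' Y' q D0.
have key (Z : V -> R) : (sd X' Y' b c (transport X Y X' Y' a b c q) * Z a +
    sd X' Y' c a (transport X Y X' Y' a b c q) * Z b +
    sd X' Y' a b (transport X Y X' Y' a b c q) * Z c) / area X' Y' a b c =
    (sd X Y b c q * Z a + sd X Y c a q * Z b + sd X Y a b q * Z c) / area X Y a b c.
  apply: (mulfI D0); apply: (mulIf D0'); rewrite -mulrA divfK//.
  rewrite [area X Y a b c * (_ / _)]mulrC divfK//.
  transitivity ((sd X' Y' b c (transport X Y X' Y' a b c q) * area X Y a b c) * Z a +
    (sd X' Y' c a (transport X Y X' Y' a b c q) * area X Y a b c) * Z b +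
    (sd X' Y' a b (transport X Y X' Y' a b c q) * area X Y a b c) * Z c); first by ring.
  by rewrite e1 e2 e3; ring.
rewrite {1}/transport !key; apply: planeP; rewrite !coordE; apply: (mulfI D0);
  rewrite mulrC divfK// /sd /side /area /cross; ring.
Qed.

Lemma transport_affine X Y X' Y' a b c :
  exists (M : 'M[R]_2) (v : plane), forall q, transport X Y X' Y' a b c q = q *m M + v.
Proof.
pose D := area X Y a b c.
(* [lx Z], [ly Z] and [l0 Z] are the coefficients of the affine function with values [Z a], [Z b],
   [Z c] at the corners. *)
pose lx (Z : V -> R) := - ((Y c - Y b) * Z a + (Y a - Y c) * Z b + (Y b - Y a) * Z c) / D.
pose ly (Z : V -> R) := ((X c - X b) * Z a + (X a - X c) * Z b + (X b - X a) * Z c) / D.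
pose l0 (Z : V -> R) := ((X b * (Y c - Y b) - (X c - X b) * Y b) * Z a +
  (X c * (Y a - Y c) - (X a - X c) * Y c) * Z b +
  (X a * (Y b - Y a) - (X b - X a) * Y a) * Z c) / D.
pose M : 'M[R]_2 := \matrix_(i, j) if j == 0 then (if i == 0 then lx X' else ly X')
  else (if i == 0 then lx Y' else ly Y').
exists M, (pt (l0 X') (l0 Y')) => q.
have mulE j : (q *m M) 0 j = xc q * M 0 j + yc q * M 1 j.
  by rewrite mxE big_ord_recl big_ord1 /xc /yc; congr (_ + q _ _ * M _ _); exact/val_inj.
apply: planeP; rewrite /transport !coordE.
  by rewrite {1}/xc mulE !mxE /= /lx /ly /l0 -/D /sd /side /cross; ring.
by rewrite {1}/yc mulE !mxE /= /lx /ly /l0 -/D /sd /side /cross; ring.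
Qed.

Lemma sd_cont X Y a b : continuous (sd X Y a b).
Proof.
by rewrite /sd /side /cross; apply: contB; apply: contM; try exact: cont_cst;
  apply: contB; (exact: xc_cont || exact: yc_cont || exact: cont_cst).
Qed.

Lemma transport_cont X Y X' Y' a b c : continuous (transport X Y X' Y' a b c).
Proof.
apply: cont_plane.
  rewrite (_ : (fun t => _) = fun q => (sd X Y b c q * X' a + sd X Y c a q * X' b +
    sd X Y a b q * X' c) / area X Y a b c); last by apply/funext => q; rewrite xc_pt.
  by apply: contM; [repeat apply: contD; apply: contM|]; try exact: cont_cst; exact: sd_cont.
rewrite (_ : (fun t => _) = fun q => (sd X Y b c q * Y' a + sd X Y c a q * Y' b +
    sd X Y a b q * Y' c) / area X Y a b c); last by apply/funext => q; rewrite yc_pt.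
by apply: contM; [repeat apply: contD; apply: contM|]; try exact: cont_cst; exact: sd_cont.
Qed.

End AffineTransport.

(** * Points in general position *)

Section Generic.
Context {R : realType} {V : finType}.
Notation plane := 'rV[R]_2.
Variable O : V -> V -> V -> bool.

(** Verticals through vertices and lines through pairs of vertices. Coinciding vertices span no
    line; the line [x = 0] stands in, so that every entry is a genuine line. *)
Definition generic_lines (X Y : V -> R) : seq (R * R * R) :=
  [seq (1, 0, - X v) | v <- enum V] ++
  [seq let: (a, b) := ab in if (- (Y b - Y a) != 0) || (X b - X a != 0)
     then (- (Y b - Y a), X b - X a, (Y b - Y a) * X a - (X b - X a) * Y a)
     else (1, 0, 0) | ab <- enum {: V * V}].

Lemma generic_lines_neq0 X Y l : l \in generic_lines X Y -> (l.1.1 != 0) || (l.1.2 != 0).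
Proof.
rewrite mem_cat => /orP[/mapP[v _ ->]|/mapP[[a b] _ ->]]; first by rewrite oner_eq0.
by case: ifP => //= _; rewrite oner_eq0.
Qed.

Lemma generic_off_lines X Y q : (forall a b c, O a b c -> area X Y a b c != 0) ->
  (forall l, l \in generic_lines X Y -> on_line l q != 0) ->
  generic O (xc q) (yc q) X Y.
Proof.
move=> nd off; split=> [v|a b c abc].
  have := off (1, 0, - X v); rewrite mem_cat map_f ?mem_enum// => /(_ isT).
  by apply: contraNneq => ->; rewrite /on_line /=; apply/eqP; ring.
have := off (let: (a, b) := (a, b) in if (- (Y b - Y a) != 0) || (X b - X a != 0)
     then (- (Y b - Y a), X b - X a, (Y b - Y a) * X a - (X b - X a) * Y a)
     else (1, 0, 0)).
rewrite mem_cat (map_f _ (_ : (a, b) \in _)) ?mem_enum// orbT => /(_ isT).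
case: ifP => [_|/negbT]; first by congr (_ != 0); rewrite /on_line /side /cross /=; ring.
rewrite negb_or !negbK oppr_eq0 => /andP[/eqP e1 /eqP e2] _.
by have := nd _ _ _ abc; rewrite /area /cross e1 e2 mul0r mulr0 subrr eqxx.
Qed.

Lemma exists_generic (X Y X' Y' : V -> R) (U : set plane) :
  (forall a b c, O a b c -> area X Y a b c != 0) ->
  (forall a b c, O a b c -> area X' Y' a b c != 0) -> open U -> U !=set0 ->
  exists q, [/\ U q, generic O (xc q) (yc q) X Y & generic O (xc q) (yc q) X' Y'].
Proof.
move=> nd nd' oU U0.
have [|q Uq off] := @avoid_lines R (generic_lines X Y ++ generic_lines X' Y') U _ oU U0.
  by move=> l; rewrite mem_cat => /orP[]; exact: generic_lines_neq0.
exists q; split => //; apply: generic_off_lines => // l lX; apply: off.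
  by rewrite mem_cat lX.
by rewrite mem_cat lX orbT.
Qed.

Definition covers (X Y : V -> R) (q : plane) (t : V * (V * V)) : bool :=
  [&& O t.1 t.2.1 t.2.2, 0 < sd X Y t.2.1 t.2.2 q, 0 < sd X Y t.2.2 t.1 q
    & 0 < sd X Y t.1 t.2.1 q].

(** The three side values add up to the positive area, so the negative term of [signed_inside] never
    occurs and the degree is a plain count. *)
Lemma sum_inside_covers X Y q : (forall a b c, O a b c -> 0 < area X Y a b c) ->
  \sum_a \sum_(x : V * V | O a x.1 x.2) inside (xc q) (yc q) X Y a x.1 x.2 =
  #|covers X Y q|%:R.
Proof.
move=> pos; rewrite pair_big_dep /= -sum1_card natr_sum [RHS]big_mkcond [LHS]big_mkcond /=.
apply: eq_bigr => -[a [b c]] _; rewrite unfold_in /covers /=.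
case: (boolP (O a b c)) => //= abc; rewrite /inside /signed_inside -!/(sd _ _ _ _ _).
have := pos _ _ _ abc; rewrite -(sd_sum X Y a b c q) => S.
have -> : [&& sd X Y b c q < 0, sd X Y c a q < 0 & sd X Y a b q < 0] = false.
  by apply/negP => /and3P[]; lra.
by rewrite subr0; case: ifP.
Qed.

End Generic.

(** * The piecewise affine map with given vertex positions *)

Section PiecewiseLinear.
Context {R : realType}.
Notation plane := 'rV[R]_2.
Variables (K : set plane) (T : {fset {fset plane}}).
Hypothesis K_disk : SL_disk K T.
Hypothesis K_convex : convex_set K.

Let V : finType := vset T.
Let O : V -> V -> V -> bool := @tris R T.
Let px : V -> R := @vx R T.
Let py : V -> R := @vy R T.
Let B : pred V := @bdry_vertex R K T.
Let DC : disk_complex O B px py := tris_disk_complex K_disk K_convex.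
Let vtri (a b c : V) : set plane := tri (\val a) (\val b) (\val c).
Implicit Types (a b c v : V) (X Y : V -> R).

Let pos a b c : O a b c -> 0 < area px py a b c. Proof. exact: (cx_pos DC). Qed.
Let posN a b c : O a b c -> area px py a b c != 0.
Proof. by move=> /pos; exact: lt0r_neq0. Qed.

Lemma located x : K x -> exists a b c, O a b c /\ vtri a b c x.
Proof.
move=> Kx; have [a [b [c [abc tx]]]] := triangles_cover K_disk K_convex Kx.
have [a' [b' [c' [ea eb ec]]]] := is_tri_lift abc; subst a b c.
by exists a', b', c'.
Qed.

Definition bary a b c (x : plane) v : R :=
  if v == a then sd px py b c x / area px py a b c
  else if v == b then sd px py c a x / area px py a b c
  else if v == c then sd px py a b x / area px py a b c else 0.

Lemma tris_uniq a b c : O a b c -> uniq [:: a; b; c].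
Proof.
move=> /andP[_ /lt0r_neq0/orient_uniq]; rewrite /= !inE !andbT.
by rewrite !(inj_eq val_inj).
Qed.

Lemma bary_sum a b c x X : O a b c -> \sum_v bary a b c x v * X v =
  (sd px py b c x * X a + sd px py c a x * X b + sd px py a b x * X c) / area px py a b c.
Proof.
move=> /tris_uniq; rewrite /= !inE !andbT negb_or => /andP[/andP[ab ac] bc].
rewrite (bigD1 a) //= (bigD1 b) 1?eq_sym //= (bigD1 c) /=; last first.
  by rewrite ![c == _]eq_sym ac bc.
rewrite big1 ?addr0 => [|v /andP[/andP[va vb] vc]]; last first.
  by rewrite /bary (negbTE va) (negbTE vb) (negbTE vc) mul0r.
rewrite /bary !eqxx [b == a]eq_sym (negbTE ab) [c == a]eq_sym (negbTE ac).
rewrite [c == b]eq_sym (negbTE bc) addrA.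
by rewrite !mulrDl ![_ / _ * _]mulrAC.
Qed.

Lemma bary_ge0 a b c x v : O a b c -> vtri a b c x -> 0 <= bary a b c x v.
Proof.
move=> abc [e f g]; have D := pos abc; rewrite /bary.
by case: ifP => _; [|case: ifP => _; [|case: ifP => _ //]]; apply: divr_ge0 => //; exact: ltW.
Qed.

Lemma bary_sum1 a b c x : O a b c -> \sum_v bary a b c x v = 1.
Proof.
move=> abc; have := bary_sum x (fun=> 1) abc; under eq_bigr do rewrite mulr1.
by move=> ->; rewrite !mulr1 sd_sum divff// posN.
Qed.

Lemma transport_id a b c x : O a b c -> transport px py px py a b c x = x.
Proof.
move=> abc; rewrite /transport; apply: planeP; rewrite !coordE; apply: (mulfI (posN abc));
  rewrite mulrC divfK ?posN// /sd /side /area /cross; ring.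
Qed.

Lemma bary_point a b c x : O a b c -> x = \sum_v bary a b c x v *: \val v.
Proof.
move=> abc; rewrite -{1}(transport_id x abc) /transport -!bary_sum//.
have xs : xc (\sum_v bary a b c x v *: \val v) = \sum_v bary a b c x v * px v.
  by rewrite /xc summxE; apply: eq_bigr => v _; rewrite mxE.
have ys : yc (\sum_v bary a b c x v *: \val v) = \sum_v bary a b c x v * py v.
  by rewrite /yc summxE; apply: eq_bigr => v _; rewrite mxE.
by apply: planeP; rewrite !coordE ?xs ?ys.
Qed.

Let vfset a b c : {fset plane} := [fset \val a; \val b; \val c]%fset.

Lemma sum_vset (M : nmodType) (s : {fset plane}) (G : plane -> M) : (s `<=` vset T)%fset ->
  (forall p, p \notin s -> G p = 0) -> \sum_(p <- s) G p = \sum_(v : V) G (\val v).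
Proof.
move=> sV G0; rewrite (sum_fsubset G sV) big_seq_fsetE /=.
by apply: eq_bigr => v _; case: ifPn => // /G0.
Qed.

(** By [carrier] the coordinates of [x] in the first triangle are supported in the second, where
    barycentric coordinates are unique. *)
Lemma bary_agree a b c a' b' c' x : O a b c -> O a' b' c' -> vtri a b c x ->
  vtri a' b' c' x -> forall v, bary a b c x v = bary a' b' c' x v.
Proof.
move=> abc abc' tx tx'.
have /andP[sT sD] : is_tri T (\val a) (\val b) (\val c) by exact: abc.
have /andP[tT tD] : is_tri T (\val a') (\val b') (\val c') by exact: abc'.
have sub d e f : (vfset d e f `<=` vset T)%fset.
  by apply/fsubsetP => p; rewrite !inE => /orP[/orP[]|] /eqP ->; exact: valP.
pose ext (k : V -> R) p : R := if insub p is Some v then k v else 0.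
have extE k v : ext k (\val v) = k v by rewrite /ext valK.
have supp d e f y p : p \notin vfset d e f -> ext (bary d e f y) p = 0.
  rewrite /ext; case: insubP => //= v _ <-; rewrite !inE !negb_or !(inj_eq val_inj).
  by move=> /andP[/andP[/negbTE v1 /negbTE v2] /negbTE v3]; rewrite /bary v1 v2 v3.
have sum1 d e f : O d e f -> \sum_(p <- vfset d e f) ext (bary d e f x) p = 1.
  move=> def; rewrite (sum_vset (sub d e f)); last by move=> p; exact: supp.
  by under eq_bigr do rewrite extE; exact: bary_sum1.
have sumx d e f : O d e f -> \sum_(p <- vfset d e f) ext (bary d e f x) p *: p = x.
  move=> def; rewrite (sum_vset (sub d e f)) => [|p /supp ->]; last by rewrite scale0r.
  by under eq_bigr do rewrite extE; rewrite -bary_point.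
have kt p : p \notin vfset a' b' c' -> ext (bary a b c x) p = 0.
  move=> pt; have [ps|] := boolP (p \in vfset a b c); last exact: supp.
  apply/eqP; apply: contraNT pt => kp.
  apply: (carrier K_disk sT tT _ (sum1 _ _ _ abc) _ _ ps kp).
  - by move=> q _; rewrite /ext; case: insubP => // v _ _; exact: bary_ge0.
  - by rewrite sumx.
  - by rewrite hull_tri.
have [[ind _ _] _ _] := K_disk.
have H := affinely_independent_inj (proj2 (ind _ tT)) (k := ext (bary a b c x))
  (l := ext (bary a' b' c' x)).
move=> v; rewrite -[LHS]extE -[RHS]extE.
have [vt|vt] := boolP (\val v \in vfset a' b' c'); last by rewrite kt// supp.
apply: H => //.
  rewrite -/(vfset _ _ _) sum1// (sum_vset (sub _ _ _))//.
  by under eq_bigr do rewrite extE; exact: bary_sum1.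
rewrite -/(vfset _ _ _) sumx// (sum_vset (sub _ _ _)) => [|p /kt ->]; last by rewrite scale0r.
by under eq_bigr do rewrite extE; rewrite -bary_point.
Qed.

Lemma hat_exists : exists hat : set_type K -> V -> R,
  forall a b c x, O a b c -> vtri a b c (\val x) -> hat x = bary a b c (\val x).
Proof.
have Hx (x : set_type K) : exists t : V * V * V,
    O t.1.1 t.1.2 t.2 /\ vtri t.1.1 t.1.2 t.2 (\val x).
  by have [a [b [c H]]] := located (set_typeP x); exists (a, b, c).
have [t tP] := choice Hx; exists (fun x => bary (t x).1.1 (t x).1.2 (t x).2 (\val x)).
move=> a b c x abc tx; apply/funext => v; have [ot tt] := tP x.
exact: bary_agree.
Qed.

Definition hat : set_type K -> V -> R := projT1 (cid hat_exists).

Lemma hatE a b c x : O a b c -> vtri a b c (\val x) -> hat x = bary a b c (\val x).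
Proof. exact: (projT2 (cid hat_exists)). Qed.

Lemma bary_cont a b c v : continuous (fun x => bary a b c x v).
Proof.
rewrite /bary; case: (v == a); [|case: (v == b); [|case: (v == c)]];
  by [apply: cont_cst|apply: contM; [exact: sd_cont|exact: cont_cst]].
Qed.

(** Pasting over finitely many closed pieces. The pieces are a parameter because both the reference
    triangles and their images are used. *)
Lemma glue_cont (Z : topologicalType) (z : Z -> plane) (f : Z -> R)
    (C : V * (V * V) -> set plane) (G : V * (V * V) -> plane -> R) :
  (forall t, O t.1 t.2.1 t.2.2 -> closed (C t)) -> continuous z ->
  (forall t, O t.1 t.2.1 t.2.2 -> continuous (G t)) ->
  (forall w, exists2 t, O t.1 t.2.1 t.2.2 & C t (z w)) ->
  (forall w t, O t.1 t.2.1 t.2.2 -> C t (z w) -> f w = G t (z w)) -> continuous f.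
Proof.
move=> Cc cz cG cov fE w; apply/cvgrPdist_lt => e e0.
pose Q (t : V * (V * V)) (y : plane) := O t.1 t.2.1 t.2.2 -> C t y ->
  C t (z w) /\ `|G t (z w) - G t y| < e.
have : \forall y \near z w, forall t, Q t y.
  apply: (@filter_forall _ _ Q _ (nbhs_filter (z w))) => t; rewrite /Q.
  have [Ot|Ot] := boolP (O t.1 t.2.1 t.2.2); last by apply: nearW.
  have [tw|tw] := pselect (C t (z w)); last first.
    have : nbhs (z w) (~` C t).
      by apply: open_nbhs_nbhs; split => //; apply: closed_openC; exact: Cc.
    by apply: filterS => y ty _ /ty.
  have /cvgrPdist_lt/(_ e e0) := cG t Ot (z w).
  by apply: filterS => y H _ _; split.
move=> /(cz w); rewrite !nbhs_simpl /=; apply: filterS => w' /= H.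
have [t Ot tw'] := cov w'.
have [tw lt] := H t Ot tw'.
by rewrite (fE _ t)// (fE w' t).
Qed.

Lemma hat_cont v : continuous (hat ^~ v).
Proof.
apply: (@glue_cont _ (fun x : set_type K => \val x) _ (fun t => vtri t.1 t.2.1 t.2.2)
  (fun t x => bary t.1 t.2.1 t.2.2 x v)).
- by move=> t _; exact: tri_closed.
- exact: cont_val.
- by move=> t _; exact: bary_cont.
- by move=> w; have [a [b [c [abc tw]]]] := located (set_typeP w); exists (a, (b, c)).
- by move=> w t Ot tw; rewrite (hatE Ot tw).
Qed.

Definition pl_map X Y (x : set_type K) : plane :=
  pt (\sum_v hat x v * X v) (\sum_v hat x v * Y v).

Lemma pl_mapE X Y a b c x : O a b c -> vtri a b c (\val x) ->
  pl_map X Y x = transport px py X Y a b c (\val x).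
Proof. by move=> abc tx; rewrite /pl_map (hatE abc tx) !bary_sum. Qed.

Lemma pl_map_cont (Z : topologicalType) (X Y : Z -> V -> R) (x : Z -> set_type K) :
  (forall v, continuous (X ^~ v)) -> (forall v, continuous (Y ^~ v)) -> continuous x ->
  continuous (fun z => pl_map (X z) (Y z) (x z)).
Proof.
move=> cX cY cx.
have ch v : continuous (fun z => hat (x z) v) by apply: (cont_comp cx (@hat_cont v)).
apply: cont_plane.
  rewrite (_ : (fun t => _) = fun z => \sum_v hat (x z) v * X z v).
    by apply: cont_sum => v; exact: contM.
  by apply/funext => z; rewrite xc_pt.
rewrite (_ : (fun t => _) = fun z => \sum_v hat (x z) v * Y z v).
  by apply: cont_sum => v; exact: contM.
by apply/funext => z; rewrite yc_pt.
Qed.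

Definition vertex v : set_type K := to_set_type (vertex_in K_disk v).

Lemma star v : exists b c, O v b c. Proof. exact: (cx_star DC). Qed.

Lemma vtri_vertex a b c : O a b c -> vtri a b c (\val a).
Proof.
move=> /andP[_ D].
have e1 : orient (\val b) (\val c) (\val a) = orient (\val a) (\val b) (\val c).
  by rewrite /orient area_rot.
have e2 : orient (\val c) (\val a) (\val a) = 0 by rewrite /orient /area /cross; ring.
have e3 : orient (\val a) (\val b) (\val a) = 0 by rewrite /orient /area /cross; ring.
by split; rewrite ?e1 ?e2 ?e3 // ltW.
Qed.

Lemma transport_vertex X Y a b c : O a b c -> transport px py X Y a b c (\val a) = pt (X a) (Y a).
Proof.
move=> abc; have D0 := posN abc; rewrite /transport.
have -> : sd px py b c (\val a) = area px py a b c.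
  by rewrite /sd /side /area /cross /px /py /vx /vy; ring.
have -> : sd px py c a (\val a) = 0 by rewrite /sd /side /cross /px /py /vx /vy; ring.
have -> : sd px py a b (\val a) = 0 by rewrite /sd /side /cross /px /py /vx /vy; ring.
by rewrite !mul0r !addr0 ![area _ _ _ _ _ * _]mulrC !mulfK.
Qed.

Lemma pl_map_vertex X Y v : pl_map X Y (vertex v) = pt (X v) (Y v).
Proof.
have [b [c vbc]] := star v.
rewrite (pl_mapE X Y (a := v) (b := b) (c := c))//; first exact: transport_vertex.
exact: vtri_vertex.
Qed.

Lemma hat_id x : pl_map px py x = \val x.
Proof.
have [a [b [c [abc tx]]]] := located (set_typeP x).
by rewrite (pl_mapE _ _ abc tx) transport_id.
Qed.

End PiecewiseLinear.

(** * Admissible configurations are homeomorphisms *)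

Lemma uniq_rotations (T : eqType) (a b c : T) : uniq [:: a; b; c] ->
  uniq [:: (a, (b, c)); (b, (c, a)); (c, (a, b))].
Proof.
rewrite !cons_uniq !in_cons !in_nil !orbF !andbT negb_or => /andP[/andP[ab ac] bc].
by rewrite !xpair_eqE (negbTE ab) (negbTE ac) (negbTE bc).
Qed.

Section Homeomorphisms.
Context {R : realType}.
Notation plane := 'rV[R]_2.
Variables (K : set plane) (T : {fset {fset plane}}).
Hypothesis K_disk : SL_disk K T.
Hypothesis K_convex : convex_set K.

Let V : finType := vset T.
Let O : V -> V -> V -> bool := @tris R T.
Let px : V -> R := @vx R T.
Let py : V -> R := @vy R T.
Let B : pred V := @bdry_vertex R K T.
Let DC : disk_complex O B px py := tris_disk_complex K_disk K_convex.
Let vtri (a b c : V) : set plane := tri (\val a) (\val b) (\val c).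
Let pl := pl_map K_disk K_convex.
Implicit Types (a b c v : V) (X Y : V -> R).

Let pos a b c : O a b c -> 0 < area px py a b c. Proof. exact: (cx_pos DC). Qed.
Let posN a b c : O a b c -> area px py a b c != 0.
Proof. by move=> /pos; exact: lt0r_neq0. Qed.

Definition itri X Y a b c : set plane :=
  [set q | [/\ 0 <= sd X Y b c q, 0 <= sd X Y c a q & 0 <= sd X Y a b q]].
Definition oitri X Y a b c : set plane :=
  [set q | [/\ 0 < sd X Y b c q, 0 < sd X Y c a q & 0 < sd X Y a b q]].

Lemma oitri_open X Y a b c : open (oitri X Y a b c).
Proof.
rewrite (_ : oitri X Y a b c = [set x | 0 < sd X Y b c x] `&`
  [set x | 0 < sd X Y c a x] `&` [set x | 0 < sd X Y a b x]).
  have op d e : open [set x | 0 < sd X Y d e x] by apply: cont_open; exact: sd_cont.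
  by apply: openI => //; apply: openI.
by apply/seteqP; split=> [x [? ? ?]|x [[? ?] ?]].
Qed.

Lemma itri_closed X Y a b c : closed (itri X Y a b c).
Proof.
rewrite (_ : itri X Y a b c = (sd X Y b c @^-1` [set t | 0 <= t]) `&`
  (sd X Y c a @^-1` [set t | 0 <= t]) `&` (sd X Y a b @^-1` [set t | 0 <= t])).
  have cl d e : closed (sd X Y d e @^-1` [set t | 0 <= t]).
    by have /continuous_closedP := @sd_cont _ _ X Y d e; apply; exact: closed_ge.
  by apply: closedI => //; apply: closedI.
by apply/seteqP; split=> [x [? ? ?]|x [[? ?] ?]].
Qed.

Lemma oitri_itri X Y a b c : oitri X Y a b c `<=` itri X Y a b c.
Proof. by move=> q [? ? ?]; split; exact: ltW. Qed.

Lemma generic_itri X Y a b c q : generic O (xc q) (yc q) X Y -> O a b c ->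
  itri X Y a b c q -> oitri X Y a b c q.
Proof.
move=> [_ g] abc [e1 e2 e3]; have bca := cx_rot DC abc; have cab := cx_rot DC bca.
by split; rewrite lt0r; apply/andP; split => //; [exact: g bca|exact: g cab|exact: g abc].
Qed.

Lemma covers_oitri X Y q a b c : covers O X Y q (a, (b, c)) <-> O a b c /\ oitri X Y a b c q.
Proof. by split=> [/and4P[]|[? [? ? ?]]] //; apply/and4P. Qed.

Lemma covers_rot X Y q a b c : covers O X Y q (a, (b, c)) -> covers O X Y q (b, (c, a)).
Proof. by move=> /covers_oitri[/(cx_rot DC) ? []] ? ? ?; apply/covers_oitri; split. Qed.

Lemma covers_reference_inj q a b c a' b' c' : covers O px py q (a, (b, c)) ->
  covers O px py q (a', (b', c')) ->
  (a', (b', c')) \in [:: (a, (b, c)); (b, (c, a)); (c, (a, b))].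
Proof.
move=> /covers_oitri[abc ox] /covers_oitri[abc' ox'].
have o1 : otri (\val a') (\val b') (\val c') q by case: ox' => ? ? ?; split.
have o2 : tri (\val a) (\val b) (\val c) q by case: ox => ? ? ?; split; exact: ltW.
have t1 : is_tri T (\val a) (\val b) (\val c) by exact: abc.
have t2 : is_tri T (\val a') (\val b') (\val c') by exact: abc'.
have := otri_inj K_disk t2 t1 o1 o2.
case=> -[/val_inj e1 /val_inj e2 /val_inj e3]; rewrite e1 e2 e3.
- exact: mem_head.
- by rewrite in_cons mem_head orbT.
- by rewrite in_cons; apply/orP; right; rewrite in_cons; apply/orP; right; exact: mem_head.
Qed.

Lemma covers_reference q : generic O (xc q) (yc q) px py ->
  K q <-> exists t, covers O px py q t.
Proof.
move=> gen; split=> [Kq|[[a [b c]] /covers_oitri[abc /oitri_itri tq]]].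
  have [a [b [c [abc tq]]]] := located K_disk K_convex Kq.
  by exists (a, (b, c)); apply/covers_oitri; split => //; apply: generic_itri.
by apply: (is_tri_sub K_disk abc).
Qed.

Section Admissible.
Variables X Y : V -> R.
Hypothesis adm : admissible O B px py X Y.

Let posXY a b c : O a b c -> 0 < area X Y a b c. Proof. exact: (proj2 adm). Qed.
Let posXYN a b c : O a b c -> area X Y a b c != 0.
Proof. by move=> /posXY; exact: lt0r_neq0. Qed.

Let gen2 q := generic O (xc q) (yc q) px py /\ generic O (xc q) (yc q) X Y.

Lemma covers_card q : gen2 q -> #|covers O X Y q| = #|covers O px py q|.
Proof.
move=> [g1 g2]; apply/eqP; rewrite -(eqr_nat R) -!sum_inside_covers//.
by apply/eqP; apply: (stokes DC) => //; exact: (proj1 adm).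
Qed.

Lemma covers_image q : gen2 q -> K q <-> exists t, covers O X Y q t.
Proof.
move=> g; have E := covers_card g; rewrite (covers_reference (proj1 g)).
split=> -[t Ct].
  have : (0 < #|covers O px py q|)%N by apply/card_gt0P; exists t.
  by rewrite -E => /card_gt0P[t' Ct']; exists t'.
have : (0 < #|covers O X Y q|)%N by apply/card_gt0P; exists t.
by rewrite E => /card_gt0P[t' Ct']; exists t'.
Qed.

(* Each triangle is listed three times, by its rotations. *)
Lemma covers_inj q a b c a' b' c' : gen2 q -> covers O X Y q (a, (b, c)) ->
  covers O X Y q (a', (b', c')) ->
  (a', (b', c')) \in [:: (a, (b, c)); (b, (c, a)); (c, (a, b))].
Proof.
move=> g C1 C2; apply: contraT => nin.
have u4 : uniq [:: (a', (b', c')); (a, (b, c)); (b, (c, a)); (c, (a, b))].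
  have /covers_oitri[/tris_uniq u _] := C1.
  by rewrite cons_uniq nin uniq_rotations.
have enumP (X' Y' : V -> R) t : (t \in enum (covers O X' Y' q)) = covers O X' Y' q t.
  by rewrite mem_enum.
have C1' := covers_rot C1; have C1'' := covers_rot C1'.
have := covers_card g; rewrite !cardE => E.
have [[a0 [b0 c0]] C0] : exists t, covers O px py q t.
  by apply/(covers_reference (proj1 g)); apply/(covers_image g); exists (a, (b, c)).
(* The two counts are equal, and four distinct listings exceed the three that the reference position
   allows. *)
have := @uniq_leq_size _ _ (enum (covers O X Y q)) u4; rewrite E => H.
have {}H : (4 <= size (enum (covers O px py q)))%N.
  apply: H => t; rewrite enumP.
  by do 4![rewrite in_cons => /orP[/eqP -> //|]].
have := @uniq_leq_size _ (enum (covers O px py q))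
  [:: (a0, (b0, c0)); (b0, (c0, a0)); (c0, (a0, b0))] (enum_uniq _).
rewrite leqNgt H /= => N; apply: N => -[a1 [b1 c1]]; rewrite enumP.
exact: covers_reference_inj.
Qed.

Lemma pl_sd p a b c : O a b c -> vtri a b c (\val p) ->
  sd X Y a b (pl X Y p) * area px py a b c = sd px py a b (\val p) * area X Y a b c.
Proof.
move=> abc tp; rewrite /pl (pl_mapE K_disk K_convex X Y abc tp).
exact: sd_transport (posN abc).
Qed.

Lemma pl_sd_gt0 p a b c : O a b c -> vtri a b c (\val p) ->
  (0 < sd X Y a b (pl X Y p)) = (0 < sd px py a b (\val p)).
Proof.
move=> abc tp; rewrite -(pmulr_lgt0 _ (pos abc)) (pl_sd abc tp).
by rewrite pmulr_lgt0// posXY.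
Qed.

Lemma vtri_rot a b c : vtri a b c `<=` vtri b c a.
Proof. by move=> x [? ? ?]. Qed.

Lemma near_oitri p a b c (U : set plane) : O a b c -> vtri a b c (\val p) ->
  nbhs (pl X Y p) U -> exists2 r, U r & oitri X Y a b c r.
Proof.
move=> abc tp; rewrite {1}/pl (pl_mapE K_disk K_convex X Y abc tp) => NU.
pose x := \val p; pose g : plane := 3^-1 *: (\val a + \val b + \val c).
have /andP[_ D0] : is_tri T (\val a) (\val b) (\val c) by exact: abc.
have og : otri (\val a) (\val b) (\val c) g by exact: centroid_otri.
have N : nbhs x (transport px py X Y a b c @^-1` U).
  by apply: (@transport_cont _ _ px py X Y a b c x).
have [e e0 He] := open_ray (g - x) (@open_interior _ _) (N : (_)° x).
pose t := Num.min 1 (e / 2).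
have t0 : 0 < t by rewrite lt_min ltr01 divr_gt0.
have t1 : t <= 1 by rewrite ge_min lexx.
have te : `|t| < e.
  by rewrite gtr0_norm// (@le_lt_trans _ _ (e / 2)) ?ge_min ?lexx ?orbT//; lra.
pose y := x + t *: (g - x).
have Uy : U (transport px py X Y a b c y) by have /interior_subset := He t te.
exists (transport px py X Y a b c y) => //.
have [g1 g2 g3] := og; have [x1 x2 x3] := tp.
have mix (u v : V) : 0 <= orient (\val u) (\val v) x -> 0 < orient (\val u) (\val v) g ->
    0 < sd px py u v y.
  move=> h1 h2; have -> : sd px py u v y = (1 - t) * orient (\val u) (\val v) x +
      t * orient (\val u) (\val v) g.
    by rewrite /y /sd /side /orient /area /cross !coordE /px /py /vx /vy; ring.
  by apply: ltr_wpDl; [rewrite mulr_ge0// subr_ge0|exact: mulr_gt0].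
have [e1 e2 e3] := sd_transport_rot X Y y (posN abc).
have sgn (s s' : R) : s * area px py a b c = s' * area X Y a b c -> 0 < s' -> 0 < s.
  move=> E s'0; rewrite -(pmulr_lgt0 _ (pos abc)) E; apply: mulr_gt0 => //; exact: posXY.
by split; [apply: sgn e1 _|apply: sgn e2 _|apply: sgn e3 _]; exact: mix.
Qed.

(** One triangle, two triangles or the whole star fill the neighbourhood, according to whether [p]
    is inside a triangle, inside an edge or a vertex. *)
Lemma local_surjectivity p : K° (\val p) -> exists2 M, nbhs (pl X Y p) M &
  forall r, M r -> exists a b c, [/\ O a b c, vtri a b c (\val p) & itri X Y a b c r].
Proof.
move=> Kp.
set goal := exists2 M, _ & _.
have case_open a b c : O a b c -> vtri a b c (\val p) ->
    0 < sd px py b c (\val p) -> 0 < sd px py c a (\val p) -> 0 < sd px py a b (\val p) ->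
    goal.
  move=> abc tp e1 e2 e3; have bca := cx_rot DC abc; have cab := cx_rot DC bca.
  have tp1 := vtri_rot tp; have tp2 := vtri_rot tp1.
  exists (oitri X Y a b c).
    apply: open_nbhs_nbhs; split; first exact: oitri_open.
    by split; [rewrite (pl_sd_gt0 bca tp1)|rewrite (pl_sd_gt0 cab tp2)|rewrite (pl_sd_gt0 abc tp)].
  by move=> r /oitri_itri; exists a, b, c.
(* The triangle across the edge exists because [p] is interior; near the image the sign of
   [sd X Y a b] decides which of the two contains [r]. *)
have case_edge a b c : O a b c -> vtri a b c (\val p) ->
    0 < sd px py b c (\val p) -> 0 < sd px py c a (\val p) -> sd px py a b (\val p) = 0 ->
    goal.
  move=> abc tp e1 e2 e3; have bca := cx_rot DC abc; have cab := cx_rot DC bca.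
  have tp1 := vtri_rot tp; have tp2 := vtri_rot tp1.
  have D0 := pos abc; have S := sd_sum px py a b c (\val p).
  pose l := sd px py b c (\val p) / area px py a b c.
  have l0 : 0 < l by rewrite divr_gt0.
  have l1 : 0 < 1 - l.
    by rewrite subr_gt0 ltr_pdivrMr// mul1r -S; lra.
  have pE : \val p = l *: \val a + (1 - l) *: \val b.
    have lD : l * area px py a b c = sd px py b c (\val p) by rewrite divfK// gt_eqF.
    rewrite -[LHS](transport_id K_disk K_convex _ abc) /transport -S e3 addr0.
    have lE : 1 - l = sd px py c a (\val p) / area px py a b c.
      by apply: (mulIf (lt0r_neq0 D0)); rewrite mulrBl mul1r lD divfK ?gt_eqF//; lra.
    rewrite lE /l -S e3 addr0.
    by apply: planeP; rewrite !coordE /px /py /vx /vy mul0r addr0 mulrDl ![_ / _ * _]mulrAC.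
  have [||d bad] := @tris_opposite _ _ _ K_disk K_convex a b c l abc l0 _ _.
  - by rewrite -subr_gt0.
  - by rewrite -pE.
  have adb := cx_rot DC bad; have dba := cx_rot DC adb.
  have D1 := pos bad.
  have q1 : sd px py a d (\val p) = (1 - l) * area px py b a d.
    by rewrite pE /sd /side /area /cross !coordE /px /py /vx /vy; ring.
  have q2 : sd px py d b (\val p) = l * area px py b a d.
    by rewrite pE /sd /side /area /cross !coordE /px /py /vx /vy; ring.
  have q3 : sd px py b a (\val p) = 0 by rewrite sdC e3 oppr0.
  have tp' : vtri b a d (\val p).
    split; [suff : 0 <= sd px py a d (\val p) by []|suff : 0 <= sd px py d b (\val p) by []|
      suff : 0 <= sd px py b a (\val p) by []].
    - by rewrite q1 mulr_ge0// ltW.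
    - by rewrite q2 mulr_ge0// ltW.
    - by rewrite q3.
  have tp1' := vtri_rot tp'; have tp2' := vtri_rot tp1'.
  exists ([set r | 0 < sd X Y b c r] `&` [set r | 0 < sd X Y c a r] `&`
    ([set r | 0 < sd X Y a d r] `&` [set r | 0 < sd X Y d b r])).
    have op u v : open [set r | 0 < sd X Y u v r] by apply: cont_open; exact: sd_cont.
    apply: open_nbhs_nbhs; split; first by apply: openI; apply: openI.
    split; split.
    - by rewrite /= (pl_sd_gt0 bca tp1).
    - by rewrite /= (pl_sd_gt0 cab tp2).
    - by rewrite /= (pl_sd_gt0 adb tp1') q1 mulr_gt0.
    - by rewrite /= (pl_sd_gt0 dba tp2') q2 mulr_gt0.
  move=> r [[/ltW r1 /ltW r2] [/ltW r3 /ltW r4]].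
  have [r0|r0] := lerP 0 (sd X Y a b r); first by exists a, b, c.
  by exists b, a, d; split => //; split => //; rewrite sdC oppr_ge0 ltW.
(* The image fan surrounds the image of [a], so [fan_cross] finds a cone containing the direction of
   [r]; closeness gives the third inequality. *)
have case_vertex a : p = vertex K_disk a -> goal.
  move=> pa; have Ba : ~~ B a by apply/asboolP; rewrite pa in Kp => /(_ Kp).
  have pl_a : pl X Y p = pt (X a) (Y a) by rewrite pa; exact: pl_map_vertex.
  pose Q (t : V * V) r := O a t.1 t.2 -> 0 < sd X Y t.1 t.2 r.
  exists [set r | forall t, Q t r].
    apply: (@filter_forall _ _ Q _ (nbhs_filter _)) => t; rewrite /Q.
    have [at_|_] := boolP (O a t.1 t.2); last by apply: nearW.
    have : nbhs (pl X Y p) [set r | 0 < sd X Y t.1 t.2 r].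
      apply: open_nbhs_nbhs; split; first by apply: cont_open; exact: sd_cont.
      rewrite /= pl_a; have := posXY at_; congr (0 < _).
      by rewrite /sd /side /area /cross !coordE; ring.
    by apply: filterS.
  move=> r Mr.
  have [b0 [c0 abc0]] := star K_disk K_convex a.
  have [/andP[/eqP r1 /eqP r2]|nz] := boolP ((xc r - X a == 0) && (yc r - Y a == 0)).
    exists a, b0, c0; split => //; first by rewrite pa; exact: vtri_vertex.
    have rE : r = pt (X a) (Y a) by apply: planeP; rewrite !coordE; lra.
    split.
    - by apply: ltW; apply: (Mr (b0, c0)).
    - suff -> : sd X Y c0 a r = 0 by [].
      by rewrite rE /sd /side /cross !coordE; ring.
    - suff -> : sd X Y a b0 r = 0 by [].
      by rewrite rE /sd /side /cross !coordE; ring.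
  rewrite negb_and in nz.
  have [|//|b [c [_ abc e1 e2]]] :=
    @fan_cross _ _ _ _ _ _ DC X Y a predT Ba (posXY (a := a)) _ _ _ _ nz.
    by exists b0, c0.
  exists a, b, c; split => //; first by rewrite pa; exact: vtri_vertex.
  split.
  - by apply: ltW; apply: (Mr (b, c)).
  - move: e2; rewrite -oppr_ge0; congr (0 <= _).
    by rewrite /sd /side /cross; ring.
  - by apply: ltW; exact: e1.
have [a [b [c [abc tp]]]] := located K_disk K_convex (set_typeP p).
have bca := cx_rot DC abc; have cab := cx_rot DC bca.
have tp1 := vtri_rot tp; have tp2 := vtri_rot tp1.
have pv u v w : O u v w -> sd px py w u (\val p) = 0 -> sd px py u v (\val p) = 0 ->
    p = vertex K_disk u.
  move=> uvw e1 e2; apply: val_inj.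
  have S := sd_sum px py u v w (\val p); rewrite e1 e2 !addr0 in S.
  rewrite -[LHS](transport_id K_disk K_convex _ uvw) /transport S e1 e2.
  by apply: planeP; rewrite !coordE !mul0r !addr0 [area _ _ _ _ _ * _]mulrC mulfK ?posN.
have [] : [/\ 0 <= sd px py b c (\val p), 0 <= sd px py c a (\val p) & 0 <= sd px py a b (\val p)].
  exact: tp.
rewrite !le_eqVlt => /orP[/eqP/esym e1|e1] /orP[/eqP/esym e2|e2] /orP[/eqP/esym e3|e3].
- by have := pos abc; rewrite -(sd_sum px py a b c (\val p)) e1 e2 e3 !addr0 ltxx.
- exact: case_vertex (pv _ _ _ cab e1 e2).
- exact: case_vertex (pv _ _ _ bca e3 e1).
- exact: case_edge bca tp1 e2 e3 e1.
- exact: case_vertex (pv _ _ _ abc e2 e3).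
- exact: case_edge cab tp2 e3 e1 e2.
- exact: case_edge abc tp e1 e2 e3.
- exact: case_open abc tp e1 e2 e3.
Qed.

Lemma generic_in (U : set plane) : open U -> U !=set0 -> exists q, U q /\ gen2 q.
Proof.
move=> oU U0; have [q [Uq g1 g2]] := exists_generic posN posXYN oU U0.
by exists q.
Qed.

(** Near the common image a generic point is taken inside the image of a triangle containing [p'];
    by [local_surjectivity] the image of a triangle containing [p] covers it too. By [covers_inj]
    the triangles agree, and [transport] is invertible. *)
Lemma pl_inj_interior p p' : K° (\val p) -> pl X Y p = pl X Y p' -> p = p'.
Proof.
move=> Kp pp'; have [M NM HM] := local_surjectivity Kp.
have [a' [b' [c' [abc' tp']]]] := located K_disk K_convex (set_typeP p').
have NM' : nbhs (pl X Y p') M° by rewrite -pp'; exact: nbhs_interior.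
have [r0 Mr0 or0] := near_oitri abc' tp' NM'.
have [||r [[Mr or] gr]] := @generic_in (M° `&` oitri X Y a' b' c').
- by apply: openI; [exact: open_interior|exact: oitri_open].
- by exists r0.
have [a [b [c [abc tp ir]]]] := HM r (interior_subset Mr).
have C1 : covers O X Y r (a, (b, c)).
  by apply/covers_oitri; split => //; apply: generic_itri => //; exact: (proj2 gr).
have C2 : covers O X Y r (a', (b', c')) by apply/covers_oitri.
have {}tp' : vtri a b c (\val p').
  have := covers_inj gr C1 C2.
  rewrite in_cons => /orP[/eqP [e1 e2 e3]|]; first by rewrite -e1 -e2 -e3.
  rewrite in_cons => /orP[/eqP [e1 e2 e3]|].
    by rewrite -e1 -e2 -e3 in tp *; exact/vtri_rot/vtri_rot.
  rewrite in_cons => /orP[/eqP [e1 e2 e3]|//].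
  by move: tp'; rewrite e1 e2 e3; exact: vtri_rot.
apply: val_inj.
have := congr1 (transport X Y px py a b c) pp'.
rewrite /pl (pl_mapE K_disk K_convex X Y abc tp) (pl_mapE K_disk K_convex X Y abc tp').
by rewrite !transportK ?posN ?posXYN.
Qed.

(** Otherwise generic points outside [K] near the image would be covered, against [covers_image]. *)
Lemma pl_interior p : K° (\val p) -> K° (pl X Y p).
Proof.
move=> Kp; have [M NM HM] := local_surjectivity Kp.
apply: contrapT => nK.
have cK : closed K := K_closed K_disk K_convex.
have [||r [[Mr nKr] gr]] := @generic_in (M° `&` ~` K).
- by apply: openI; [exact: open_interior|exact: closed_openC].
- apply: contrapT => no; apply: nK.
  suff : nbhs (pl X Y p) K by [].
  apply: filterS (nbhs_interior NM) => y My; apply: contrapT => Ky.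
  by apply: no; exists y.
have [a [b [c [abc _ ir]]]] := HM r (interior_subset Mr).
apply: nKr; apply/(covers_image gr); exists (a, (b, c)).
by apply/covers_oitri; split => //; apply: generic_itri => //; exact: (proj2 gr).
Qed.

End Admissible.

Lemma conv3_interior (u w z : plane) (l m n : R) : K° u -> K w -> K z ->
  0 < l -> 0 <= m -> 0 <= n -> l + m + n = 1 -> K° (l *: u + m *: w + n *: z).
Proof.
move=> Ku Kw Kz l0 m0 n0 lmn.
have [mn|mn] := eqVneq (m + n) 0.
  have [e1 e2] : m = 0 /\ n = 0 by split; lra.
  by move: lmn; rewrite e1 e2 !addr0 !scale0r !addr0 => ->; rewrite scale1r.
have mn0 : 0 < m + n by rewrite lt0r mn addr_ge0.
have lE : 1 - l = m + n by lra.
have e1 : (1 - l) * (m / (m + n)) = m by rewrite lE mulrC divfK.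
have e2 : (1 - l) * (1 - m / (m + n)) = n by rewrite mulrBr e1 mulr1 lE; ring.
rewrite -addrA (_ : m *: w + n *: z =
  (1 - l) *: (m / (m + n) *: w + (1 - m / (m + n)) *: z)); last first.
  by rewrite scalerDr !scalerA e1 e2.
apply: segment_interior => //; last by lra.
apply: conv2 => //; first by rewrite divr_ge0// ltW.
by rewrite ler_pdivrMr// mul1r lerDl.
Qed.

(** A positive barycentric coordinate at an interior vertex would make the point interior, so only
    fixed vertices contribute. *)
Lemma pl_boundary X Y p : (forall v, B v -> X v = px v /\ Y v = py v) ->
  ~ K° (\val p) -> pl X Y p = \val p.
Proof.
move=> XB nKp; rewrite -[RHS](hat_id K_disk K_convex); rewrite /pl /pl_map.
suff H v : hat K_disk K_convex p v = 0 \/ B v.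
  by congr pt; apply: eq_bigr => v _; have [->|/XB[e1 e2]] := H v; rewrite ?mul0r ?e1 ?e2.
have [a [b [c [abc tp]]]] := located K_disk K_convex (set_typeP p).
rewrite (hatE K_disk K_convex abc tp).
have key u w z : O u w z -> vtri u w z (\val p) -> sd px py w z (\val p) = 0 \/ B u.
  move=> uwz tp'; have [[f1 f2 f3]] := (tp', tt).
  have [e|e] := eqVneq (sd px py w z (\val p)) 0; first by left.
  right; apply/asboolP => Ku; apply: nKp.
  have D0 := pos uwz; have S := sd_sum px py u w z (\val p).
  rewrite -(transport_id K_disk K_convex (\val p) uwz) (_ : transport _ _ _ _ _ _ _ _ =
      (sd px py w z (\val p) / area px py u w z) *: \val u +
      (sd px py z u (\val p) / area px py u w z) *: \val w +
      (sd px py u w (\val p) / area px py u w z) *: \val z); last first.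
    by apply: planeP; rewrite /transport !coordE !mulrDl ![_ / _ * _]mulrAC.
  apply: conv3_interior => //.
  - exact: vertex_in.
  - exact: vertex_in.
  - by rewrite divr_gt0// lt0r e.
  - by rewrite divr_ge0// ltW.
  - by rewrite divr_ge0// ltW.
  - by rewrite -!mulrDl S divff// posN.
have bca := cx_rot DC abc; have cab := cx_rot DC bca.
have tp1 := vtri_rot tp; have tp2 := vtri_rot tp1.
rewrite /bary; case: eqP => [->|_].
  by have [e|?] := key _ _ _ abc tp; [left; rewrite -/px -/py e mul0r|right].
case: eqP => [->|_].
  by have [e|?] := key _ _ _ bca tp1; [left; rewrite -/px -/py e mul0r|right].
case: eqP => [->|_]; last by left.
by have [e|?] := key _ _ _ cab tp2; [left; rewrite -/px -/py e mul0r|right].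
Qed.

(** The barycentre of [s] has all coordinates positive, so by [carrier] a triangle containing it has
    all vertices of [s]. *)
Lemma simplex_in_triangle s : s \in T -> exists a b c, O a b c /\
  hull s `<=` vtri a b c.
Proof.
move=> sT; have [[ind _ _] KE _] := K_disk; have [s0 _] := ind s sT.
have n0 : (0 : R) < #|` s|%:R by rewrite ltr0n lt0n cardfs_eq0.
pose x := \sum_(p <- s) (#|` s|%:R : R)^-1 *: p.
have sum1 : \sum_(p <- s) (#|` s|%:R : R)^-1 = 1.
  by rewrite big_const_seq count_predT iter_addr_0 -[LHS]mulr_natr mulVf// lt0r_neq0.
have hx : hull s x by exists (fun=> (#|` s|%:R)^-1); split => // p _; rewrite invr_ge0 ltW.
have Kx : K x by rewrite KE; exists s.
have [a [b [c [abc tx]]]] := located K_disk K_convex Kx.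
have [tT D0] := andP (abc : is_tri T (\val a) (\val b) (\val c)).
exists a, b, c; split => //.
have sub p : p \in s -> p \in [fset \val a; \val b; \val c]%fset.
  move=> ps; apply: (carrier K_disk sT tT (k := fun=> (#|` s|%:R)^-1) (x := x) _ sum1 _ _ ps).
  - by move=> q _; rewrite invr_ge0 ltW.
  - by [].
  - by rewrite hull_tri.
  - by rewrite invr_eq0 gt_eqF.
rewrite -[vtri a b c]/(tri _ _ _) -hull_tri// => y [k [k0 k1 ->]].
have subf : (s `<=` [fset \val a; \val b; \val c])%fset by apply/fsubsetP.
exists (fun p => if p \in s then k p else 0); split.
- by move=> p _; case: ifP => // /k0.
- by rewrite -(sum_fsubset k subf).
- rewrite (sum_fsubset (fun p => k p *: p) subf); apply: eq_bigr => p _.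
  by case: ifP; rewrite ?scale0r.
Qed.

Theorem pl_homeo X Y : admissible O B px py X Y ->
  exists f : set_type K -> set_type K, SL_homeo_rel_boundary K T f /\
    forall p, \val (f p) = pl X Y p.
Proof.
move=> adm; have posXY : forall a b c, O a b c -> 0 < area X Y a b c := proj2 adm.
have posXYN a b c : O a b c -> area X Y a b c != 0 by move=> /posXY; exact: lt0r_neq0.
have XB : forall v, B v -> X v = px v /\ Y v = py v := proj1 adm.
have inK p : K (pl X Y p).
  have [Kp|Kp] := pselect (K° (\val p)); first exact: interior_subset (pl_interior adm Kp).
  by rewrite pl_boundary//; exact: set_typeP.
pose f p := to_set_type (inK p); exists f; split => //.
have fi : injective f.
  move=> p p' /(congr1 \val) /= pp'.
  have [Kp|Kp] := pselect (K° (\val p)); first exact: (pl_inj_interior adm Kp pp').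
  have [Kp'|Kp'] := pselect (K° (\val p')); first exact/esym/(pl_inj_interior adm Kp')/esym.
  by apply: val_inj; rewrite -(pl_boundary XB Kp) -(pl_boundary XB Kp').
have inv_tri q a b c : O a b c -> itri X Y a b c q ->
    exists2 p : set_type K, \val p = transport X Y px py a b c q & pl X Y p = q.
  move=> abc [i1 i2 i3]; set x := transport X Y px py a b c q.
  have [e1 e2 e3] := sd_transport_rot px py q (posXYN _ _ _ abc).
  have sgn (s s' : R) : s * area X Y a b c = s' * area px py a b c -> 0 <= s' -> 0 <= s.
    move=> E s'0; rewrite -(pmulr_lge0 _ (posXY _ _ _ abc)) E mulr_ge0// ltW//; exact: pos.
  have tx : vtri a b c x by split; [apply: sgn e1 i1|apply: sgn e2 i2|apply: sgn e3 i3].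
  have Kx : K x by apply: (is_tri_sub K_disk abc).
  pose p := to_set_type Kx; exists p => //.
  rewrite /pl (@pl_mapE _ _ _ K_disk K_convex X Y a b c p abc tx).
  by rewrite transportK ?posXYN// posN.
(* A point missed by the closed image triangles has a neighbourhood missed by them, and this
   contains generic points of the interior of [K], against [covers_image]. *)
have cover q : K q -> exists2 t : V * (V * V), O t.1 t.2.1 t.2.2 & itri X Y t.1 t.2.1 t.2.2 q.
  move=> Kq; apply: contrapT => no.
  pose Q (t : V * (V * V)) y := O t.1 t.2.1 t.2.2 -> ~ itri X Y t.1 t.2.1 t.2.2 y.
  have N : \forall y \near q, forall t, Q t y.
    apply: (@filter_forall _ _ Q _ (nbhs_filter q)) => t; rewrite /Q.
    have [Ot|_] := boolP (O t.1 t.2.1 t.2.2); last by apply: nearW.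
    have : nbhs q (~` itri X Y t.1 t.2.1 t.2.2).
      apply: open_nbhs_nbhs; split; first by apply: closed_openC; exact: itri_closed.
      by move=> tq; apply: no; exists t.
    by apply: filterS.
  have [y Ky Ny] := near_interior K_disk K_convex Kq (nbhs_interior N).
  have [||r [[Kr Nr] gr]] := @generic_in X Y adm (K° `&` [set y | forall t, Q t y]°).
  - by apply: openI; exact: open_interior.
  - by exists y.
  have [t Ct] := proj1 (covers_image adm gr) (interior_subset Kr).
  move: t Ct => [a [b c]] /covers_oitri[abc /oitri_itri it].
  exact: (interior_subset Nr (a, (b, c)) abc it).
have surj q : exists p, f p = q.
  have [[a [b c]] /= abc it] := cover _ (set_typeP q).
  by have [p _ pq] := inv_tri _ _ _ _ abc it; exists p; apply: val_inj.
have [g gK] := choice surj.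
have cf : continuous f.
  apply: cont_set_type => /=.
  apply: (@pl_map_cont R K T K_disk K_convex _ (fun=> X) (fun=> Y) id).
  - by move=> v; exact: cont_cst.
  - by move=> v; exact: cont_cst.
  - by move=> ?; exact: cvg_id.
have gE q a b c : O a b c -> itri X Y a b c (\val q) ->
    \val (g q) = transport X Y px py a b c (\val q).
  move=> abc it; have [p <- pq] := inv_tri _ _ _ _ abc it.
  by congr (\val _); apply: fi; rewrite gK; apply: val_inj.
have cg : continuous g.
  apply: cont_set_type; apply: cont_plane.
    apply: (@glue_cont R T _ (fun x : set_type K => \val x) _
      (fun t => itri X Y t.1 t.2.1 t.2.2)
      (fun t x => xc (transport X Y px py t.1 t.2.1 t.2.2 x))).
    - by move=> t _; exact: itri_closed.
    - exact: cont_val.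
    - by move=> t _; apply: (cont_comp _ xc_cont); exact: transport_cont.
    - by move=> w; exact: cover (set_typeP w).
    - by move=> w [a [b c]] /= abc it; rewrite (gE _ _ _ _ abc it).
  apply: (@glue_cont R T _ (fun x : set_type K => \val x) _
    (fun t => itri X Y t.1 t.2.1 t.2.2)
    (fun t x => yc (transport X Y px py t.1 t.2.1 t.2.2 x))).
  - by move=> t _; exact: itri_closed.
  - exact: cont_val.
  - by move=> t _; apply: (cont_comp _ yc_cont); exact: transport_cont.
  - by move=> w; exact: cover (set_typeP w).
  - by move=> w [a [b c]] /= abc it; rewrite (gE _ _ _ _ abc it).
split; last first.
  move=> p /(boundaryE K_disk K_convex)[_ nKp]; apply: val_inj.
  exact: pl_boundary.
split; first by exists g; split => // p; apply: fi; rewrite gK.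
move=> s sT; have [a [b [c [abc sub]]]] := simplex_in_triangle sT.
have [M [v Mv]] := transport_affine px py X Y a b c.
exists M, v => p /sub tp; rewrite -Mv /= /pl.
exact: pl_mapE.
Qed.

(** Affinity recovers [f] from the vertices. For the areas, injectivity excludes the value zero, and
    a degree count excludes negative values. *)
Theorem homeo_pl (f : set_type K -> set_type K) : SL_homeo_rel_boundary K T f ->
  let X v := xc (\val (f (vertex K_disk v))) in
  let Y v := yc (\val (f (vertex K_disk v))) in
  admissible O B px py X Y /\ forall p, \val (f p) = pl X Y p.
Proof.
move=> [[[g [fK gK cf cg]] faff] fB] X Y.
have XB v : B v -> X v = px v /\ Y v = py v.
  move=> /asboolP Bv; rewrite /X /Y fB//.
  by apply/(boundaryE K_disk K_convex); split => //; exact: vertex_in.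
have fE p a b c : O a b c -> vtri a b c (\val p) ->
    \val (f p) = transport px py X Y a b c (\val p).
  move=> abc tp; have [tT D0] := andP (abc : is_tri T (\val a) (\val b) (\val c)).
  have [M [w Mw]] := faff _ tT; rewrite hull_tri// in Mw.
  have vE u : vtri a b c (\val u) -> pt (X u) (Y u) = \val u *m M + w.
    move=> tu; rewrite -[\val u]/(\val (vertex K_disk u)) -Mw//.
    by apply: planeP; rewrite !coordE.
  have ta := vtri_vertex abc.
  have tb : vtri a b c (\val b) by exact: (vtri_rot (vtri_rot (vtri_vertex (cx_rot DC abc)))).
  have tc : vtri a b c (\val c) by exact: (vtri_rot (vtri_vertex (cx_rot2 DC abc))).
  have pE := transport_id K_disk K_convex (\val p) abc.
  pose k z := z / area px py a b c.
  have comb (Z W : V -> R) : transport px py Z W a b c (\val p) =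
      k (sd px py b c (\val p)) *: pt (Z a) (W a) + k (sd px py c a (\val p)) *: pt (Z b) (W b) +
      k (sd px py a b (\val p)) *: pt (Z c) (W c).
    by rewrite /transport /k; apply: planeP; rewrite !coordE !mulrDl ![_ / _ * _]mulrAC.
  have ptv u : pt (px u) (py u) = \val u by apply: planeP; rewrite !coordE.
  rewrite comb !vE// Mw// -[in LHS]pE comb !ptv !mulmxDl -!scalemxAl !scalerDr.
  have k1 : k (sd px py b c (\val p)) + k (sd px py c a (\val p)) + k (sd px py a b (\val p)) = 1.
    by rewrite /k -!mulrDl sd_sum divff// posN.
  rewrite -[in LHS](scale1r w) -k1 !scalerDl.
  by rewrite !addrA; apply: planeP; rewrite !(xcD, ycD); ring.
have fpl p : \val (f p) = pl X Y p.
  have [a [b [c [abc tp]]]] := located K_disk K_convex (set_typeP p).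
  by rewrite (fE p a b c abc tp) /pl (pl_mapE K_disk K_convex X Y abc tp).
split => //; split => //.
(* Zero area gives a nonzero [d] killed by the linear part of [f] on the triangle; two points
   differing by a multiple of [d] would have the same image. *)
have nd a b c : O a b c -> area X Y a b c != 0.
  move=> abc; apply/eqP => D0; have [tT D1] := andP (abc : is_tri T (\val a) (\val b) (\val c)).
  have [l [m [lm e1 e2]]] : exists l m : R, [/\ (l != 0) || (m != 0),
      l * (X b - X a) + m * (X c - X a) = 0 & l * (Y b - Y a) + m * (Y c - Y a) = 0].
    move: D0; rewrite /area /cross => D0.
    have [H|] := boolP ((X c - X a != 0) || (X b - X a != 0)).
      by exists (X c - X a), (- (X b - X a)); rewrite oppr_eq0; split => //; [ring|lra].
    rewrite negb_or !negbK => /andP[/eqP h1 /eqP h2].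
    have [H|] := boolP ((Y c - Y a != 0) || (Y b - Y a != 0)).
      by exists (Y c - Y a), (- (Y b - Y a)); rewrite oppr_eq0; split => //; [lra|ring].
    rewrite negb_or !negbK => /andP[/eqP h3 /eqP h4].
    by exists 1, 0; rewrite oner_eq0 h1 h2 h3 h4; split => //; ring.
  have og := centroid_otri D1; set g0 := 3^-1 *: _ in og.
  pose d := l *: (\val b - \val a) + m *: (\val c - \val a).
  have [e e0 He] := open_ray d (@otri_open _ _ _ _) og.
  have e2' : 0 < e / 2 by rewrite divr_gt0.
  have t1 : vtri a b c (g0 + (e / 2) *: d).
    by apply/otri_tri/He; rewrite gtr0_norm// ltr_pdivrMr// mulr2n mulrDr mulr1 ltrDl.
  have t0 : vtri a b c g0 by exact/otri_tri.
  have K0 : K g0 by exact: (is_tri_sub K_disk abc).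
  have K1 : K (g0 + (e / 2) *: d) by exact: (is_tri_sub K_disk abc).
  have : f (to_set_type K1) = f (to_set_type K0).
    apply: val_inj; rewrite (fE (to_set_type K1) a b c abc t1) (fE (to_set_type K0) a b c abc t0) /=.
    have tr (Z : V -> R) : l * (Z b - Z a) + m * (Z c - Z a) = 0 ->
      sd px py b c (g0 + (e / 2) *: d) * Z a + sd px py c a (g0 + (e / 2) *: d) * Z b +
      sd px py a b (g0 + (e / 2) *: d) * Z c =
      sd px py b c g0 * Z a + sd px py c a g0 * Z b + sd px py a b g0 * Z c.
      move=> lmZ; apply/eqP; rewrite -subr_eq0; apply/eqP.
      transitivity ((e / 2) * area px py a b c * (l * (Z b - Z a) + m * (Z c - Z a))).
        by rewrite /d /sd /side /area /cross !coordE /px /py /vx /vy; ring.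
      by rewrite lmZ mulr0.
    by rewrite /transport !tr.
  move=> /(can_inj fK)/(congr1 \val) /= E.
  have : d = 0.
    have /eqP : (e / 2) *: d = 0 by apply: (addrI g0); rewrite E addr0.
    by rewrite scaler_eq0 gt_eqF//= => /eqP.
  move=> d0; have dx : xc d = 0 by rewrite d0 /xc mxE.
  have dy : yc d = 0 by rewrite d0 /yc mxE.
  move: dx dy; rewrite /d !coordE -/(vx _) -/(vx _) => dx dy.
  have D := posN abc.
  have lD : l * area px py a b c = 0.
    transitivity ((l * (px b - px a) + m * (px c - px a)) * (py c - py a) -
      (l * (py b - py a) + m * (py c - py a)) * (px c - px a)).
      by rewrite /area /cross; ring.
    by rewrite [X in X * _ - _]dx [X in _ - X * _]dy !mul0r subrr.
  have mD : m * area px py a b c = 0.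
    transitivity ((l * (py b - py a) + m * (py c - py a)) * (px b - px a) -
      (l * (px b - px a) + m * (px c - px a)) * (py b - py a)).
      by rewrite /area /cross; ring.
    by rewrite [X in X * _ - _]dy [X in _ - X * _]dx !mul0r subrr.
  move/eqP: lD; rewrite mulf_eq0 (negbTE D) orbF => l0.
  move/eqP: mD; rewrite mulf_eq0 (negbTE D) orbF => m0.
  by rewrite l0 m0 in lm.
move=> a b c abc; have [tT D1] := andP (abc : is_tri T (\val a) (\val b) (\val c)).
have tr : is_tri T (\val a) (\val b) (\val c) by exact: abc.
pose U := transport X Y px py a b c @^-1` otri (\val a) (\val b) (\val c).
have oU : open U.
  have /continuousP := @transport_cont _ _ X Y px py a b c; apply; exact: otri_open.
have U0 : U !=set0.
  exists (transport px py X Y a b c (3^-1 *: (\val a + \val b + \val c))).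
  rewrite /U /= transportK ?posN ?nd//; exact: centroid_otri.
have [r [Ur g1 g2]] := exists_generic posN nd oU U0.
pose x := transport X Y px py a b c r; have ox : otri (\val a) (\val b) (\val c) x by [].
have tx : vtri a b c x by exact: otri_tri.
have Kx : K x by exact: (is_tri_sub K_disk tr tx).
have fr : \val (f (to_set_type Kx)) = r.
  by rewrite (fE (to_set_type Kx) a b c abc tx) transportK ?nd ?posN.
have Kr : K r by rewrite -fr; exact: set_typeP.
(* The signs of the areas are still unknown, but by [stokes] the total degree at [r] is positive, so
   some triangle covers [r] positively. *)
have [[a' [b' c']] /covers_oitri[abc' oi]] : exists t, covers O X Y r t.
  apply: contrapT => no.
  have [t Ct] := proj1 (covers_reference g1) Kr.
  have : 0 < (#|covers O px py r|%:R : R) by rewrite ltr0n; apply/card_gt0P; exists t.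
  rewrite -sum_inside_covers// -(stokes DC g1 g2 XB) ltNge => /negP; apply.
  apply: sumr_le0 => u _; apply: sumr_le0 => -[v w] /= uvw.
  rewrite /inside /signed_inside.
  have [/and3P[s1 s2 s3]|_] := boolP [&& 0 < _, 0 < _ & 0 < _]; last first.
    by rewrite sub0r oppr_le0 ler0n.
  by exfalso; apply: no; exists (u, (v, w)); apply/and4P.
have D' : 0 < area X Y a' b' c'.
  case: oi => s1 s2 s3; rewrite -(sd_sum X Y a' b' c' r).
  by apply: addr_gt0 => //; exact: addr_gt0.
pose x' := transport X Y px py a' b' c' r.
have ta' : is_tri T (\val a') (\val b') (\val c') by exact: abc'.
have tx' : vtri a' b' c' x'.
  have [e1 e2 e3] := sd_transport_rot px py r (nd _ _ _ abc').
  have sgn (s s' : R) : s * area X Y a' b' c' = s' * area px py a' b' c' -> 0 < s' -> 0 <= s.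
    by move=> E s'0; rewrite -(pmulr_lge0 _ D') E mulr_ge0// ltW// pos.
  by case: oi => s1 s2 s3; split; [apply: sgn e1 s1|apply: sgn e2 s2|apply: sgn e3 s3].
have Kx' : K x' by exact: (is_tri_sub K_disk ta' tx').
have fr' : \val (f (to_set_type Kx')) = r.
  by rewrite (fE (to_set_type Kx') a' b' c' abc' tx') transportK ?nd ?posN.
(* Injectivity identifies the two preimages of [r], so the positively placed triangle is the given
   one up to rotation. *)
have xx' : x = x'.
  by have /val_inj/(can_inj fK)/(congr1 \val) : \val (f (to_set_type Kx)) =
    \val (f (to_set_type Kx')) by rewrite fr fr'.
rewrite -xx' in tx'.
case: (otri_inj K_disk tr ta' ox tx') => -[/val_inj e1 /val_inj e2 /val_inj e3].
- by move: D'; rewrite e1 e2 e3.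
- by rewrite e1 e2 e3 area_rot.
- by rewrite e1 e2 e3 2!area_rot.
Qed.

End Homeomorphisms.

(** * The parametrization *)

Section CompactOpen.
Context {X Y : topologicalType}.

Lemma cont_eval (x : X) : continuous (fun f : {compact-open, X -> Y} => f x).
Proof.
apply/continuousP => U oU.
have := compact_open_open (@compact_set1 X x) oU; congr open.
apply/seteqP; split=> [f /= fU|f /= fU _ [_ -> <-]] //.
by apply: fU; exists x.
Qed.

Lemma cont_curry (Z : topologicalType) (F : Z -> X -> Y) :
  continuous (fun p : Z * X => F p.1 p.2) ->
  continuous (F : Z -> {compact-open, X -> Y}).
Proof. by move=> cF; exact: (proj1 (continuous_curry cF)). Qed.

End CompactOpen.

Section Coordinates.
Context {R : realType}.
Notation plane := 'rV[R]_2.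
Variables (K : set plane) (T : {fset {fset plane}}).
Hypothesis K_disk : SL_disk K T.
Hypothesis K_convex : convex_set K.
Let V : finType := vset T.
Let B : pred V := @bdry_vertex R K T.

Lemma interior_verticesP p :
  interior_vertices K T p <-> exists2 v : V, ~~ B v & \val v = p.
Proof.
split=> [[pT nb]|[v Bv <-]].
  have pv : p \in vset T by rewrite (vset1 K_disk).
  exists [` pv]%fset => //; apply/asboolP => nK; apply: nb.
  by apply/(boundaryE K_disk K_convex); split => //; exact: (vertex_in K_disk [` pv]%fset).
split; first by rewrite -(vset1 K_disk); exact: (valP v).
by move=> /(boundaryE K_disk K_convex)[_ nK]; move/asboolP: Bv; apply.
Qed.

Lemma enumerate_interior m : (interior_vertices K T #= `I_m)%card ->
  exists e : 'I_m -> V, injective e /\ forall v, ~~ B v <-> exists i, e i = v.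
Proof.
rewrite card_eq_sym => /card_set_bijP[f [fM fI fS]].
have /choice[e eP] (i : 'I_m) : exists v : V, ~~ B v /\ \val v = f i.
  by have /interior_verticesP[v Bv vE] := fM _ (ltn_ord i); exists v.
exists e; split=> [i j eij|v].
  apply/val_inj/fI; rewrite ?inE /=; try exact: ltn_ord.
  by rewrite -(proj2 (eP i)) -(proj2 (eP j)) eij.
split=> [Bv|[i <-]]; last exact: (proj1 (eP i)).
have [|k /= km fk] := fS (\val v); first by apply/interior_verticesP; exists v.
by exists (Ordinal km); apply: val_inj; rewrite (proj2 (eP _)).
Qed.

End Coordinates.

(** * Coordinates indexed by interior vertices *)

Section ParameterSpace.
Context {R : realType} {V : finType} {m : nat}.
Variables (B : pred V) (e : 'I_m -> V).
Hypothesis e_inj : injective e.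
Hypothesis eP : forall v, ~~ B v <-> exists i, e i = v.

(** Row 0 of the underlying matrix with two rows holds height parameters, row 1 directions. As a sum
    over indices this is 0 at boundary vertices and visibly continuous. *)
Definition coord (k : 'I_2) (v : V) (q : 'rV[R]_(2 * m)) : R :=
  \sum_i (e i == v)%:R * q 0 (mxvec_index k i).

Definition of_coords (p d : V -> R) : 'rV[R]_(2 * m) :=
  mxvec (\matrix_(k < 2, i < m) if k == 0 then p (e i) else d (e i)).

Lemma coord_cont k v : continuous (coord k v).
Proof.
by apply: cont_sum => i; apply: contM; [exact: cont_cst|exact: coord_continuous].
Qed.

Lemma coord_e k i q : coord k (e i) q = q 0 (mxvec_index k i).
Proof.
rewrite /coord (bigD1 i)//= eqxx mul1r big1 ?addr0// => j /negbTE ji.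
by rewrite (inj_eq e_inj) ji mul0r.
Qed.

Lemma coordB k v q : B v -> coord k v q = 0.
Proof.
move=> Bv; apply: big1 => i _; case: eqP => [ev|]; last by rewrite mul0r.
by have := proj2 (eP v) (ex_intro _ i ev); rewrite Bv.
Qed.

Lemma coord_of_coords k p d v : ~~ B v ->
  coord k v (of_coords p d) = if k == 0 then p v else d v.
Proof. by move=> /eP[i <-]; rewrite coord_e mxvecE mxE. Qed.

Lemma of_coordsK q : of_coords (coord 0 ^~ q) (coord 1 ^~ q) = q.
Proof.
apply/rowP => j; case/mxvec_indexP: j => k i; rewrite mxvecE mxE !coord_e.
case: eqP => [-> //|k0]; congr (q 0 (mxvec_index _ _)).
by apply/val_inj; move: k k0 => [[|[|//]] ?] //= /eqP; rewrite -val_eqE.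
Qed.

Lemma of_coords_ext p d p' d' : (forall v, ~~ B v -> p v = p' v) ->
  (forall v, ~~ B v -> d v = d' v) -> of_coords p d = of_coords p' d'.
Proof.
move=> pp dd; congr mxvec; apply/matrixP => k i; rewrite !mxE.
have Bi : ~~ B (e i) by apply/eP; exists i.
by rewrite pp// dd.
Qed.

Lemma of_coords_cont (Z : topologicalType) (p d : Z -> V -> R) :
  (forall v, ~~ B v -> continuous (p ^~ v)) ->
  (forall v, ~~ B v -> continuous (d ^~ v)) ->
  continuous (fun z => of_coords (p z) (d z)).
Proof.
move=> cp cd; apply: cont_mx => o j; rewrite (ord1 o).
case/mxvec_indexP: j => k i.
have Bi : ~~ B (e i) by apply/eP; exists i.
rewrite (_ : (fun z => _) = fun z => if k == 0 then p z (e i) else d z (e i)).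
  by case: (k == 0); [exact: cp|exact: cd].
by apply/funext => z; rewrite mxvecE mxE.
Qed.

End ParameterSpace.

Theorem theorem2 (R : realType) (K : set 'rV[R]_2)
    (T : {fset {fset 'rV[R]_2}}) (m : nat)
    (K_disk : SL_disk K T)
    (K_convex : convex_set K)
    (interior_verticesE : (interior_vertices K T #= `I_m)%card) :
  homeomorphic (set_type (SL_homeo_rel_boundary K T)) 'rV[R]_(2 * m).
Proof.
have [e [e_inj eP]] := enumerate_interior K_disk K_convex interior_verticesE.
pose DC := tris_disk_complex K_disk K_convex.
have [V0] : inhabited (vset T).
  have [o /interior_subset Ko] := interior_point K_disk K_convex.
  by have [a _] := located K_disk K_convex Ko.
have [X [Y [enc [XYc adm encK decK enc_cont]]]] := configuration_chart DC V0
  (@coord_cont R _ m e 0) (@coord_cont R _ m e 1) (fun v q => @coordB R _ m _ e eP 1 v q)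
  (fun p d v => coord_of_coords e_inj eP 0 p d (v := v))
  (fun p d v => coord_of_coords e_inj eP 1 p d (v := v))
  (of_coordsK e_inj) (of_coords_ext eP) (@of_coords_cont _ _ _ _ _ eP).
pose E := set_type (SL_homeo_rel_boundary K T).
pose fx (f : E) v := xc (\val ((\val f : set_type K -> set_type K) (vertex K_disk v))).
pose fy (f : E) v := yc (\val ((\val f : set_type K -> set_type K) (vertex K_disk v))).
have fadm (f : E) : admissible (@tris R T) (@bdry_vertex R K T) (@vx R T) (@vy R T) (fx f) (fy f).
  exact: (proj1 (homeo_pl K_disk K_convex (set_typeP f))).
have fE (f : E) (p : set_type K) : \val ((\val f : set_type K -> set_type K) p) =
    pl_map K_disk K_convex (fx f) (fy f) p.
  by have [_] := homeo_pl K_disk K_convex (set_typeP f); apply.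
have /choice[g gE] q : exists f : E, forall p,
    \val ((\val f : set_type K -> set_type K) p) = pl_map K_disk K_convex (X q) (Y q) p.
  have [f [Ef fq]] := pl_homeo K_disk K_convex (adm q).
  by exists (to_set_type Ef).
have fgx q : fx (g q) = X q by apply/funext => v; rewrite /fx gE pl_map_vertex xc_pt.
have fgy q : fy (g q) = Y q by apply/funext => v; rewrite /fy gE pl_map_vertex yc_pt.
(* Evaluation is continuous for the compact-open topology; at the vertices it yields continuity of
   the encoding. *)
have ev p : continuous (fun f : E => \val ((\val f : set_type K -> set_type K) p)).
  have c1 : continuous (fun f : E => (\val f : {compact-open, set_type K -> set_type K}) p).
    exact: (cont_comp (@cont_val _ _) (@cont_eval _ _ p)).
  exact: (cont_comp c1 (@cont_val _ _)).
exists (fun f => enc (fx f) (fy f)), g; split.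
- move=> f; have [eX eY] := decK _ _ (fadm f).
  by apply/val_inj/funext => p; apply/val_inj; rewrite gE eX eY fE.
- by move=> q; rewrite fgx fgy encK.
- apply: enc_cont => // v.
    exact: (cont_comp (ev (vertex K_disk v)) (@xc_cont _)).
  exact: (cont_comp (ev (vertex K_disk v)) (@yc_cont _)).
(* Joint continuity of the piecewise affine map in parameter and point becomes continuity into the
   function space by currying. *)
- apply: cont_set_type.
  apply: (@cont_curry _ _ _ (fun q => (\val (g q) : set_type K -> set_type K))).
  apply: cont_set_type.
  rewrite (_ : (fun p => _) = fun p : 'rV[R]_(2 * m) * set_type K =>
    pl_map K_disk K_convex (X p.1) (Y p.1) p.2); last by apply/funext => p; exact: gE.
  have c1 : continuous (fst : 'rV[R]_(2 * m) * set_type K -> _) by move=> w; exact: cvg_fst.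
  have c2 : continuous (snd : 'rV[R]_(2 * m) * set_type K -> _) by move=> w; exact: cvg_snd.
  apply: pl_map_cont => //.
  + by move=> v; exact: (cont_comp c1 (proj1 (XYc v))).
  + by move=> v; exact: (cont_comp c1 (proj2 (XYc v))).
Qed.
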